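(* Let $\alpha>0$ and $\nu>-1$. Then for $z\in\mathbb C$ $$e^{-\alpha z/4}I_\nu(\sqrt z)=\frac{\alpha^2e^{1/(4\alpha)}}{3\pi2^3}\int_{\mathbb C}I_\nu\left(\frac\alpha2\sqrt{z\overline u}\right)I_\nu\left(\frac{\sqrt u}{2}\right)e^{-\frac16\alpha\,\mathrm{Re}\,u}\,K_\nu\left(\frac{\alpha|u|}{3}\right)d\sigma(u).$$
   Context: $I_\nu$ is the modified Bessel function of the first kind, $K_\nu$ is the MacDonald function (modified Bessel function of the second kind), $d\sigma$ is planar Lebesgue measure on $\mathbb C$. Branches of roots and powers are principal, taken consistently: $\sqrt{z\overline u}=\sqrt z\,\overline{\sqrt u}$, and in $I_\nu(w)=w^\nu\cdot(\text{even entire function of }w)$ one takes $(\sqrt z\,\overline{\sqrt u})^\nu=(\sqrt z)^\nu\,\overline{(\sqrt u)^\nu}$ (equivalently, the identity is understood after cancelling $z^{\nu/2}=(\sqrt z)^\nu$, where both sides become entire in $z$). *)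

(* Defs.v *)
From HB Require Import structures.
From mathcomp Require Import all_boot all_order all_algebra.
From mathcomp Require Import complex.
From mathcomp Require Import all_classical all_reals all_analysis.
Import Order.TTheory GRing.Theory Num.Theory.
Import numFieldNormedType.Exports.

Set Implicit Arguments.
Unset Strict Implicit.
Unset Printing Implicit Defensive.

Local Open Scope classical_set_scope.
Local Open Scope ring_scope.
Local Open Scope complex_scope.

Section Complex.
Context {R : realType}.
Implicit Types (z w : R[i]) (f : R[i] -> R[i]).

Definition cabs z : R := ComplexField.Normc.normc z.

(* The principal argument, with values in ]-pi, pi]; by convention [carg 0] is
   [acos 0 = pi / 2], a value that plays no role in [cpow]. *)
Definition carg z : R :=
  let t := acos (complex.Re z / cabs z) in if 0 <= complex.Im z then t else - t.

Definition cexp z : R[i] :=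
  (expR (complex.Re z) * cos (complex.Im z)) +i*
  (expR (complex.Re z) * sin (complex.Im z)).

(* The principal power [z ^ s] for a real exponent [s]. Since [powR 0 s] is
   [(s == 0)%:R], one has [cpow 0 0 = 1] and [cpow 0 s = 0] for [s != 0], also
   when [s < 0]. *)
Definition cpow z (s : R) : R[i] :=
  (cabs z `^ s * cos (s * carg z)) +i* (cabs z `^ s * sin (s * carg z)).

(* Planar Lebesgue measure: R[i] is identified with the plane R * R through
   (x, y) |-> x +i* y. *)
Definition planar : set (measurableTypeR R * measurableTypeR R) -> \bar R :=
  (@lebesgue_measure R \x @lebesgue_measure R)%E.

Definition cintegrable f : Prop :=
  planar.-integrable setT (fun p => (complex.Re (f (p.1 +i* p.2)))%:E) /\
  planar.-integrable setT (fun p => (complex.Im (f (p.1 +i* p.2)))%:E).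

Definition cintegral f : R[i] :=
  (\int[planar]_p complex.Re (f (p.1 +i* p.2))) +i*
  (\int[planar]_p complex.Im (f (p.1 +i* p.2))).

End Complex.

Section Bessel.
Context {R : realType}.
Implicit Types (nu x : R) (w : R[i]).

(* Euler's integral, used below only for [0 < x]. *)
Definition Gamma x : R :=
  \int[@lebesgue_measure R]_(t in `]0, +oo[) (t `^ (x - 1) * expR (- t)).

(* The even entire function [w ^ (- nu) * I_nu w], that is
   2 ^ (- nu) * \sum_k (w ^ 2 / 4) ^ k / (k! * Gamma (nu + k + 1)). *)
Definition besselI_entire nu w : R[i] :=
  (2 `^ (- nu))%:C *
  limn (series (fun k : nat =>
    (w ^+ 2 / 4) ^+ k / (k`!%:R * Gamma (nu + k%:R + 1))%:C : R[i]^o)).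

Definition besselI nu w : R[i] := cpow w nu * besselI_entire nu w.

Definition cosh x : R := (expR x + expR (- x)) / 2.

(* The Macdonald function K_nu on the positive half-line, for an arbitrary real
   order (integers included), by its integral representation. *)
Definition besselK nu x : R :=
  \int[@lebesgue_measure R]_(t in `[0, +oo[)
    (expR (- (x * cosh t)) * cosh (nu * t)).

End Bessel.

(* Main.v *)
(* For x > 0 the number 2 (x/2)^nu K_nu(x) is the integral of
   exp(nu t - e^t - (x^2/4) e^(-t)) over t in R. Since conj(sqrt u)^nu (sqrt u)^nu
   is |u|^nu, the weight of the identity is therefore, up to a constant, exp(h Re u)
   times a mixture over t of the Gaussians exp(- q |u|^2 e^(-t)), where
   h = - alpha/6 and q = (alpha/6)^2. For a single Gaussian the moments of
   u^j conj(u)^k are finite sums, and integrating them in t turns the powers of e^t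
   into values of Gamma. Expanding I_nu(sqrt u / 2) and summing over j, Vandermonde's
   identity for ratios of Gamma makes the inner sums exponential series; the moment of
   conj(u)^k is left as a finite sum, which is a coefficient of the Cauchy product of
   an exponential series and a Bessel series, so that the expansion of the other
   Bessel factor sums to the left-hand side. Both exchanges of sum and integral are
   dominated: a Bessel series in u is O(exp(eps |u|)) for every eps > 0, while
   exp(g |Re u| + g |Im u|) is integrable against the mixture as soon as
   g^2 < 2 q. *)

(* The computation is done for general h, q and a real factor b in the argument of the second Bessel
   series. The controlling quantity is w = h^2 / (4 q): over the plane, exp(h Re u) times one
   Gaussian integrates to (pi / q) e^t exp(w e^t), so the remaining integral in t converges exactly
   when nu + 1 > 0 and w < 1. The stated constants give w = 1/4; the power of 1 - w = 3/4 this
   produces cancels against the other constants, and the exponential left by the inner sum over j is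
   exp(- 1 / (4 alpha)), which the prefactor exp(1 / (4 alpha)) compensates. The two series are
   exchanged with the integral one after the other, never as a double series, so that each exchange
   needs only a bound for partial sums of one factor times a bound for the other. The origin is
   exceptional: for nu <= 0 the mixture diverges at u = 0, and the conventional values of the
   integrand there need not match. Integrands are therefore compared only off the origin, which is a
   null set. *)
Require Import Defs.
From HB Require Import structures.
From mathcomp Require Import all_boot all_order all_algebra.
From mathcomp Require Import complex ring lra.
From mathcomp Require Import all_classical all_reals all_analysis.
From mathcomp Require Import measurable_realfun.
Import Order.TTheory GRing.Theory Num.Theory Num.Def.
Import numFieldNormedType.Exports.

Set Implicit Arguments.
Unset Strict Implicit.
Unset Printing Implicit Defensive.

Local Open Scope classical_set_scope.
Local Open Scope ring_scope.
Local Open Scope complex_scope.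

(** * Integrals over the real line *)

Section RealLine.
Context {R : realType}.
Local Notation mu := (@lebesgue_measure R).

Lemma symitv_ndseq : nondecreasing_seq (fun n : nat => `[- n%:R, n%:R]%classic : set R).
Proof.
move=> m n mn; apply/subsetPset => x /=; rewrite !in_itv/= => /andP[h1 h2].
have := mn; rewrite -(ler_nat R) => mnR; apply/andP; split; lra.
Qed.

Lemma symitv_bigcup : \bigcup_n (`[- n%:R, n%:R]%classic : set R) = setT.
Proof.
apply/seteqP; split=> // x _.
exists (truncn `|x|).+1 => //=; rewrite in_itv/= -ler_norml ltW//.
exact: truncnS_gt.
Qed.

Lemma is_derive_continuous (F f : R -> R) :
  (forall x : R, is_derive x 1 F (f x)) -> continuous F.
Proof.
by move=> dF x; apply/differentiable_continuous/derivable1_diffP; have [] := dF x.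
Qed.

Lemma integral_derive_itv (F f : R -> R) (a b : R) :
  a < b -> (forall x : R, is_derive x 1 F (f x)) -> continuous f ->
  (\int[mu]_(x in `[a, b]) (f x)%:E = (F b - F a)%:E)%E.
Proof.
move=> ab dF cf; have cF := is_derive_continuous dF.
rewrite (@continuous_FTC2 _ f F)//.
- exact: continuous_subspaceT.
- split.
  + by move=> x _; have [] := dF x.
  + by apply: cvg_at_right_filter; exact: cF.
  + by apply: cvg_at_left_filter; exact: cF.
- by move=> x _; rewrite derive1E; have [] := dF x.
Qed.

Lemma cvg_integral_symitv (f : measurableTypeR R -> \bar R) :
  mu.-integrable setT f ->
  (\int[mu]_(x in `[(- n%:R)%R, n%:R%R]) f x @[n --> \oo] --> \int[mu]_x f x)%E.
Proof.
move=> fi; have mf : measurable_fun setT f by exact: measurable_int fi.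
under eq_fun do rewrite integral_mkcond.
have := @dominated_convergence _ _ R mu setT measurableT
  (fun n => f \_ `[- (n%:R : R), (n%:R : R)]%classic) f (abse \o f).
case=> //.
- by move=> n; apply/(measurable_restrictT f) => //; exact: measurable_funS mf.
- apply/aeW => x _; apply: cvg_near_cst.
  exists (truncn `|x|).+1 => // n /= hn.
  rewrite patchE mem_set//= in_itv/= -ler_norml.
  apply/ltW/(lt_le_trans (truncnS_gt _)).
  by rewrite ler_nat.
- by apply: integrable_abse.
- apply/aeW => x n _; rewrite /= patchE; case: ifPn => // _.
  by rewrite abse0 abse_ge0.
Qed.

(** Integration by parts on the line, in the form in which the boundary terms vanish. The functional
    equation of [Gamma] and the recursion for Gaussian moments are both instances. *)
Lemma integral_derive_eq0 (F f : R -> R) :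
  (forall x : R, is_derive x 1 F (f x)) -> continuous f ->
  mu.-integrable setT (EFin \o f) ->
  F x @[x --> +oo] --> (0 : R) -> F x @[x --> -oo] --> (0 : R) ->
  (\int[mu]_x (f x)%:E = 0)%E.
Proof.
move=> dF cf fi Fy FNy.
have := cvg_integral_symitv fi => /= h.
suff h0 : (\int[mu]_(x in `[(- n%:R)%R, n%:R%R]) (f x)%:E @[n --> \oo] --> (0 : \bar R))%E.
  exact: (cvg_unique _ h h0).
(* At n = 0 the interval is a point, while the fundamental theorem is stated for a < b; hence the
   shift of the index. *)
rewrite -(cvg_shiftS (fun n : nat => \int[mu]_(x in `[(- n%:R)%R, n%:R%R]) (f x)%:E)%E)/=.
under eq_fun.
  move=> n; rewrite (integral_derive_itv _ dF cf); last by rewrite gtrN ?ltr0n.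
  over.
apply: cvg_EFin; first exact: nearW.
rewrite -(subr0 (0 : R)); apply: cvgB.
- apply: (cvg_comp _ F _ Fy).
  by apply/cvgrnyP; rewrite (cvg_shiftS id); exact: cvg_id.
- apply: (cvg_comp _ F _ FNy).
  by apply/cvgNrNy/cvgrnyP; rewrite (cvg_shiftS id); exact: cvg_id.
Qed.

(** [G] may be singular at 0, as in Euler's integral with x < 1. The substitution is made on the
    compact intervals [e^(-n), e^n], which exhaust the half-line, and both sides pass to the limit
    by monotone convergence. *)
Lemma integral_comp_expR (G : R -> R) :
  {in `]0, +oo[, continuous G} -> (forall x, 0 < x -> 0 <= G x) ->
  (\int[mu]_(x in `]0%R, +oo[) (G x)%:E = \int[mu]_t (G (expR t) * expR t)%:E)%E.
Proof.
move=> cG G0.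
have cexp : continuous (fun t : R => G (expR t) * expR t).
  move=> t; apply: cvgM; last exact: continuous_expR.
  apply: continuous_comp; first exact: continuous_expR.
  by apply: cG; rewrite in_itv/= andbT expR_gt0.
have e1 : (\int[mu]_(x in `[expR (- n%:R), expR n%:R]) (G x)%:E @[n --> \oo]
    --> \int[mu]_(x in `]0%R, +oo[) (G x)%:E)%E.
  have -> : `]0, +oo[%classic = \bigcup_n `[expR (- n%:R), expR n%:R]%classic :> set R.
    apply/seteqP; split=> x /=; rewrite in_itv/=.
      rewrite andbT => x0; have : [set: R] (ln x) by [].
      rewrite -symitv_bigcup => -[n _ /=]; rewrite in_itv/= => /andP[h1 h2].
      by exists n => //=; rewrite in_itv/= -(lnK x0) !ler_expR h1.
    move=> [n _ /=]; rewrite in_itv/= andbT => /andP[h _].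
    by apply: lt_le_trans h; exact: expR_gt0.
  apply: ge0_nondecreasing_set_cvg_integral => //=.
  - move=> m n mn; apply/subsetPset => x /=; rewrite !in_itv/= => /andP[h1 h2].
    have := mn; rewrite -(ler_nat R) => mnR; apply/andP; split.
      by apply: le_trans h1; rewrite ler_expR lerN2.
    by apply: (le_trans h2); rewrite ler_expR.
  - move=> n; apply/measurable_EFinP; apply: subspace_continuous_measurable_fun => //.
    apply: continuous_in_subspaceT => x /set_mem/=; rewrite in_itv/= => /andP[h _].
    by apply: cG; rewrite in_itv/= andbT (lt_le_trans (expR_gt0 _) h).
  - move=> n x; rewrite in_itv/= => /andP[h _]; rewrite lee_fin G0//.
    by rewrite (lt_le_trans (expR_gt0 _) h).
have e2 : (\int[mu]_(t in `[(- n%:R)%R, n%:R%R]) (G (expR t) * expR t)%:E @[n --> \oo]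
    --> \int[mu]_t (G (expR t) * expR t)%:E)%E.
  rewrite -symitv_bigcup.
  apply: ge0_nondecreasing_set_cvg_integral => //=.
  - exact: symitv_ndseq.
  - move=> n; apply/measurable_EFinP; apply: measurable_funS (continuous_measurable_fun cexp) => //.
  - by move=> n x _; rewrite lee_fin mulr_ge0 ?expR_ge0// G0// expR_gt0.
apply: (cvg_unique _ e1) => //.
suff -> : (fun n : nat => \int[mu]_(x in `[expR (- n%:R), expR n%:R]) (G x)%:E)%E =
  (fun n : nat => \int[mu]_(t in `[(- n%:R)%R, n%:R%R]) (G (expR t) * expR t)%:E)%E by [].
have dexp : derive1 (expR : R -> R) = expR.
  by apply/funext => x; rewrite derive1E; apply: derive_val.
apply/funext => n; rewrite (@integration_by_substitution_increasing _ expR)//=.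
- by apply: eq_integral => x _; rewrite dexp.
- by apply: (@le_trans _ _ 0); rewrite ?oppr_le0 ?ler0n.
- by move=> x y _ _; rewrite ltr_expR.
- by rewrite dexp => x _; exact: continuous_expR.
- apply/cvg_ex; exists (expR (- n%:R)).
  by rewrite dexp; apply: cvg_at_right_filter; exact: continuous_expR.
- apply/cvg_ex; exists (expR (n%:R)).
  by rewrite dexp; apply: cvg_at_left_filter; exact: continuous_expR.
- split.
  + by move=> x _; exact: derivable_expR.
  + by apply: cvg_at_right_filter; exact: continuous_expR.
  + by apply: cvg_at_left_filter; exact: continuous_expR.
- apply: continuous_in_subspaceT => x /set_mem/=; rewrite in_itv/= => /andP[h _].
  by apply: cG; rewrite in_itv/= andbT (lt_le_trans (expR_gt0 _) h).
Qed.

Lemma ge0_integral_shift (G : R -> R) (a : R) :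
  continuous G -> (forall x, 0 <= G x) ->
  (\int[mu]_x (G x)%:E = \int[mu]_x (G (x + a))%:E)%E.
Proof.
move=> cG G0.
have dF : derive1 (fun x : R => x + a) = cst 1.
  apply/funext => x; rewrite derive1E deriveD// derive_id derive_cst addr0//.
rewrite (@increasing_ge0_integration_by_substitutionT _ (fun x => x + a) G)//.
- by apply: eq_integral => x _; rewrite dF/= mulr1.
- by move=> x y xy; rewrite ltrD2r.
- by rewrite dF; exact: cst_continuous.
- by rewrite dF; exact: is_cvg_cst.
- by rewrite dF; exact: is_cvg_cst.
- exact: cvg_addrr_Ny.
- exact: cvg_addrr.
Qed.

End RealLine.

Section Domination.
Context d (T : measurableType d) (R : realType) (mu : {measure set T -> \bar R}).

Lemma integrable_dominated (f g : T -> R) :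
  measurable_fun setT f -> (forall x, `|f x| <= g x) ->
  mu.-integrable setT (EFin \o g) -> mu.-integrable setT (EFin \o f).
Proof.
move=> mf fg; apply: le_integrable => //; first exact/measurable_EFinP.
by move=> x _ /=; rewrite lee_fin (le_trans (fg x))// ler_norm.
Qed.

Lemma integrable_EFinZl (k : R) (f : T -> R) :
  mu.-integrable setT (EFin \o f) -> mu.-integrable setT (EFin \o (fun x => k * f x)).
Proof. by move=> fi; exact: (integrableZl measurableT k fi). Qed.

Lemma integrable_EFinD (f g : T -> R) :
  mu.-integrable setT (EFin \o f) -> mu.-integrable setT (EFin \o g) ->
  mu.-integrable setT (EFin \o (fun x => f x + g x)).
Proof. by move=> fi gi; exact: (integrableD measurableT fi gi). Qed.

Lemma integrable_EFinB (f g : T -> R) :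
  mu.-integrable setT (EFin \o f) -> mu.-integrable setT (EFin \o g) ->
  mu.-integrable setT (EFin \o (fun x => f x - g x)).
Proof. by move=> fi gi; exact: (integrableB measurableT fi gi). Qed.

End Domination.

(** * Exponential integrals and the Gamma function *)

Section ExpIntegrals.
Context {R : realType}.
Local Notation mu := (@lebesgue_measure R).

Lemma cvg_expR_comp {T : Type} (F : set_system T) {FF : Filter F} (f : T -> R) (l : R) :
  f x @[x --> F] --> l -> expR (f x) @[x --> F] --> expR l.
Proof. by move=> fl; apply: continuous_cvg => //; exact: continuous_expR. Qed.

(** The integrals over [-n, n] are F n - F (- n), at most 2 B, and they increase to the integral
    over the line because f is nonnegative. *)
Lemma ge0_derive_integrable (F f : R -> R) (B : R) :
  (forall x : R, is_derive x 1 F (f x)) -> continuous f ->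
  (forall x, 0 <= f x) -> (forall x, `|F x| <= B) ->
  mu.-integrable setT (EFin \o f).
Proof.
move=> dF cf f0 FB.
have mf : measurable_fun setT (EFin \o f).
  by apply/measurable_EFinP; exact: continuous_measurable_fun.
apply/integrableP; split => //.
under eq_integral do rewrite /= ger0_norm//.
apply: (@le_lt_trans _ _ (B + B)%:E); last exact: ltry.
have h : (\int[mu]_(x in `[(- n%:R)%R, n%:R%R]) (f x)%:E @[n --> \oo]
    --> \int[mu]_x (f x)%:E)%E.
  rewrite -symitv_bigcup; apply: ge0_nondecreasing_set_cvg_integral => //=.
  - exact: symitv_ndseq.
  - by move=> n; exact: measurable_funS mf.
  - by move=> n x _; rewrite lee_fin.
rewrite -(cvg_lim _ h)//; apply: lime_le; first by apply/cvg_ex; eexists; exact: h.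
exists 1%N => // n /= n0; rewrite (integral_derive_itv _ dF)//; last first.
  by rewrite gtrN// ltr0n.
have /ler_normlP[h1 h2] := FB n%:R; have /ler_normlP[h3 h4] := FB (- n%:R).
by rewrite lee_fin; lra.
Qed.

(* The derivative of a bounded function, used as an integrable majorant. *)
Definition logistic_deriv (m t : R) : R := m * expR (m * t) / (1 + expR (m * t)) ^+ 2.

Lemma integrable_logistic_deriv (m : R) : 0 < m ->
  mu.-integrable setT (EFin \o logistic_deriv m).
Proof.
move=> m0; have p0 t : 0 < 1 + expR (m * t) by rewrite addr_gt0 ?expR_gt0.
apply: (@ge0_derive_integrable (fun t => - (1 + expR (m * t))^-1) _ 1).
- move=> x; have n0 : 1 + expR (m * x) != 0 by rewrite gt_eqF.
  pose g t := 1 + expR (m * t).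
  have dg : is_derive x 1 g (m * expR (m * x)).
    rewrite /g; apply: is_derive_eq; rewrite /GRing.scale/=.
    by ring.
  have dV := is_deriveV (f := g) n0 dg.
  have dN := is_deriveN dV; apply: (is_derive_eq dN).
  by rewrite /logistic_deriv /g /GRing.scale/=; field; rewrite gt_eqF.
- move=> t; apply: cvgM; last first.
    apply: cvgV; first by rewrite expf_neq0// gt_eqF.
    by rewrite expr2; apply: cvgM; apply: cvgD; [exact: cvg_cst| |exact: cvg_cst|];
      apply: cvg_expR_comp; apply: cvgM; (exact: cvg_cst || exact: cvg_id).
  by apply: cvgM; [exact: cvg_cst|]; apply: cvg_expR_comp; apply: cvgM;
    (exact: cvg_cst || exact: cvg_id).
- move=> x; rewrite /logistic_deriv divr_ge0// ?mulr_ge0 ?expR_ge0//; exact: ltW.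
- move=> x; rewrite normrN ger0_norm ?invr_ge0 ?ltW//.
  by rewrite invf_lt1// ltrDl expR_gt0.
Qed.

(** By convexity: l e^t lies above its tangent at t = ln (a / l), the point where its slope is a.
    The constant is the maximum of a t - l e^t. *)
Lemma linear_le_expR (a l : R) : 0 < a -> 0 < l ->
  exists C, forall t, a * t <= C + l * expR t.
Proof.
move=> a0 l0; exists (a * (ln (a / l) - 1)) => t.
have al0 : 0 < a / l by rewrite divr_gt0.
have h := expR_ge1Dx (t - ln (a / l)).
have e : l * expR t = a * expR (t - ln (a / l)).
  by rewrite expRB lnK// invf_div; field; rewrite gt_eqF// gt_eqF.
by rewrite e; nra.
Qed.

Lemma linear_le_expR2 (a l q : R) : 0 < l -> 0 < q ->
  exists C, forall t, a * t <= C + l * expR t + q * expR (- t).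
Proof.
move=> l0 q0; have [a0|a0|->] := ltrgtP a 0.
- have [C hC] : exists C, forall t, (- a) * t <= C + q * expR t.
    by apply: linear_le_expR => //; rewrite oppr_gt0.
  exists C => t; have := hC (- t); rewrite mulrNN => /le_trans; apply.
  by rewrite -addrA (addrC (l * _)) addrA lerDl mulr_ge0 ?expR_ge0// ltW.
- have [C hC] : exists C, forall t, a * t <= C + l * expR t by exact: linear_le_expR.
  exists C => t; have := hC t => /le_trans; apply.
  by rewrite lerDl mulr_ge0 ?expR_ge0// ltW.
- exists 0 => t; rewrite mul0r add0r addr_ge0// mulr_ge0 ?expR_ge0//; exact: ltW.
Qed.

Lemma continuous_expR_mixed (a l q : R) :
  continuous (fun t : R => expR (a * t - l * expR t - q * expR (- t))).
Proof.
move=> t; apply: cvg_expR_comp; apply: cvgB; last first.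
  apply: cvgM; first exact: cvg_cst.
  by apply: cvg_expR_comp; apply: cvgN; exact: cvg_id.
apply: cvgB; apply: cvgM; (try exact: cvg_cst); (try exact: cvg_id).
exact: continuous_expR.
Qed.

(** [logistic_deriv m] is comparable to e^(- m |t|). The first bound on g controls t -> -oo and the
    second t -> +oo, so no case split on the sign of t is needed. *)
Lemma expR_le_logistic_deriv (m C0 C1 : R) (g : R -> R) : 0 < m ->
  (forall t, g t <= C0 + m * t) -> (forall t, g t + m * t <= C1) ->
  exists K, forall t, expR (g t) <= K * logistic_deriv m t.
Proof.
move=> m0 h0 h1; exists (2 * (expR C0 + expR C1) / m) => t.
have p0 : 0 < 1 + expR (m * t) by rewrite addr_gt0 ?expR_gt0.
have -> : 2 * (expR C0 + expR C1) / m * logistic_deriv m t =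
    2 * (expR C0 + expR C1) * expR (m * t) / (1 + expR (m * t)) ^+ 2.
  by rewrite /logistic_deriv; field; rewrite !gt_eqF.
rewrite ler_pdivlMr ?exprn_gt0//.
have H0 : expR (g t) <= expR C0 * expR (m * t) by rewrite -expRD ler_expR.
have H1 : expR (g t) * expR (m * t) <= expR C1 by rewrite -expRD ler_expR.
have E0 := expR_gt0 (m * t); have G0 := expR_gt0 (g t).
(* This is (1 + E)^2 <= 2 + 2 E^2 with E = e^(m t); it is the source of the factor 2 in the
   constant. *)
have : expR (g t) * (1 + expR (m * t)) ^+ 2 <=
   2 * expR (g t) + 2 * (expR (g t) * expR (m * t)) * expR (m * t).
  have := sqr_ge0 (1 - expR (m * t)); nra.
move=> /le_trans; apply; rewrite mulrDr mulrDl lerD// -!mulrA ler_pM2l// ?mulrA//.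
by rewrite ler_pM2r.
Qed.

Lemma integrable_expR_mixed (a l q : R) : 0 < l -> 0 < q ->
  mu.-integrable setT (EFin \o (fun t => expR (a * t - l * expR t - q * expR (- t)))).
Proof.
move=> l0 q0.
have [C0 h0] := linear_le_expR2 (a - 1) l0 q0.
have [C1 h1] := linear_le_expR2 (a + 1) l0 q0.
have [K hK] : exists K, forall t,
    expR (a * t - l * expR t - q * expR (- t)) <= K * logistic_deriv 1 t.
  apply: (@expR_le_logistic_deriv 1 C0 C1) => // t.
    by have := h0 t; lra.
  by have := h1 t; lra.
apply: (@integrable_dominated _ (measurableTypeR R) R mu _ (fun t => K * logistic_deriv 1 t)).
- by apply: continuous_measurable_fun; exact: continuous_expR_mixed.
- by move=> t; rewrite ger0_norm ?expR_ge0.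
- by apply: (@integrable_EFinZl _ (measurableTypeR R)); exact: integrable_logistic_deriv.
Qed.

(** At -oo only e^(m t) decays, so the majorant has to be the logistic derivative with the same
    m. *)
Lemma integrable_expR_expR (m l : R) : 0 < m -> 0 < l ->
  mu.-integrable setT (EFin \o (fun t => expR (m * t - l * expR t))).
Proof.
move=> m0 l0; have [C1 h1] : exists C, forall t, (m + m) * t <= C + l * expR t.
  by apply: linear_le_expR => //; rewrite addr_gt0.
have [K hK] : exists K, forall t,
    expR (m * t - l * expR t) <= K * logistic_deriv m t.
  apply: (@expR_le_logistic_deriv m 0 C1) => // t.
    by rewrite add0r gerBl mulr_ge0 ?expR_ge0// ltW.
  by have := h1 t; lra.
apply: (@integrable_dominated _ (measurableTypeR R) R mu _ (fun t => K * logistic_deriv m t)).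
- apply: continuous_measurable_fun => t; apply: cvg_expR_comp; apply: cvgB.
    by apply: cvgM; [exact: cvg_cst|exact: cvg_id].
  by apply: cvgM; [exact: cvg_cst|exact: continuous_expR].
- by move=> t; rewrite ger0_norm ?expR_ge0.
- by apply: (@integrable_EFinZl _ (measurableTypeR R)); exact: integrable_logistic_deriv.
Qed.

Lemma continuous_expR_expR (m l : R) : continuous (fun t : R => expR (m * t - l * expR t)).
Proof.
move=> t; apply: cvg_expR_comp; apply: cvgB.
  by apply: cvgM; [exact: cvg_cst|exact: cvg_id].
by apply: cvgM; [exact: cvg_cst|exact: continuous_expR].
Qed.

Lemma powR_expR (t x : R) : expR t `^ x = expR (x * t).
Proof. by rewrite /powR gt_eqF ?expR_gt0// expRK. Qed.

(** On the whole line, scaling becomes translation and the integral in t of the mixture is visibly a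
    value of [Gamma]. No sign of x is assumed: both sides are [fine] of the same extended
    integral. *)
Lemma GammaE (x : R) : Gamma x = \int[mu]_t expR (x * t - expR t).
Proof.
rewrite /Gamma /Rintegral integral_comp_expR.
- congr fine; apply: eq_integral => t _; congr (_%:E).
  by rewrite powR_expR -!expRD; congr expR; ring.
- move=> s s0; apply: cvgM.
  + have c1 : {for s, continuous (fun y : R => y `^ (x - 1))}.
      by apply/differentiable_continuous/derivable1_diffP; exact: derivable_powR.
    exact: c1.
  + by apply: cvg_expR_comp; apply: cvgN; exact: cvg_id.
- by move=> s s0; rewrite mulr_ge0 ?powR_ge0 ?expR_ge0.
Qed.

(** Translating t by ln l reduces l to 1. Used with l = 1 - w, this is how powers of 1 - w enter. *)
Lemma integral_expR_expR (m l : R) : 0 < m -> 0 < l ->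
  (\int[mu]_t (expR (m * t - l * expR t))%:E = (Gamma m * l `^ (- m))%:E)%E.
Proof.
move=> m0 l0; have i1 := integrable_expR_expR m0 ltr01.
have il := integrable_expR_expR m0 l0.
have e : Gamma m = \int[mu]_t expR (m * t - 1 * expR t).
  by rewrite GammaE; apply: eq_Rintegral => t _; rewrite mul1r.
rewrite e EFinM /Rintegral fineK; last exact: integrable_fin_num.
rewrite (@ge0_integral_shift _ (fun t => expR (m * t - 1 * expR t)) (ln l)); last 2 first.
- exact: continuous_expR_expR.
- by move=> t; exact: expR_ge0.
have -> : (\int[mu]_t (expR (m * (t + ln l) - 1 * expR (t + ln l)))%:E =
    (l `^ m)%:E * \int[mu]_t (expR (m * t - l * expR t))%:E)%E.
  rewrite -(integralZl measurableT il); apply: eq_integral => t _ /=.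
  rewrite -EFinM /powR gt_eqF// -expRD expRD lnK//; congr (expR _)%:E; ring.
by rewrite muleAC -EFinM powRN divff ?mul1e// gt_eqF// powR_gt0.
Qed.

(** Only the unit interval [ln A, ln A + 1] is kept: there e^(k t) >= A^k, and the other factors are
    bounded below by the constant k0. As A is arbitrary, Gamma (x + k) outgrows every geometric
    sequence. *)
Lemma Gamma_ge_expn (x A : R) : 0 < x -> 0 < A ->
  exists2 k0, 0 < k0 & forall k : nat, k0 * A ^+ k <= Gamma (x + k%:R).
Proof.
move=> x0 A0; exists (expR (x * ln A - expR (ln A + 1))); first exact: expR_gt0.
move=> k; have xk0 : 0 < x + k%:R by rewrite ltr_wpDr.
have := integral_expR_expR xk0 ltr01; rewrite powR1 mulr1 => e.
rewrite -lee_fin -e.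
apply: (@le_trans _ _ (\int[mu]_(t in `[(ln A), (ln A + 1)%R])
    (expR ((x + k%:R) * t - 1 * expR t))%:E)%E); last first.
  apply: ge0_subset_integral => //.
  - by apply/measurable_EFinP; apply: continuous_measurable_fun; exact: continuous_expR_expR.
rewrite -[leLHS]mule1 -(_ : mu `[(ln A), (ln A + 1)] = 1%E); last first.
  by rewrite lebesgue_measure_itv/= lte_fin ltrDl ltr01 -EFinD addrAC subrr add0r.
rewrite -integral_cst//; apply: ge0_le_integral => //.
- by move=> t _; rewrite lee_fin mulr_ge0 ?expR_ge0// exprn_ge0// ltW.
- apply/measurable_EFinP; apply: measurable_funTS.
  by apply: continuous_measurable_fun; exact: continuous_expR_expR.
- move=> t; rewrite /= in_itv/= => /andP[h1 h2]; rewrite lee_fin.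
  rewrite -[X in X ^+ k](lnK A0) -expRM_natl -expRD ler_expR mul1r.
  have : expR t <= expR (ln A + 1) by rewrite ler_expR.
  have : x * ln A <= x * t by rewrite ler_pM2l.
  have : k%:R * ln A <= k%:R * t by rewrite ler_wpM2l.
  by rewrite mulrDl; lra.
Qed.

Lemma Gamma_gt0 (x : R) : 0 < x -> 0 < Gamma x.
Proof.
move=> x0; have [k0 k00 /(_ 0%N)] := Gamma_ge_expn x0 ltr01.
by rewrite expr0 mulr1 addr0; exact: lt_le_trans.
Qed.

Lemma cvg_expR_linear_Ny (m : R) : 0 < m -> expR (m * t) @[t --> -oo] --> (0 : R).
Proof.
move=> m0.
have -> : (fun t => expR (m * t)) = (fun t => expR (- (- (m * t)))).
  by apply/funext => t; rewrite opprK.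
apply: (cvg_comp (fun t => - (m * t)) (fun y => expR (- y)) _ (@cvgr_expR R)).
by apply: (cvgNry (fun t => m * t)).2; exact: gt0_cvgMrNy.
Qed.

(** The derivative of e^(x t - e^t) is the difference of the two integrands, and its integral over
    the line is zero. *)
Lemma GammaS (x : R) : 0 < x -> Gamma (x + 1) = x * Gamma x.
Proof.
move=> x0; have x10 : 0 < x + 1 by rewrite addr_gt0.
pose F t : R := expR (x * t - 1 * expR t).
pose f t : R := x * F t - expR ((x + 1) * t - 1 * expR t).
have i1 := integrable_expR_expR x0 ltr01.
have i2 := integrable_expR_expR x10 ltr01.
have i1' := @integrable_EFinZl _ (measurableTypeR R) R mu x _ i1.
have cf : continuous f.
  move=> t; apply: cvgB; last exact: continuous_expR_expR.
  by apply: cvgM; [exact: cvg_cst|exact: continuous_expR_expR].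
have fi : mu.-integrable setT (EFin \o f).
  exact: (@integrable_EFinB _ (measurableTypeR R)).
have : (\int[mu]_t (f t)%:E = 0)%E.
  apply: (@integral_derive_eq0 _ F) => //.
  - move=> t; have d1 : is_derive t 1 (fun t : R => x * t - 1 * expR t) (x - expR t).
      by apply: is_derive_eq; rewrite /GRing.scale/=; ring.
    have := @is_derive1_comp R expR _ t _ _ (is_derive_expR _) d1.
    move=> d2; apply: (is_derive_eq d2); rewrite /f /F.
    rewrite mulrBr (mulrC _ x) -expRD; congr (_ - expR _); ring.
  (* Asking for twice the slope leaves a factor e^(- x t) to spare, which gives the decay at +oo. *)
  - have [C hC] : exists C, forall t, (x + x) * t <= C + 1 * expR t.
      by apply: linear_le_expR => //; rewrite addr_gt0.
    have h : expR C * expR (- (x * t)) @[t --> +oo] --> (0 : R).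
      rewrite -(mulr0 (expR C)); apply: cvgM; first exact: cvg_cst.
      apply: (cvg_comp (fun t => x * t) (fun y => expR (- y)) _ (@cvgr_expR R)).
      exact: gt0_cvgMry.
    apply: (squeeze_cvgr _ _ h); last exact: cvg_cst.
    by apply: nearW => t /=; rewrite /F expR_ge0 -expRD ler_expR; have := hC t; lra.
  - apply: (squeeze_cvgr _ _ (cvg_expR_linear_Ny x0)); last exact: cvg_cst.
    by apply: nearW => t /=; rewrite /F expR_ge0 ler_expR mul1r gerBl expR_ge0.
rewrite /f; under eq_integral do rewrite EFinB.
rewrite integralB//; under eq_integral do rewrite EFinM.
rewrite integralZl// /F !integral_expR_expR// !powR1 !mulr1.
by rewrite -EFinM -EFinB => -[/eqP]; rewrite subr_eq0 => /eqP.
Qed.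

End ExpIntegrals.

(** * The Macdonald function as a Gaussian mixture *)

Section MacdonaldGaussian.
Context {R : realType}.
Local Notation mu := (@lebesgue_measure R).

Lemma ge0_integral_fold (h : R -> R) : continuous h -> (forall t, 0 <= h t) ->
  (\int[mu]_t (h t)%:E = \int[mu]_(t in `[0%R, +oo[) (h t + h (- t))%:E)%E.
Proof.
move=> ch h0; have mh : measurable_fun setT h by exact: continuous_measurable_fun.
have m1 : measurable_fun setT (EFin \o h) by exact/measurable_EFinP.
have chN : continuous (h \o -%R).
  by move=> t; apply: continuous_comp; [exact: opp_continuous|exact: ch].
have mhN : measurable_fun setT (EFin \o (h \o -%R)).
  by apply/measurable_EFinP; exact: continuous_measurable_fun.
under [RHS]eq_integral do rewrite EFinD.
rewrite ge0_integralD//=; last 4 first.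
- by move=> t _; rewrite lee_fin.
- exact: measurable_funTS.
- by move=> t _; rewrite lee_fin.
- exact: measurable_funTS.
rewrite -(@ge0_integration_by_substitutionNy _ h 0)//; last exact: continuous_subspaceT.
rewrite oppr0 -(setUv `[0, +oo[%classic) ge0_integral_setU//=; last 4 first.
- exact: measurableC.
- by rewrite setUv.
- by move=> t _; rewrite lee_fin.
- exact/disj_setPCl.
congr (_ + _)%E; rewrite setCitvr -(integral_itv_bndo_bndc)//.
by apply: measurable_funTS.
Qed.

(** Translating t by ln (x / 2) balances the two exponentials into - x cosh t and releases the
    factor (x / 2)^nu. Folding the line at 0 then turns e^(nu t) into 2 cosh (nu t). *)
Lemma integral_besselK (nu x : R) : 0 < x ->
  (\int[mu]_t (expR (nu * t - 1 * expR t - x ^+ 2 / 4 * expR (- t)))%:E =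
    (2 * (x / 2) `^ nu * besselK nu x)%:E)%E.
Proof.
move=> x0; have x20 : 0 < x / 2 by rewrite divr_gt0.
pose h t : R := expR (nu * t - x / 2 * expR t - x / 2 * expR (- t)).
have hi : mu.-integrable setT (EFin \o h) by exact: integrable_expR_mixed.
have ch : continuous h by exact: continuous_expR_mixed.
transitivity (((x / 2) `^ nu)%:E * \int[mu]_t (h t)%:E)%E.
  rewrite (@ge0_integral_shift _ _ (ln (x / 2))); last 2 first.
  - exact: continuous_expR_mixed.
  - by move=> t; exact: expR_ge0.
  rewrite -(integralZl measurableT hi); apply: eq_integral => t _ /=.
  have e1 : expR (t + ln (x / 2)) = expR t * (x / 2) by rewrite expRD lnK.
  have e2 : expR (- (t + ln (x / 2))) = expR (- t) * (x / 2)^-1.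
    by rewrite opprD expRD (expRN (ln _)) lnK.
  rewrite e1 e2 -EFinM /powR gt_eqF// /h -expRD; congr ((expR _)%:E).
  by field; rewrite gt_eqF.
have hI : (\int[mu]_t (h t)%:E = 2%:E *
    \int[mu]_(t in `[0%R, +oo[) (expR (- (x * cosh t)) * cosh (nu * t))%:E)%E.
  rewrite ge0_integral_fold//; last by move=> t; exact: expR_ge0.
  rewrite -ge0_integralZl//=; last 2 first.
  - apply/measurable_EFinP; apply: measurable_funTS; apply: continuous_measurable_fun.
    move=> t; apply: cvgM.
      apply: cvg_expR_comp; apply: cvgN; apply: cvgM; first exact: cvg_cst.
      apply: cvgM; last exact: cvg_cst.
      apply: cvgD; first exact: continuous_expR.
      by apply: cvg_expR_comp; apply: cvgN; exact: cvg_id.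
    apply: cvgM; last exact: cvg_cst.
    apply: cvgD; apply: cvg_expR_comp.
      by apply: cvgM; [exact: cvg_cst|exact: cvg_id].
    by apply: cvgN; apply: cvgM; [exact: cvg_cst|exact: cvg_id].
  - move=> t _; rewrite lee_fin mulr_ge0 ?expR_ge0// /cosh divr_ge0// addr_ge0 ?expR_ge0//.
  apply: eq_integral => t _; rewrite -EFinM; congr (_%:E).
  rewrite /h /cosh opprK mulrN.
  have -> : nu * t - x / 2 * expR t - x / 2 * expR (- t) =
    - (x * ((expR t + expR (- t)) / 2)) + nu * t by field.
  have -> : - (nu * t) - x / 2 * expR (- t) - x / 2 * expR t =
    - (x * ((expR t + expR (- t)) / 2)) + - (nu * t) by field.
  by rewrite !expRD; field.
(* [besselK] takes [fine] of this integral, so the equality of extended reals descends only once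
   infinite values are excluded. *)
have fi : (2%:E * \int[mu]_(t in `[0%R, +oo[)
    (expR (- (x * cosh t)) * cosh (nu * t))%:E)%E \is a fin_num.
  by rewrite -hI; exact: integrable_fin_num.
rewrite hI /besselK /Rintegral.
case: (\int[mu]_(t in `[0%R, +oo[) _)%E fi => //=.
- by move=> r _; rewrite -!EFinM; congr (_%:E); ring.
- by rewrite gt0_muley ?lte_fin.
- by rewrite gt0_muleNy ?lte_fin.
Qed.

(** Completing the square exhibits a normal density of mean h / (2 c) and variance 1 / (2 c), whose
    total mass is known. *)
Lemma gauss_normal_pdf (c h x : R) : 0 < c ->
  expR (h * x - c * x ^+ 2) =
  Num.sqrt (pi / c) * expR (h ^+ 2 / (4 * c)) * normal_pdf (h / (2 * c)) (Num.sqrt (2 * c)^-1) x.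
Proof.
move=> c0; have s0 : 0 < Num.sqrt (2 * c)^-1 :> R.
  by rewrite sqrtr_gt0 invr_gt0 mulr_gt0.
rewrite /normal_pdf gt_eqF// /normal_peak /normal_fun.
rewrite sqr_sqrtr; last by rewrite invr_ge0 mulr_ge0// ltW.
have -> : (2 * c)^-1 * pi *+ 2 = pi / c.
  by rewrite -mulr_natl; field; rewrite gt_eqF.
rewrite mulrACA divff ?gt_eqF ?sqrtr_gt0 ?divr_gt0 ?pi_gt0// mul1r -expRD.
by congr expR; rewrite -mulr_natl; field; rewrite gt_eqF.
Qed.

Lemma integrable_gauss (c h : R) : 0 < c ->
  mu.-integrable setT (EFin \o (fun x => expR (h * x - c * x ^+ 2))).
Proof.
move=> c0; have -> : (fun x => expR (h * x - c * x ^+ 2)) =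
  (fun x => Num.sqrt (pi / c) * expR (h ^+ 2 / (4 * c)) *
     normal_pdf (h / (2 * c)) (Num.sqrt (2 * c)^-1) x).
  by apply/funext => x; exact: gauss_normal_pdf.
apply: (@integrable_EFinZl _ (measurableTypeR R)); exact: integrable_normal_pdf.
Qed.

Lemma integral_gauss (c h : R) : 0 < c ->
  (\int[mu]_x (expR (h * x - c * x ^+ 2))%:E =
   (Num.sqrt (pi / c) * expR (h ^+ 2 / (4 * c)))%:E)%E.
Proof.
move=> c0; under eq_integral do rewrite gauss_normal_pdf// EFinM.
rewrite integralZl//; last exact: integrable_normal_pdf.
by rewrite integral_normal_pdf mule1.
Qed.

End MacdonaldGaussian.

(** * Complex-valued integrals over the plane *)

Section ProductIntegral.
Context {R : realType}.
Local Notation mu := (@lebesgue_measure R).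
Local Notation mT := (measurableTypeR R).
Implicit Types f g : mT -> R.

Lemma measurable_prodfun f g : measurable_fun setT f -> measurable_fun setT g ->
  measurable_fun setT (fun p : mT * mT => f p.1 * g p.2).
Proof.
move=> mf mg; apply: measurable_funM.
  exact: (measurableT_comp mf measurable_fst).
exact: (measurableT_comp mg measurable_snd).
Qed.

Lemma integrable_prodfun f g :
  mu.-integrable setT (EFin \o f) -> mu.-integrable setT (EFin \o g) ->
  (mu \x mu)%E.-integrable setT (EFin \o (fun p : mT * mT => f p.1 * g p.2)).
Proof.
move=> fi gi.
have mf : measurable_fun setT f by apply/measurable_EFinP; exact: measurable_int fi.
have mg : measurable_fun setT g by apply/measurable_EFinP; exact: measurable_int gi.
apply/integrable12ltyP; first by apply/measurable_EFinP; exact: measurable_prodfun.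
have ngi := integrable_abse gi; have nfi := integrable_abse fi.
have Gfin : (\int[mu]_y `|(g y)%:E|)%E \is a fin_num by exact: integrable_fin_num ngi.
have -> : (\int[mu]_x \int[mu]_y `|((fun p : mT * mT => f p.1 * g p.2) (x, y))%:E| =
   \int[mu]_x ((\int[mu]_y `|(g y)%:E|) * `|(f x)%:E|))%E.
  apply: eq_integral => x _ /=.
  under eq_integral do rewrite normrM EFinM.
  by rewrite (integralZl measurableT ngi) muleC.
rewrite -(fineK Gfin) (integralZl measurableT nfi).
rewrite -(fineK (integrable_fin_num measurableT nfi)) -EFinM; exact: ltry.
Qed.

Lemma Rintegral_prodfun f g :
  mu.-integrable setT (EFin \o f) -> mu.-integrable setT (EFin \o g) ->
  \int[(mu \x mu)%E]_p (f p.1 * g p.2) = (\int[mu]_x f x) * (\int[mu]_y g y).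
Proof.
move=> fi gi; have fgi := integrable_prodfun fi gi.
rewrite /Rintegral -(integral12_prod_meas1 fgi)/=.
have -> : (\int[mu]_x \int[mu]_y ((fun p : mT * mT => f p.1 * g p.2) (x, y))%:E =
   \int[mu]_x ((\int[mu]_y (g y)%:E) * (f x)%:E))%E.
  apply: eq_integral => x _ /=.
  under eq_integral do rewrite EFinM.
  by rewrite (integralZl measurableT gi) muleC.
have Gfin := integrable_fin_num measurableT gi.
have Ffin := integrable_fin_num measurableT fi.
rewrite -(fineK Gfin) (integralZl measurableT fi) -(fineK Ffin).
by rewrite -EFinM/= mulrC.
Qed.

End ProductIntegral.

Section ComplexIntegral.
Context {R : realType}.
Local Notation C := R[i].
Local Notation mT := (measurableTypeR R).
Implicit Types (f g : C -> C) (p : mT * mT).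

Definition cmeasurable f : Prop :=
  measurable_fun setT (fun p : mT * mT => complex.Re (f (p.1 +i* p.2))) /\
  measurable_fun setT (fun p : mT * mT => complex.Im (f (p.1 +i* p.2))).

Lemma ReD (x y : C) : complex.Re (x + y) = complex.Re x + complex.Re y.
Proof. by case: x y => [a b] [c d]. Qed.
Lemma ImD (x y : C) : complex.Im (x + y) = complex.Im x + complex.Im y.
Proof. by case: x y => [a b] [c d]. Qed.
Lemma ReM (x y : C) : complex.Re (x * y) =
  complex.Re x * complex.Re y - complex.Im x * complex.Im y.
Proof. by case: x y => [a b] [c d]. Qed.
Lemma ImM (x y : C) : complex.Im (x * y) =
  complex.Re x * complex.Im y + complex.Im x * complex.Re y.
Proof. by case: x y => [a b] [c d]. Qed.
Lemma complex_ext (x y : C) :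
  complex.Re x = complex.Re y -> complex.Im x = complex.Im y -> x = y.
Proof. by case: x y => [a b] [c d] /= -> ->. Qed.

Lemma cmeasurable_cst (c : C) : cmeasurable (fun=> c).
Proof. by split; exact: measurable_cst. Qed.

Lemma cmeasurable_id : cmeasurable id.
Proof. by split => /=; [exact: measurable_fst|exact: measurable_snd]. Qed.

Lemma cmeasurable_conj : cmeasurable (fun u => conjc u).
Proof.
by split => /=; [exact: measurable_fst|apply: measurableT_comp => //; exact: measurable_snd].
Qed.

Lemma cmeasurable_realfun (f : C -> R) :
  measurable_fun setT (fun p : mT * mT => f (p.1 +i* p.2)) ->
  cmeasurable (fun u => (f u)%:C).
Proof. by move=> mf; split => //=; exact: measurable_cst. Qed.

Lemma cmeasurableD f g : cmeasurable f -> cmeasurable g -> cmeasurable (fun u => f u + g u).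
Proof.
move=> [f1 f2] [g1 g2]; split.
  by under eq_fun do rewrite ReD; exact: measurable_funD.
by under eq_fun do rewrite ImD; exact: measurable_funD.
Qed.

Lemma cmeasurableM f g : cmeasurable f -> cmeasurable g -> cmeasurable (fun u => f u * g u).
Proof.
move=> [f1 f2] [g1 g2]; split.
  by under eq_fun do rewrite ReM; apply: measurable_funB; exact: measurable_funM.
by under eq_fun do rewrite ImM; apply: measurable_funD; exact: measurable_funM.
Qed.

Lemma cmeasurableX f n : cmeasurable f -> cmeasurable (fun u => f u ^+ n).
Proof.
move=> mf; elim: n => [|n IH]; first by under eq_fun do rewrite expr0; exact: cmeasurable_cst.
by under eq_fun do rewrite exprS; exact: cmeasurableM.
Qed.

Lemma cmeasurable_sum (I : Type) (s : seq I) (F : I -> C -> C) :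
  (forall i, cmeasurable (F i)) -> cmeasurable (fun u => \sum_(i <- s) F i u).
Proof.
move=> mF; elim: s => [|i s IH].
  by under eq_fun do rewrite big_nil; exact: cmeasurable_cst.
by under eq_fun do rewrite big_cons; exact: cmeasurableD.
Qed.

Lemma normr_Re_le (x : C) : `|complex.Re x| <= cabs x.
Proof.
case: x => a b; rewrite /cabs /= -sqrtr_sqr; apply: ler_wsqrtr.
by rewrite lerDl sqr_ge0.
Qed.

Lemma normr_Im_le (x : C) : `|complex.Im x| <= cabs x.
Proof.
case: x => a b; rewrite /cabs /= -sqrtr_sqr; apply: ler_wsqrtr.
by rewrite lerDr sqr_ge0.
Qed.

Lemma cabs_le (x : C) : cabs x <= `|complex.Re x| + `|complex.Im x|.
Proof.
case: x => a b; rewrite /cabs /=.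
rewrite -(ger0_norm (addr_ge0 (normr_ge0 a) (normr_ge0 b))) -sqrtr_sqr; apply: ler_wsqrtr.
rewrite sqrrD !real_normK ?num_real// -addrA (addrC (_ *+ 2)) addrA lerDl.
by rewrite mulrn_wge0// mulr_ge0.
Qed.

Lemma cabs_ge0 (x : C) : 0 <= cabs x.
Proof. by case: x => a b; exact: sqrtr_ge0. Qed.

Lemma cabsM (x y : C) : cabs (x * y) = cabs x * cabs y.
Proof. exact: ComplexField.Normc.normcM. Qed.

Lemma cabsD (x y : C) : cabs (x + y) <= cabs x + cabs y.
Proof. exact: le_normcD. Qed.

Lemma cabsX (x : C) n : cabs (x ^+ n) = cabs x ^+ n.
Proof.
elim: n => [|n IH]; first by rewrite !expr0; exact: ComplexField.Normc.normc1.
by rewrite !exprS cabsM IH.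
Qed.

Lemma cabs_real (r : R) : cabs r%:C = `|r|.
Proof. by rewrite /cabs /= expr0n/= addr0 sqrtr_sqr. Qed.

Lemma cabs_conj (x : C) : cabs (conjc x) = cabs x.
Proof. by case: x => a b; rewrite /cabs/= sqrrN. Qed.

Lemma eq_cintegrable f g : f =1 g -> cintegrable f -> cintegrable g.
Proof. by move=> /funext ->. Qed.

Lemma eq_cintegral f g : f =1 g -> cintegral f = cintegral g.
Proof. by move=> /funext ->. Qed.

Lemma cintegrableD f g : cintegrable f -> cintegrable g ->
  cintegrable (fun u => f u + g u).
Proof.
rewrite /cintegrable /planar => -[f1 f2] [g1 g2]; split.
  by under eq_fun do rewrite ReD; exact: integrable_EFinD.
by under eq_fun do rewrite ImD; exact: integrable_EFinD.
Qed.

Lemma cintegralD f g : cintegrable f -> cintegrable g ->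
  cintegral (fun u => f u + g u) = cintegral f + cintegral g.
Proof.
rewrite /cintegrable /cintegral /planar => -[f1 f2] [g1 g2].
apply: complex_ext => /=.
  by under eq_Rintegral do rewrite ReD; rewrite RintegralD.
by under eq_Rintegral do rewrite ImD; rewrite RintegralD.
Qed.

Lemma cintegrableZl (c : C) f : cintegrable f -> cintegrable (fun u => c * f u).
Proof.
rewrite /cintegrable /planar => -[f1 f2]; split.
  under eq_fun do rewrite ReM.
  by apply: integrable_EFinB; exact: integrable_EFinZl.
under eq_fun do rewrite ImM.
by apply: integrable_EFinD; exact: integrable_EFinZl.
Qed.

Lemma cintegralZl (c : C) f : cintegrable f ->
  cintegral (fun u => c * f u) = c * cintegral f.
Proof.
rewrite /cintegrable /cintegral /planar => -[f1 f2].
apply: complex_ext.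
  rewrite ReM/=; under eq_Rintegral do rewrite ReM.
  by rewrite RintegralB// ?RintegralZl//; exact: integrable_EFinZl.
rewrite ImM/=; under eq_Rintegral do rewrite ImM.
by rewrite RintegralD// ?RintegralZl//; exact: integrable_EFinZl.
Qed.

Lemma cintegrable0 : cintegrable (fun=> 0 : C).
Proof. by split; rewrite /planar; exact: integrable0. Qed.

Lemma cintegral0 : cintegral (fun=> 0 : C) = 0.
Proof.
by rewrite /cintegral /planar; apply: complex_ext; rewrite /= /Rintegral integral0.
Qed.

Lemma cintegrable_sum (I : Type) (s : seq I) (F : I -> C -> C) :
  (forall i, cintegrable (F i)) -> cintegrable (fun u => \sum_(i <- s) F i u).
Proof.
move=> iF; elim: s => [|i s IH].
  by under eq_fun do rewrite big_nil; exact: cintegrable0.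
by under eq_fun do rewrite big_cons; exact: cintegrableD.
Qed.

Lemma cintegral_sum (I : Type) (s : seq I) (F : I -> C -> C) :
  (forall i, cintegrable (F i)) ->
  cintegral (fun u => \sum_(i <- s) F i u) = \sum_(i <- s) cintegral (F i).
Proof.
move=> iF; elim: s => [|i s IH].
  rewrite big_nil -[RHS]cintegral0; apply: eq_cintegral => u; exact: big_nil.
rewrite big_cons -IH -cintegralD//; last exact: cintegrable_sum.
by apply: eq_cintegral => u; exact: big_cons.
Qed.

End ComplexIntegral.

(** * Gaussian moments *)

Section GaussianMomentAlgebra.

(** The matching polynomial of the complete bipartite graph with parts of sizes j and k. It appears
    through Wick's formula: m of the factors u are paired with m of the factors conj u, and each
    unpaired factor contributes the mean; w is the covariance divided by the square of the mean. *)
Definition falling_sum (F : comPzRingType) (w : F) (j k : nat) : F :=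
  \sum_(m < j.+1) ('C(j, m) * 'C(k, m) * m`!)%:R * w ^+ m.

Lemma falling_sum0 (F : comPzRingType) (w : F) k : falling_sum w 0 k = 1.
Proof. by rewrite /falling_sum big_ord1 !bin0 expr0 mulr1. Qed.

(** Pascal's rule on ['C(j, m)]. In terms of matchings, the additional factor u is either unpaired
    or paired with one of the k conjugates. For k = 0 the coefficient k annihilates the term with
    [k.-1]. *)
Lemma falling_sumS (F : comPzRingType) (w : F) j k :
  falling_sum w j.+1 k = falling_sum w j k + k%:R * w * falling_sum w j k.-1.
Proof.
rewrite /falling_sum big_ord_recl /= [X in _ = X + _]big_ord_recl /=.
rewrite !bin0 -addrA; congr (_ + _).
under eq_bigr do rewrite /bump/= add1n binS mulnDl mulnDl natrD mulrDl.
rewrite big_split/=; congr (_ + _).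
  by rewrite big_ord_recr /= bin_small// !mul0n mul0r addr0.
rewrite mulr_sumr; apply: eq_bigr => m _.
rewrite factS exprS.
have -> : ('C(j, m) * 'C(k, m.+1) * (m.+1 * m`!) = k * ('C(j, m) * 'C(k.-1, m) * m`!))%N.
  case: k => [|k]; first by rewrite bin0n /= muln0 !mul0n.
  have := mul_bin_diag k.+1 m; rewrite /= => e.
  rewrite -mulnA (mulnA 'C(k.+1, m.+1)) (mulnC 'C(k.+1, m.+1)) -e; ring.
by rewrite natrM; ring.
Qed.

(** The recursions determine N from N 0 0: one runs along j = 0, the other raises j. They match
    [falling_sumS] because w p^2 = 1 / c. *)
Lemma falling_sum_closed_form (F : fieldType) (c h w p : F) (N : nat -> nat -> F) :
  c != 0 -> p = h / c -> w = c / h ^+ 2 -> h != 0 ->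
  (forall j k, c * N j.+1 k = h * N j k + k%:R * N j k.-1) ->
  (forall k, c * N 0%N k.+1 = h * N 0%N k) ->
  forall j k, N j k = N 0%N 0%N * p ^+ (j + k) * falling_sum w j k.
Proof.
move=> c0 hp hw h0 HJ HK; elim=> [|j IH] k.
  rewrite falling_sum0 mulr1 add0n; elim: k => [|k IHk]; first by rewrite expr0 mulr1.
  by apply: (mulfI c0); rewrite HK IHk exprS hp; field.
apply: (mulfI c0); rewrite HJ !IH falling_sumS.
case: k => [|k].
  by rewrite !mul0r !addr0 !addn0 exprS hp; field.
rewrite [_.-1]/= addSn !addnS !exprS hp hw; field.
by rewrite c0 h0.
Qed.

(* [A p q j k] stands for the moment of [x ^ p * y ^ q * u ^ j * conj u ^ k],
   with [u = x + I * y], against [exp (h * x - (x ^ 2 + y ^ 2) * c / 2)]; the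
   last two hypotheses are integration by parts in [x] and in [y]. *)
Lemma mixed_moment_recursion (F : comPzRingType) (I c h : F)
  (A : nat -> nat -> nat -> nat -> F) :
  I * I = -1 ->
  (forall p q j k, A p q j.+1 k = A p.+1 q j k + I * A p q.+1 j k) ->
  (forall p q j k, A p q j k.+1 = A p.+1 q j k - I * A p q.+1 j k) ->
  (forall p q, c * A p.+1 q 0%N 0%N = h * A p q 0%N 0%N + p%:R * A p.-1 q 0%N 0%N) ->
  (forall p q, c * A p q.+1 0%N 0%N = q%:R * A p q.-1 0%N 0%N) ->
  (forall j k p q, c * A p.+1 q j k = h * A p q j k + p%:R * A p.-1 q j k +
     j%:R * A p q j.-1 k + k%:R * A p q j k.-1) /\
  (forall j k p q, c * A p q.+1 j k = q%:R * A p q.-1 j k +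
     I * (j%:R * A p q j.-1 k) - I * (k%:R * A p q j k.-1)).
Proof.
move=> I2 HJ HK HX HY.
(* The case j = 0 comes first, by induction on k; the induction on j starts from it. The exponents p
   and q stay general because unfolding one factor u or conj u raises one of them. *)
have X0 : forall k p q, c * A p.+1 q 0%N k = h * A p q 0%N k + p%:R * A p.-1 q 0%N k +
    k%:R * A p q 0%N k.-1.
  elim=> [|k IH] p q; first by rewrite HX mul0r addr0.
  rewrite HK mulrBr IH.
  have -> : c * (I * A p.+1 q.+1 0%N k) = I * (c * A p.+1 q.+1 0%N k) by ring.
  rewrite IH !HK.
  case: k {IH} => [|k]; case: p => [|p]; rewrite ?HK /= -?natr1; ring.
have Y0 : forall k p q, c * A p q.+1 0%N k = q%:R * A p q.-1 0%N k -
    I * (k%:R * A p q 0%N k.-1).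
  elim=> [|k IH] p q; first by rewrite HY mul0r mulr0 subr0.
  rewrite HK mulrBr IH.
  have -> : c * (I * A p q.+2 0%N k) = I * (c * A p q.+2 0%N k) by ring.
  rewrite IH !HK.
  case: k {IH} => [|k]; case: q => [|q]; rewrite ?HK /= -?natr1; ring: I2.
split.
  elim=> [|j IH] k p q; first by rewrite X0 mul0r addr0.
  rewrite !HJ mulrDr IH.
  have -> : c * (I * A p.+1 q.+1 j k) = I * (c * A p.+1 q.+1 j k) by ring.
  rewrite IH.
  case: j {IH} => [|j]; case: p => [|p]; rewrite ?HJ /= -?natr1; ring.
elim=> [|j IH] k p q; first by rewrite Y0 mul0r mulr0 addr0.
rewrite !HJ mulrDr IH.
have -> : c * (I * A p q.+2 j k) = I * (c * A p q.+2 j k) by ring.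
rewrite IH.
case: j {IH} => [|j]; case: q => [|q]; rewrite ?HJ /= -?natr1; ring: I2.
Qed.

End GaussianMomentAlgebra.

Section GaussianMoments.
Context {R : realType}.
Local Notation C := R[i].
Local Notation mu := (@lebesgue_measure R).
Local Notation mT := (measurableTypeR R).

(** The n-th power of the inequality y <= e^y, taken at y = e x / n. *)
Lemma expn_le_expR (n : nat) (e : R) : 0 < e ->
  exists2 K, 0 <= K & forall x, 0 <= x -> x ^+ n <= K * expR (e * x).
Proof.
move=> e0; case: n => [|n].
  exists 1 => // x x0; rewrite expr0 mul1r -expR0 ler_expR mulr_ge0//; exact: ltW.
have n0 : 0 < n.+1%:R / e :> R by rewrite divr_gt0.
exists ((n.+1%:R / e) ^+ n.+1); first by rewrite exprn_ge0// ltW.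
move=> x x0; have -> : expR (e * x) = expR (e * x / n.+1%:R) ^+ n.+1.
  by rewrite -expRM_natl [in RHS]mulrC divfK.
rewrite -exprMn lerXn2r ?nnegrE ?mulr_ge0 ?expR_ge0 ?invr_ge0 ?(ltW e0)//.
rewrite -ler_pdivrMl// invf_div.
have := expR_ge1Dx (e * x / n.+1%:R); rewrite mulrAC; apply: le_trans.
by rewrite lerDr.
Qed.

Lemma expR_norm_le (x : R) : expR `|x| <= expR x + expR (- x).
Proof.
by case: (ger0P x) => _; rewrite ?lerDl ?lerDr expR_ge0.
Qed.

Definition gauss_integrand (c h : R) (p : nat) (x : R) := x ^+ p * expR (h * x - c * x ^+ 2).

Definition gauss_moment (c h : R) (p : nat) : R := \int[mu]_x gauss_integrand c h p x.

Lemma continuous_gauss_integrand c h p : continuous (gauss_integrand c h p).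
Proof.
move=> x; apply: cvgM; first exact: exprn_continuous.
apply: cvg_expR_comp; apply: cvgB; apply: cvgM; try exact: cvg_cst.
  exact: cvg_id.
exact: exprn_continuous.
Qed.

(** A power of x costs only a shift of h by 1 or -1, so integrability and decay reduce to the case p
    = 0. *)
Lemma gauss_integrand_le (c h : R) (p : nat) : exists2 K, 0 <= K &
  forall x, `|gauss_integrand c h p x| <=
    K * (expR ((h + 1) * x - c * x ^+ 2) + expR ((h - 1) * x - c * x ^+ 2)).
Proof.
have [K K0 hK] := expn_le_expR p ltr01; exists K => // x.
rewrite normrM (ger0_norm (expR_ge0 _)) normrX.
have h1 : `|x| ^+ p <= K * (expR x + expR (- x)).
  by apply: (le_trans (hK _ (normr_ge0 _))); rewrite mul1r ler_wpM2l// expR_norm_le.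
apply: (le_trans (ler_wpM2r (expR_ge0 _) h1)).
rewrite -mulrA ler_wpM2l// mulrDl -!expRD.
have -> : x + (h * x - c * x ^+ 2) = (h + 1) * x - c * x ^+ 2 by ring.
by have -> : - x + (h * x - c * x ^+ 2) = (h - 1) * x - c * x ^+ 2 by ring.
Qed.

Lemma integrable_gauss_integrand c h p : 0 < c ->
  mu.-integrable setT (EFin \o gauss_integrand c h p).
Proof.
move=> c0; have [K K0 hK] := gauss_integrand_le c h p.
apply: (@integrable_dominated _ mT R mu _ _ _ hK).
  by apply: continuous_measurable_fun; exact: continuous_gauss_integrand.
apply: (@integrable_EFinZl _ mT); apply: (@integrable_EFinD _ mT);
  exact: integrable_gauss.
Qed.

Lemma gauss_le_expR (c h : R) : 0 < c ->
  forall x, expR (h * x - c * x ^+ 2) <= expR ((h + 1) ^+ 2 / (4 * c)) * expR (- x).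
Proof.
move=> c0 x; rewrite -expRD ler_expR.
have -> : (h + 1) ^+ 2 / (4 * c) + - x =
   h * x - c * x ^+ 2 + c * (x - (h + 1) / (2 * c)) ^+ 2 by field; rewrite gt_eqF.
by rewrite lerDl mulr_ge0 ?sqr_ge0// ltW.
Qed.

Lemma cvg_gauss_y (c h : R) : 0 < c ->
  expR (h * x - c * x ^+ 2) @[x --> +oo] --> (0 : R).
Proof.
move=> c0.
have h1 : expR ((h + 1) ^+ 2 / (4 * c)) * expR (- x) @[x --> +oo] --> (0 : R).
  rewrite -(mulr0 (expR ((h + 1) ^+ 2 / (4 * c)))); apply: cvgM; first exact: cvg_cst.
  exact: cvgr_expR.
apply: (squeeze_cvgr _ _ h1); last exact: cvg_cst.
by apply: nearW => x; rewrite expR_ge0 gauss_le_expR.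
Qed.

Lemma cvg_gauss_integrand_y c h p : 0 < c ->
  gauss_integrand c h p x @[x --> +oo] --> (0 : R).
Proof.
move=> c0; have [K K0 hK] := gauss_integrand_le c h p.
have h1 : K * (expR ((h + 1) * x - c * x ^+ 2) + expR ((h - 1) * x - c * x ^+ 2))
    @[x --> +oo] --> (0 : R).
  rewrite -(mulr0 K) -(addr0 0); apply: cvgM; first exact: cvg_cst.
  by apply: cvgD; exact: cvg_gauss_y.
apply/norm_cvg0P; apply: (squeeze_cvgr _ _ h1); last exact: cvg_cst.
by apply: nearW => x; rewrite normr_ge0 hK.
Qed.

Lemma gauss_integrandN c h p x :
  gauss_integrand c h p (- x) = (-1) ^+ p * gauss_integrand c (- h) p x.
Proof.
rewrite /gauss_integrand -[- x]mulN1r exprMn mulN1r.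
have -> : h * - x - c * (- x) ^+ 2 = - h * x - c * x ^+ 2 by ring.
by ring.
Qed.

Lemma cvg_gauss_integrand_Ny c h p : 0 < c ->
  gauss_integrand c h p x @[x --> -oo] --> (0 : R).
Proof.
move=> c0; apply/cvgyNP.
have -> : gauss_integrand c h p \o -%R = fun x => (-1) ^+ p * gauss_integrand c (- h) p x.
  by apply/funext => x; exact: gauss_integrandN.
have : (-1) ^+ p * gauss_integrand c (- h) p x @[x --> +oo] --> (-1) ^+ p * (0 : R).
  by apply: cvgM; [exact: cvg_cst|exact: cvg_gauss_integrand_y].
by rewrite mulr0.
Qed.

Lemma is_derive_gauss_integrand c h p (x : R) :
  is_derive x 1 (gauss_integrand c h p)
   (p%:R * gauss_integrand c h p.-1 x + h * gauss_integrand c h p x -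
      2 * c * gauss_integrand c h p.+1 x).
Proof.
have d1 : is_derive x 1 (fun x : R => h * x - c * x ^+ 2) (h - 2 * c * x).
  by apply: is_derive_eq; rewrite /GRing.scale/=; ring.
have d2 := @is_derive1_comp R expR _ x _ _ (is_derive_expR _) d1.
have d3 : is_derive x 1 (fun y : R => y ^+ p) (p%:R * x ^+ p.-1).
  have := @is_deriveX _ _ id p x 1 _ (is_derive_id x 1).
  by rewrite /GRing.scale/= mulr1 fctE.
have d4 := is_deriveM d3 d2.
apply: (is_derive_eq d4); rewrite /gauss_integrand /GRing.scale/= (exprS x p); ring.
Qed.

Lemma gauss_moment_rec c h p : 0 < c ->
  2 * c * gauss_moment c h p.+1 = h * gauss_moment c h p + p%:R * gauss_moment c h p.-1.
Proof.
move=> c0; have gi q := integrable_gauss_integrand h q c0.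
have gZ k q := @integrable_EFinZl _ mT R mu k _ (gi q).
have gDi := @integrable_EFinD _ mT R mu _ _ (gZ p%:R p.-1) (gZ h p).
have gDB := @integrable_EFinB _ mT R mu _ _ gDi (gZ (2 * c) p.+1).
have := integral_derive_eq0 (is_derive_gauss_integrand c h p) _ gDB.
move=> /(_ _ (cvg_gauss_integrand_y _ _ c0) (cvg_gauss_integrand_Ny _ _ c0)) e.
have {}e : \int[mu]_x (p%:R * gauss_integrand c h p.-1 x + h * gauss_integrand c h p x -
      2 * c * gauss_integrand c h p.+1 x) = 0.
  rewrite /Rintegral e//.
  move=> x; apply: cvgB; [apply: cvgD|]; apply: cvgM; try exact: cvg_cst;
    exact: continuous_gauss_integrand.
move: e; rewrite RintegralB// RintegralD// !RintegralZl// => e.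
by rewrite addrC; apply/esym/eqP; rewrite -subr_eq0 e.
Qed.

Lemma gauss_moment0 c h : 0 < c ->
  gauss_moment c h 0 = Num.sqrt (pi / c) * expR (h ^+ 2 / (4 * c)).
Proof.
move=> c0; rewrite /gauss_moment /Rintegral /gauss_integrand.
by under eq_integral do rewrite expr0 mul1r; rewrite integral_gauss.
Qed.

(** The exponents p and q of the coordinates are kept although only p = q = 0 is wanted: writing a
    factor u or conj u as x + i y or x - i y moves it into them, until at j = k = 0 the integral
    factors into one-dimensional moments. *)
Definition planar_gauss_monomial (c h : R) (p q j k : nat) (u : C) : C :=
  (gauss_integrand c h p (complex.Re u) * gauss_integrand c 0 q (complex.Im u))%:C *
  (u ^+ j * conjc u ^+ k).

Lemma imaginary_sqr : 'i * 'i = -1 :> C.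
Proof. by apply: complex_ext => /=; ring. Qed.

Lemma planar_gauss_monomialJ c h p q j k u :
  planar_gauss_monomial c h p q j.+1 k u =
  planar_gauss_monomial c h p.+1 q j k u + 'i * planar_gauss_monomial c h p q.+1 j k u.
Proof.
have e : u = (complex.Re u)%:C + 'i * (complex.Im u)%:C.
  by case: u => a b; apply: complex_ext => /=; ring.
rewrite /planar_gauss_monomial exprS [X in X * u ^+ j]e /gauss_integrand.
rewrite (exprS (complex.Re u) p) (exprS (complex.Im u) q) !rmorphM/=; ring.
Qed.

Lemma planar_gauss_monomialK c h p q j k u :
  planar_gauss_monomial c h p q j k.+1 u =
  planar_gauss_monomial c h p.+1 q j k u - 'i * planar_gauss_monomial c h p q.+1 j k u.
Proof.
have e : conjc u = (complex.Re u)%:C - 'i * (complex.Im u)%:C.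
  by case: u => a b; apply: complex_ext => /=; ring.
rewrite /planar_gauss_monomial exprS [X in X * conjc u ^+ k]e /gauss_integrand.
rewrite (exprS (complex.Re u) p) (exprS (complex.Im u) q) !rmorphM/=; ring.
Qed.

Lemma cintegrable_planar_gauss_monomial c h p q j k : 0 < c ->
  cintegrable (planar_gauss_monomial c h p q j k).
Proof.
move=> c0; elim: j k p q => [|j IH] k p q; last first.
  apply: (@eq_cintegrable _ (fun u => planar_gauss_monomial c h p.+1 q j k u +
    'i * planar_gauss_monomial c h p q.+1 j k u)).
    by move=> u; rewrite planar_gauss_monomialJ.
  by apply: cintegrableD => //; exact: cintegrableZl.
elim: k p q => [|k IH] p q; last first.
  apply: (@eq_cintegrable _ (fun u => planar_gauss_monomial c h p.+1 q 0 k u +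
    (- 'i) * planar_gauss_monomial c h p q.+1 0 k u)).
    by move=> u; rewrite planar_gauss_monomialK mulNr.
  by apply: cintegrableD => //; exact: cintegrableZl.
have i1 := @integrable_prodfun R _ _ (integrable_gauss_integrand h p c0)
  (integrable_gauss_integrand 0 q c0).
apply: (@eq_cintegrable _ (fun u => (gauss_integrand c h p (complex.Re u) *
    gauss_integrand c 0 q (complex.Im u))%:C)).
  by move=> u; rewrite /planar_gauss_monomial !expr0 !mulr1.
by split; rewrite /planar /=; [exact: i1|exact: integrable0].
Qed.

Definition planar_gauss_moment c h p q j k : C :=
  cintegral (planar_gauss_monomial c h p q j k).

Lemma planar_gauss_momentJ c h p q j k : 0 < c ->
  planar_gauss_moment c h p q j.+1 k =
  planar_gauss_moment c h p.+1 q j k + 'i * planar_gauss_moment c h p q.+1 j k.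
Proof.
move=> c0; have ci p' q' := cintegrable_planar_gauss_monomial h p' q' j k c0.
rewrite /planar_gauss_moment -cintegralZl// -cintegralD//; last exact: cintegrableZl.
by apply: eq_cintegral => u; exact: planar_gauss_monomialJ.
Qed.

Lemma planar_gauss_momentK c h p q j k : 0 < c ->
  planar_gauss_moment c h p q j k.+1 =
  planar_gauss_moment c h p.+1 q j k - 'i * planar_gauss_moment c h p q.+1 j k.
Proof.
move=> c0; have ci p' q' := cintegrable_planar_gauss_monomial h p' q' j k c0.
rewrite /planar_gauss_moment -mulNr -cintegralZl// -cintegralD//; last exact: cintegrableZl.
by apply: eq_cintegral => u; rewrite planar_gauss_monomialK mulNr.
Qed.

Lemma planar_gauss_moment00 c h p q : 0 < c ->
  planar_gauss_moment c h p q 0 0 = (gauss_moment c h p * gauss_moment c 0 q)%:C.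
Proof.
move=> c0; transitivity (cintegral (fun u => (gauss_integrand c h p (complex.Re u) *
    gauss_integrand c 0 q (complex.Im u))%:C)).
  by apply: eq_cintegral => u; rewrite /planar_gauss_monomial !expr0 !mulr1.
rewrite /cintegral /planar; apply: complex_ext => /=; last by rewrite /Rintegral integral0.
rewrite (@Rintegral_prodfun R _ _ (integrable_gauss_integrand h p c0)
  (integrable_gauss_integrand 0 q c0))//.
Qed.

Lemma planar_gauss_moment_closed_form c h j k : 0 < c -> h != 0 ->
  planar_gauss_moment c h 0 0 j k =
  (pi / c * expR (h ^+ 2 / (4 * c)) * (h / (2 * c)) ^+ (j + k) *
    falling_sum (4 * c / h ^+ 2) j k)%:C.
Proof.
move=> c0 h0.
have X0 p q : (2 * c)%:C * planar_gauss_moment c h p.+1 q 0 0 =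
    h%:C * planar_gauss_moment c h p q 0 0 + p%:R * planar_gauss_moment c h p.-1 q 0 0.
  rewrite !planar_gauss_moment00// -[p%:R](rmorph_nat (real_complex R)).
  by rewrite -!rmorphM -rmorphD/= !mulrA gauss_moment_rec// mulrDl.
have Y0 p q : (2 * c)%:C * planar_gauss_moment c h p q.+1 0 0 =
    q%:R * planar_gauss_moment c h p q.-1 0 0.
  rewrite !planar_gauss_moment00// -[q%:R](rmorph_nat (real_complex R)).
  by rewrite -!rmorphM/= mulrCA gauss_moment_rec// mul0r add0r mulrCA.
have [HX HY] := @mixed_moment_recursion C 'i (2 * c)%:C h%:C
  (planar_gauss_moment c h) imaginary_sqr
  (fun p q j k => planar_gauss_momentJ h p q j k c0)
  (fun p q j k => planar_gauss_momentK h p q j k c0) X0 Y0.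
have c2 : (2 * c)%:C = c%:C + c%:C by rewrite -rmorphD/=; congr (_%:C); ring.
pose N j k := planar_gauss_moment c h 0 0 j k.
(* In x + i y the contributions of u^j from the two integrations by parts cancel and those of conj
   u^k double. The factor 2 is removed below by passing from h to h / 2, which gives the mean h / (2
   c). *)
have NJ j' k' : (2 * c)%:C * N j'.+1 k' = h%:C * N j' k' + k'%:R * N j' k'.-1 *+ 2.
  rewrite /N planar_gauss_momentJ// mulrDr HX mulrCA HY.
  ring: imaginary_sqr.
have NK k' : (2 * c)%:C * N 0%N k'.+1 = h%:C * N 0%N k'.
  rewrite /N planar_gauss_momentK// mulrBr HX mulrCA HY.
  ring: imaginary_sqr.
have h0C : h%:C != 0 :> C by rewrite eq_complex/= negb_and h0.
have c0C : c%:C != 0 :> C by rewrite eq_complex/= negb_and gt_eqF.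
have h2 : h%:C = (h / 2)%:C + (h / 2)%:C by rewrite -rmorphD/=; congr (_%:C); field.
have two0 : (2 : C) != 0 by rewrite pnatr_eq0.
have N00 : N 0%N 0%N = (pi / c * expR (h ^+ 2 / (4 * c)))%:C.
  rewrite /N planar_gauss_moment00// !gauss_moment0//; congr (_%:C).
  rewrite expr0n/= mul0r expR0 mulr1 mulrAC -expr2 sqr_sqrtr//.
  by rewrite divr_ge0 ?pi_ge0// ltW.
rewrite rmorphM/= [X in X * _]rmorphM/= -N00 rmorphXn/=.
have -> : (falling_sum (4 * c / h ^+ 2) j k)%:C = falling_sum (4 * c / h ^+ 2)%:C j k :> C.
  rewrite /falling_sum rmorph_sum/=; apply: eq_bigr => m _.
  by rewrite rmorphM rmorphXn/= rmorph_nat.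
apply: (@falling_sum_closed_form C c%:C (h / 2)%:C _ _ N c0C).
- by rewrite -fmorphV -rmorphM/=; congr (_%:C); field; rewrite gt_eqF.
- by rewrite -rmorphXn -fmorphV -rmorphM/=; congr (_%:C); field.
- by rewrite eq_complex/= negb_and mulf_neq0.
- move=> j' k'; apply: (mulfI two0); have := NJ j' k'; rewrite c2 h2 => e.
  by transitivity ((c%:C + c%:C) * N j'.+1 k'); [ring|rewrite e; ring].
- move=> k'; apply: (mulfI two0); have := NK k'; rewrite c2 h2 => e.
  by transitivity ((c%:C + c%:C) * N 0%N k'.+1); [ring|rewrite e; ring].
Qed.

End GaussianMoments.

(** * Moments of the mixture *)

Section PlanarMeasure.
Context {R : realType}.
Local Notation mu := (@lebesgue_measure R).
Local Notation mT := (measurableTypeR R).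

(** [planar] is typed as a bare set function. It is registered here as a sigma-finite measure, so
    that integration theorems and Fubini's theorem apply to it. *)
Let planar0 : @planar R set0 = 0%E.
Proof. by rewrite /planar; exact: measure0. Qed.

Let planar_ge0 (A : set (mT * mT)) : (0 <= planar A)%E.
Proof. by rewrite /planar; exact: measure_ge0. Qed.

Let planar_sigma_additive : semi_sigma_additive (@planar R).
Proof. by rewrite /planar; exact: measure_semi_sigma_additive. Qed.

HB.instance Definition _ := isMeasure.Build _ _ _ (@planar R)
  planar0 planar_ge0 planar_sigma_additive.

Let planar_sigma_finite : sigma_finite setT (@planar R).
Proof.
exists (fun n : nat => `[(- n%:R)%R, n%:R]%classic `*` `[(- n%:R)%R, n%:R]%classic).
  apply/seteqP; split=> // -[x y] _.
  have : [set: R] `|x| by []. have : [set: R] `|y| by [].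
  rewrite -symitv_bigcup => -[n _ hn] [m _ hm]; exists (maxn m n) => //.
  have S k : (k <= maxn m n)%N -> `[(- k%:R)%R, k%:R]%classic `<=`
      (`[(- (maxn m n)%:R)%R, (maxn m n)%:R]%classic : set R).
    by move=> kmn; apply/subsetPset; exact: symitv_ndseq.
  split => /=.
    have := S _ (leq_maxl m n) _ hm; rewrite /= !in_itv/= => /andP[_].
    by rewrite ler_norml.
  have := S _ (leq_maxr m n) _ hn; rewrite /= !in_itv/= => /andP[_].
  by rewrite ler_norml.
move=> n; split; first by apply: measurableX; exact: measurable_itv.
rewrite /planar product_measure1E; [|exact: measurable_itv..].
have h : (mu `[(- n%:R)%R, n%:R] < +oo)%E.
  by rewrite lebesgue_measure_itv/=; case: ifP => _; rewrite -?EFinD ltry.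
by apply: lte_mul_pinfty => //; rewrite ge0_fin_numE.
Qed.

HB.instance Definition _ := Measure_isSigmaFinite.Build _ _ _ (@planar R)
  planar_sigma_finite.

End PlanarMeasure.

Section Mixture.
Context {R : realType}.
Local Notation mu := (@lebesgue_measure R).
Local Notation mT := (measurableTypeR R).

Lemma ae_eq_integrable d (T : measurableType d) (m : {measure set T -> \bar R})
    (f g : T -> \bar R) :
  measurable_fun setT g -> ae_eq m setT f g -> m.-integrable setT f ->
  m.-integrable setT g.
Proof.
move=> mg fg /integrableP[mf fi]; apply/integrableP; split=> //.
rewrite (@ae_eq_integral _ _ _ m setT (abse \o f))//.
- exact: measurableT_comp.
- exact: measurableT_comp.
- apply: filterS fg => x /= + h; by move=> /(_ h) ->.
Qed.

Lemma set1_prod (x y : mT) : [set (x, y)] = [set x] `*` [set y] :> set (mT * mT).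
Proof. by apply/seteqP; split=> [[a b] [-> ->]|[a b] [/= -> ->]]. Qed.

Lemma planar_set1 (p : mT * mT) : planar [set p] = 0%E.
Proof.
case: p => x y; rewrite set1_prod /planar product_measure1E; [|exact: measurable_set1..].
by rewrite [X in (X * _)%E]lebesgue_measure_set1 mul0e.
Qed.

Definition sqnorm (p : mT * mT) : R := p.1 ^+ 2 + p.2 ^+ 2.

Lemma measurable_sqnorm : measurable_fun setT sqnorm.
Proof.
apply: measurable_funD; apply: measurable_funX; first exact: measurable_fst.
exact: measurable_snd.
Qed.

(* Integrated in [t] this is [2 * (x / 2) ^ nu * K_nu x] at [x = 2 * sqrt q * |u|];
   see [integral_besselK]. *)
Definition mixture_kernel (nu q t : R) (p : mT * mT) : R :=
  expR (nu * t - 1 * expR t - q * sqnorm p * expR (- t)).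

Definition mixture (nu q : R) (p : mT * mT) : R := \int[mu]_t mixture_kernel nu q t p.

Lemma measurable_mixture_kernel nu q :
  measurable_fun setT (fun z : (mT * mT) * mT => mixture_kernel nu q z.2 z.1).
Proof.
have mt : measurable_fun setT (fun z : (mT * mT) * mT => z.2) by exact: measurable_snd.
have mp : measurable_fun setT (fun z : (mT * mT) * mT => sqnorm z.1).
  exact: (measurableT_comp measurable_sqnorm measurable_fst).
apply: measurableT_comp => //; apply: measurable_funB; [apply: measurable_funB|].
- by apply: measurable_funM => //; exact: measurable_cst.
- apply: measurable_funM; first exact: measurable_cst.
  exact: measurableT_comp mt.
- apply: measurable_funM; first by apply: measurable_funM => //; exact: measurable_cst.
  by apply: measurableT_comp => //; exact: measurableT_comp mt.
Qed.

Lemma mixture_kernel_ge0 nu q t p : 0 <= mixture_kernel nu q t p.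
Proof. exact: expR_ge0. Qed.

Lemma measurable_mixture nu q : measurable_fun setT (mixture nu q).
Proof.
apply: measurableT_comp; first exact: fine_measurable.
apply: (@measurable_fun_fubini_tonelli_F _ _ (mT * mT)%type mT R mu
  (fun z => (mixture_kernel nu q z.2 z.1)%:E)).
  by apply/measurable_EFinP; exact: measurable_mixture_kernel.
by move=> z; rewrite lee_fin mixture_kernel_ge0.
Qed.

Lemma sqnorm_gt0 p : p <> (0, 0) -> 0 < sqnorm p.
Proof.
case: p => x y; rewrite /sqnorm/= => h; rewrite lt_neqAle addr_ge0 ?sqr_ge0// andbT eq_sym.
by apply/eqP => /eqP; rewrite paddr_eq0 ?sqr_ge0// !sqrf_eq0 => /andP[/eqP x0 /eqP y0];
  apply: h; rewrite x0 y0.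
Qed.

(** The majorant concerns only the factor f; its joint integrability with the kernel gives
    integrability on the plane and the exchange of integrals at once. *)
Lemma mixture_Fubini nu q (f G : mT * mT -> R) : 0 < q ->
  measurable_fun setT f -> (forall p, `|f p| <= G p) ->
  (planar \x mu)%E.-integrable setT
    (EFin \o (fun z : (mT * mT) * mT => G z.1 * mixture_kernel nu q z.2 z.1)) ->
  planar.-integrable setT (EFin \o (fun p => f p * mixture nu q p)) /\
  (\int[planar]_p (f p * mixture nu q p)%:E =
   \int[mu]_t \int[planar]_p (f p * mixture_kernel nu q t p)%:E)%E.
Proof.
move=> q0 mf fG Gi.
pose H (z : (mT * mT) * mT) := f z.1 * mixture_kernel nu q z.2 z.1.
have mfz : measurable_fun setT (fun z : (mT * mT) * mT => f z.1).
  exact: (measurableT_comp mf measurable_fst).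
have mH : measurable_fun setT H.
  by apply: measurable_funM => //; exact: measurable_mixture_kernel.
have Hi : (planar \x mu)%E.-integrable setT (EFin \o H).
  apply: (integrable_dominated mH _ Gi) => z.
  by rewrite /H normrM (ger0_norm (mixture_kernel_ge0 _ _ _ _)) ler_wpM2r ?mixture_kernel_ge0 ?fG.
(* At the origin the kernel is e^(nu t - e^t), not integrable for nu <= 0, and there [mixture] takes
   the value [fine +oo], that is 0. The two functions therefore agree only almost everywhere. *)
have ae : ae_eq planar setT (fun p => \int[mu]_t (H (p, t))%:E)%E
    (EFin \o (fun p => f p * mixture nu q p)).
  exists [set (0, 0)]; split.
  - by rewrite set1_prod; apply: measurableX; exact: measurable_set1.
  - exact: planar_set1.
  - move=> p /= h; apply: contrapT => p0; apply: h => _.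
    have qp : 0 < q * sqnorm p by rewrite mulr_gt0//; exact: sqnorm_gt0.
    have ki : mu.-integrable setT (EFin \o (fun t => mixture_kernel nu q t p)).
      exact: integrable_expR_mixed.
    rewrite /H/= EFinM /mixture /Rintegral fineK; last exact: integrable_fin_num.
    by rewrite -(integralZl measurableT ki).
have mfm : measurable_fun setT (EFin \o (fun p => f p * mixture nu q p)).
  by apply/measurable_EFinP; apply: measurable_funM => //; exact: measurable_mixture.
split.
  apply: (ae_eq_integrable mfm ae); exact: (integrable_fubini_F Hi).
rewrite -(@ae_eq_integral _ _ _ planar setT _ _ measurableT _ mfm ae); last first.
  exact: (measurable_fubini_F Hi).
by rewrite (integral12_prod_meas1 Hi) -(integral21_prod_meas1 Hi).
Qed.

Lemma planar_gauss_exp c h k : 0 < c ->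
  planar.-integrable setT (EFin \o (fun p => expR (h * p.1 + k * p.2 - c * sqnorm p))) /\
  (\int[planar]_p (expR (h * p.1 + k * p.2 - c * sqnorm p))%:E =
    (pi / c * expR ((h ^+ 2 + k ^+ 2) / (4 * c)))%:E)%E.
Proof.
move=> c0.
have e : (fun p : mT * mT => expR (h * p.1 + k * p.2 - c * sqnorm p)) =
  (fun p : mT * mT => expR (h * p.1 - c * p.1 ^+ 2) * expR (k * p.2 - c * p.2 ^+ 2)).
  apply/funext => p; rewrite -expRD /sqnorm; congr expR; ring.
have ih := integrable_gauss h c0; have ik := integrable_gauss k c0.
have i2 := integrable_prodfun ih ik.
have ei : planar.-integrable setT (EFin \o (fun p => expR (h * p.1 + k * p.2 - c * sqnorm p))).
  by rewrite e.
split=> //; rewrite -(fineK (integrable_fin_num measurableT ei)).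
congr (_%:E); transitivity (\int[planar]_p
   (expR (h * p.1 - c * p.1 ^+ 2) * expR (k * p.2 - c * p.2 ^+ 2))).
  by rewrite -e.
apply: (etrans (Rintegral_prodfun ih ik)); rewrite /Rintegral !integral_gauss//= mulrACA -expRD.
rewrite -expr2 sqr_sqrtr ?divr_ge0 ?pi_ge0 ?(ltW c0)//; congr (_ * expR _).
by rewrite -mulrDl.
Qed.

(** By Tonelli with t outermost: the planar integral is (pi / q) e^t exp(e^t (h^2 + k^2) / (4 q)).
    The first exponential shifts nu to nu + 1, whence nu > -1; the second must not outweigh exp(-
    e^t), whence the bound on h^2 + k^2. *)
Lemma integrable_mixture_exp nu q h k : -1 < nu -> 0 < q -> h ^+ 2 + k ^+ 2 < 4 * q ->
  (planar \x mu)%E.-integrable setT (EFin \o (fun z : (mT * mT) * mT =>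
    expR (h * z.1.1 + k * z.1.2) * mixture_kernel nu q z.2 z.1)).
Proof.
move=> nu1 q0 hk.
have mh : measurable_fun setT (fun z : (mT * mT) * mT =>
    expR (h * z.1.1 + k * z.1.2) * mixture_kernel nu q z.2 z.1).
  apply: measurable_funM; last exact: measurable_mixture_kernel.
  apply: measurableT_comp => //; apply: measurable_funD; apply: measurable_funM;
    try exact: measurable_cst.
    exact: (measurableT_comp measurable_fst measurable_fst).
  exact: (measurableT_comp measurable_snd measurable_fst).
apply/integrable21ltyP; first exact/measurable_EFinP.
have -> : (\int[mu]_t \int[planar]_p `|((fun z : (mT * mT) * mT =>
    expR (h * z.1.1 + k * z.1.2) * mixture_kernel nu q z.2 z.1) (p, t))%:E| =
  \int[mu]_t (pi / q * expR ((nu + 1) * t - (1 - (h ^+ 2 + k ^+ 2) / (4 * q)) * expR t))%:E)%E.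
  apply: eq_integral => t _ /=.
  have c0 : 0 < q * expR (- t) by rewrite mulr_gt0 ?expR_gt0.
  have [ci ce] := planar_gauss_exp h k c0.
  under eq_integral.
    move=> p _; rewrite ger0_norm ?mulr_ge0 ?expR_ge0//.
    have -> : expR (h * p.1 + k * p.2) * mixture_kernel nu q t p =
       expR (nu * t - 1 * expR t) * expR (h * p.1 + k * p.2 - q * expR (- t) * sqnorm p).
      rewrite /mixture_kernel -!expRD; congr expR; ring.
    rewrite EFinM; over.
  rewrite (integralZl measurableT ci) ce -EFinM; congr (_%:E).
  have eN : (expR (- t))^-1 = expR t by rewrite expRN invrK.
  have -> : pi / (q * expR (- t)) = pi / q * expR t by rewrite invfM eN mulrA.
  have -> : (h ^+ 2 + k ^+ 2) / (4 * (q * expR (- t))) = (h ^+ 2 + k ^+ 2) / (4 * q) * expR t.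
    by rewrite mulrA invfM eN mulrA.
  rewrite mulrCA -!mulrA; congr (_ * (_ * _)).
  by rewrite -!expRD; congr expR; ring.
have l0 : 0 < 1 - (h ^+ 2 + k ^+ 2) / (4 * q).
  by rewrite subr_gt0 ltr_pdivrMr ?mul1r// mulr_gt0.
have n0 : 0 < nu + 1 by rewrite -ltrBlDr sub0r.
have ii := @integrable_EFinZl _ mT R mu (pi / q) _ (integrable_expR_expR n0 l0).
by rewrite -(fineK (integrable_fin_num measurableT ii)) ltry.
Qed.

(** It dominates e^(g |u|), yet it is a sum of four exponentials of linear forms, to which the
    explicit Gaussian integral applies. Each has h^2 + k^2 = 2 g^2, so that the requirement becomes
    g^2 < 2 q. *)
Definition exp_envelope (g : R) (p : mT * mT) : R :=
  (expR (g * p.1) + expR (- g * p.1)) * (expR (g * p.2) + expR (- g * p.2)).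

Lemma exp_envelope_ge (g : R) (p : mT * mT) : 0 <= g ->
  expR (g * cabs (p.1 +i* p.2)) <= exp_envelope g p.
Proof.
move=> g0; apply: (@le_trans _ _ (expR `|g * p.1| * expR `|g * p.2|)).
  rewrite -expRD ler_expR !normrM (ger0_norm g0) -mulrDr ler_wpM2l//.
  exact: cabs_le.
by rewrite /exp_envelope !mulNr ler_pM ?expR_ge0// expR_norm_le.
Qed.

Lemma integrable_mixture_envelope nu q g : -1 < nu -> 0 < q -> g ^+ 2 < 2 * q ->
  (planar \x mu)%E.-integrable setT (EFin \o (fun z : (mT * mT) * mT =>
    exp_envelope g z.1 * mixture_kernel nu q z.2 z.1)).
Proof.
move=> nu1 q0 gq.
have I h k : h ^+ 2 = g ^+ 2 -> k ^+ 2 = g ^+ 2 ->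
    (planar \x mu)%E.-integrable setT (EFin \o (fun z : (mT * mT) * mT =>
      expR (h * z.1.1 + k * z.1.2) * mixture_kernel nu q z.2 z.1)).
  by move=> hg kg; apply: integrable_mixture_exp => //; rewrite hg kg; lra.
rewrite (_ : (fun z : (mT * mT) * mT => exp_envelope g z.1 * mixture_kernel nu q z.2 z.1) =
  (fun z => (expR (g * z.1.1 + g * z.1.2) * mixture_kernel nu q z.2 z.1 +
    expR (g * z.1.1 + - g * z.1.2) * mixture_kernel nu q z.2 z.1) +
   (expR (- g * z.1.1 + g * z.1.2) * mixture_kernel nu q z.2 z.1 +
    expR (- g * z.1.1 + - g * z.1.2) * mixture_kernel nu q z.2 z.1))); last first.
  by apply/funext => z; rewrite /exp_envelope !expRD; ring.
by apply: integrable_EFinD; apply: integrable_EFinD; apply: I; rewrite ?sqrrN.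
Qed.

End Mixture.

Section MixtureMoments.
Context {R : realType}.
Local Notation C := R[i].
Local Notation mu := (@lebesgue_measure R).
Local Notation mT := (measurableTypeR R).

Lemma ReMr (x : C) (r : R) : complex.Re (x * r%:C) = complex.Re x * r.
Proof. by rewrite ReM/= mulr0 subr0. Qed.
Lemma ImMr (x : C) (r : R) : complex.Im (x * r%:C) = complex.Im x * r.
Proof. by rewrite ImM/= mulr0 add0r. Qed.

Definition cmixture (nu q : R) (u : C) : R := mixture nu q (complex.Re u, complex.Im u).

Lemma integrable_EFin_sum d (T : measurableType d) (m : {measure set T -> \bar R})
    (I : Type) (s : seq I) (F : I -> T -> R) :
  (forall i, m.-integrable setT (EFin \o F i)) ->
  m.-integrable setT (EFin \o (fun x => \sum_(i <- s) F i x)).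
Proof.
move=> Fi; elim: s => [|i s IH].
  by under eq_fun do rewrite big_nil; exact: integrable0.
by under eq_fun do rewrite big_cons; exact: integrable_EFinD.
Qed.

Lemma Rintegral_sum d (T : measurableType d) (m : {measure set T -> \bar R})
    (I : Type) (s : seq I) (F : I -> T -> R) :
  (forall i, m.-integrable setT (EFin \o F i)) ->
  \int[m]_x (\sum_(i <- s) F i x) = \sum_(i <- s) \int[m]_x F i x.
Proof.
move=> Fi; elim: s => [|i s IH].
  rewrite big_nil; under eq_Rintegral do rewrite big_nil.
  by rewrite /Rintegral integral0.
rewrite big_cons; under eq_Rintegral do rewrite big_cons.
by rewrite RintegralD// ?IH//; exact: integrable_EFin_sum.
Qed.

Lemma exp_envelope_ge0 (g : R) p : 0 <= exp_envelope g p.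
Proof. by rewrite mulr_ge0 ?addr_ge0 ?expR_ge0. Qed.

Lemma mixture_ge0 (nu q : R) p : 0 <= mixture nu q p.
Proof. by apply: Rintegral_ge0 => t _; exact: mixture_kernel_ge0. Qed.

Lemma measurable_exp_envelope (g : R) : measurable_fun setT (exp_envelope g).
Proof.
have me (h : R) (f : mT * mT -> R) : measurable_fun setT f ->
    measurable_fun setT (fun p => expR (h * f p)).
  move=> mf; apply: measurableT_comp => //.
  by apply: measurable_funM => //; exact: measurable_cst.
by apply: measurable_funM; apply: measurable_funD; apply: me;
  (exact: measurable_fst || exact: measurable_snd).
Qed.

Lemma integrable_envelope_mixture (nu q g : R) : -1 < nu -> 0 < q -> g ^+ 2 < 2 * q ->
  planar.-integrable setT (EFin \o (fun p => exp_envelope g p * mixture nu q p)).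
Proof.
move=> nu1 q0 gq.
have [] := @mixture_Fubini R nu q (exp_envelope g) (exp_envelope g) q0
  (measurable_exp_envelope g) _ (integrable_mixture_envelope nu1 q0 gq) => // p.
by rewrite ger0_norm ?exp_envelope_ge0.
Qed.

Lemma integrable_scaled_mixture_envelope (nu q g K : R) : -1 < nu -> 0 < q -> g ^+ 2 < 2 * q ->
  (planar \x mu)%E.-integrable setT (EFin \o (fun z : (mT * mT) * mT =>
    K * exp_envelope g z.1 * mixture_kernel nu q z.2 z.1)).
Proof.
move=> nu1 q0 gq; under eq_fun do rewrite -mulrA.
exact: integrable_EFinZl (integrable_mixture_envelope nu1 q0 gq).
Qed.

(** The gap g - |h| absorbs the polynomial factor. *)
Lemma cpoly_exp_le (h g : R) (j k : nat) : `|h| < g ->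
  exists2 K, 0 <= K & forall p : mT * mT,
    cabs ((p.1 +i* p.2) ^+ j * conjc (p.1 +i* p.2) ^+ k * (expR (h * p.1))%:C) <=
      K * exp_envelope g p.
Proof.
move=> hg; have e0 : 0 < g - `|h| by rewrite subr_gt0.
have g0 : 0 <= g by rewrite (le_trans _ (ltW hg)).
have [K K0 hK] := expn_le_expR (j + k) e0; exists K => // p.
set u := p.1 +i* p.2.
rewrite !cabsM !cabsX cabs_conj -exprD cabs_real (ger0_norm (expR_ge0 _)).
apply: (@le_trans _ _ (K * expR ((g - `|h|) * cabs u) * expR (`|h| * cabs u))).
  apply: ler_pM; rewrite ?exprn_ge0 ?cabs_ge0 ?expR_ge0//.
    by apply: hK; exact: cabs_ge0.
  rewrite ler_expR (le_trans (ler_norm _))// normrM ler_wpM2l//.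
  exact: (normr_Re_le u).
rewrite -mulrA -expRD -mulrDl subrK ler_wpM2l//; exact: exp_envelope_ge.
Qed.

(* The moment of [u ^ j * conj u ^ k] against [exp (h * Re u) * cmixture nu q u]. *)
Definition mixture_moment (nu q h : R) (j k : nat) : R :=
  let w := h ^+ 2 / (4 * q) in
  pi / q * (h / (2 * q)) ^+ (j + k) *
  \sum_(m < j.+1) ('C(j, m) * 'C(k, m) * m`!)%:R * w^-1 ^+ m *
     (Gamma (nu + 1 + (j + k)%:R - m%:R) *
        (1 - w) `^ (- (nu + 1 + (j + k)%:R - m%:R))).

(** The Gaussian at t has parameter q e^(-t): its mass and the j + k factors of the mean each bring
    e^t, and each pairing removes one. The exponent nu + 1 + j + k - m is positive because m <= j.
    The factor exp(w e^t) turns exp(- e^t) into exp(- (1 - w) e^t). *)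
Lemma Rintegral_mixture_moment (nu q h : R) (j k : nat) :
  -1 < nu -> 0 < q -> h != 0 -> h ^+ 2 < 4 * q ->
  (\int[mu]_t (expR (nu * t - 1 * expR t) * (pi / (q * expR (- t)) *
     expR (h ^+ 2 / (4 * (q * expR (- t)))) * (h / (2 * (q * expR (- t)))) ^+ (j + k) *
     falling_sum (4 * (q * expR (- t)) / h ^+ 2) j k)))%R = mixture_moment nu q h j k.
Proof.
move=> nu1 q0 h0 hq; rewrite /mixture_moment; set w := h ^+ 2 / (4 * q).
have w0 : 0 < w by apply: divr_gt0; [rewrite exprn_even_gt0|rewrite mulr_gt0].
have w1 : 0 < 1 - w by rewrite subr_gt0 ltr_pdivrMr ?mul1r// mulr_gt0.
pose A := pi / q * (h / (2 * q)) ^+ (j + k).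
pose e (m : 'I_j.+1) : R := nu + 1 + (j + k)%:R - m%:R.
have e0 m : 0 < e m.
  have : (m : nat)%:R <= (j + k)%:R :> R.
    by rewrite ler_nat (leq_trans (leq_ord m))// leq_addr.
  by rewrite /e => h1; lra.
pose F (m : 'I_j.+1) t : R := (A * (('C(j, m) * 'C(k, m) * m`!)%:R * w^-1 ^+ m)) *
   expR (e m * t - (1 - w) * expR t).
have Fi m : mu.-integrable setT (EFin \o F m).
  by apply: (@integrable_EFinZl _ mT); exact: integrable_expR_expR.
transitivity (\int[mu]_t (\sum_m F m t)).
  apply: eq_Rintegral => t _.
  have Et := expR_gt0 t; have eN : expR (- t) = (expR t)^-1 by rewrite expRN.
  rewrite /falling_sum eN.
  have -> : pi / (q / expR t) = pi / q * expR t.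
    by field; rewrite !gt_eqF.
  have -> : h / (2 * (q / expR t)) = h / (2 * q) * expR t.
    by field; rewrite !gt_eqF.
  have -> : h ^+ 2 / (4 * (q / expR t)) = w * expR t.
    by rewrite /w; field; rewrite !gt_eqF.
  have -> : 4 * (q / expR t) / h ^+ 2 = w^-1 * expR (- t).
    by rewrite /w eN; field; rewrite h0 !gt_eqF.
  rewrite !mulr_sumr; apply: eq_bigr => m _; rewrite /F /A /e.
  rewrite !exprMn -!expRM_natl.
  set P := (h / (2 * q)) ^+ (j + k); set B := w^-1 ^+ m.
  have -> : expR ((nu + 1 + (j + k)%:R - m%:R) * t - (1 - w) * expR t) =
    expR (nu * t - 1 * expR t) * expR t * expR (w * expR t) * expR ((j + k)%:R * t) *
      expR (m%:R * - t).
    by rewrite -!expRD; congr expR; ring.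
  ring.
rewrite Rintegral_sum// mulr_sumr; apply: eq_bigr => m _.
rewrite /F RintegralZl//; last exact: integrable_expR_expR.
by rewrite /Rintegral integral_expR_expR//= /A /e -!mulrA.
Qed.

(** Fubini's theorem is applied to the real and imaginary parts separately. At every t the planar
    moment is real, so the imaginary part vanishes. *)
Lemma cintegral_mixture_moment (nu q h g : R) (j k : nat) :
  -1 < nu -> 0 < q -> h != 0 -> `|h| < g -> g ^+ 2 < 2 * q ->
  cintegral (fun u => u ^+ j * conjc u ^+ k * (expR (h * complex.Re u))%:C *
    (cmixture nu q u)%:C) = (mixture_moment nu q h j k)%:C.
Proof.
move=> nu1 q0 h0 hg gq.
have hq : h ^+ 2 < 4 * q.
  have : h ^+ 2 < g ^+ 2 by rewrite -(real_normK (num_real h)) ltrXn2r// ?nnegrE// (le_trans _ (ltW hg)).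
  by move: gq q0; lra.
have [K K0 hK] := cpoly_exp_le j k hg.
pose f (u : C) := u ^+ j * conjc u ^+ k * (expR (h * complex.Re u))%:C.
have [mR mI] : cmeasurable f.
  apply: cmeasurableM; first by apply: cmeasurableM; apply: cmeasurableX;
    [exact: cmeasurable_id|exact: cmeasurable_conj].
  apply: cmeasurable_realfun => /=; apply: measurableT_comp => //.
  by apply: measurable_funM; [exact: measurable_cst|exact: measurable_fst].
have Gi := integrable_scaled_mixture_envelope K nu1 q0 gq.
have c0 t : 0 < q * expR (- t) by rewrite mulr_gt0 ?expR_gt0.
have [_ eR] := mixture_Fubini q0 mR (fun p => le_trans (normr_Re_le _) (hK p)) Gi.
have [_ eI] := mixture_Fubini q0 mI (fun p => le_trans (normr_Im_le _) (hK p)) Gi.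
have fk t p : (complex.Re (f (p.1 +i* p.2)) * mixture_kernel nu q t p =
    expR (nu * t - 1 * expR t) * complex.Re (planar_gauss_monomial (q * expR (- t)) h 0 0 j k (p.1 +i* p.2))) /\
  (complex.Im (f (p.1 +i* p.2)) * mixture_kernel nu q t p =
    expR (nu * t - 1 * expR t) * complex.Im (planar_gauss_monomial (q * expR (- t)) h 0 0 j k (p.1 +i* p.2))).
  rewrite /f /planar_gauss_monomial /gauss_integrand !expr0.
  set v := _ ^+ j * _; move: v => v.
  have -> : mixture_kernel nu q t p = expR (nu * t - 1 * expR t) *
     (expR (h * p.1 - q * expR (- t) * p.1 ^+ 2) *
       expR (0 * p.2 - q * expR (- t) * p.2 ^+ 2)) * expR (- (h * p.1)).
    by rewrite /mixture_kernel /sqnorm -!expRD; congr expR; ring.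
  have e1 : expR (h * p.1) * expR (- (h * p.1)) = 1 by rewrite -expRD subrr expR0.
  rewrite ![_%:C * v]mulrC !ReMr !ImMr.
  rewrite -[complex.Re (p.1 +i* p.2)]/p.1 -[complex.Im (p.1 +i* p.2)]/p.2.
  by split; ring: e1.
have NE t := planar_gauss_moment_closed_form j k (c0 t) h0.
have giR t : planar.-integrable setT (EFin \o (fun p : mT * mT => complex.Re
    (planar_gauss_monomial (q * expR (- t)) h 0 0 j k (p.1 +i* p.2)))).
  exact: (cintegrable_planar_gauss_monomial h 0 0 j k (c0 t)).1.
have giI t : planar.-integrable setT (EFin \o (fun p : mT * mT => complex.Im
    (planar_gauss_monomial (q * expR (- t)) h 0 0 j k (p.1 +i* p.2)))).
  exact: (cintegrable_planar_gauss_monomial h 0 0 j k (c0 t)).2.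
rewrite /cintegral; apply: complex_ext => /=.
  rewrite -(Rintegral_mixture_moment j k nu1 q0 h0 hq) /Rintegral; congr fine.
  transitivity (\int[planar]_p (complex.Re (f (p.1 +i* p.2)) * mixture nu q p)%:E)%E.
    by apply: eq_integral => p _; rewrite ReMr /cmixture/= -surjective_pairing.
  rewrite eR; apply: eq_integral => t _.
  under eq_integral do rewrite (fk _ _).1 EFinM.
  rewrite (integralZl measurableT (giR t)) -(fineK (integrable_fin_num measurableT (giR t))).
  by rewrite -EFinM; congr ((_ * _)%:E); have [<- _] := NE t.
transitivity (fine (\int[planar]_p (complex.Im (f (p.1 +i* p.2)) * mixture nu q p)%:E)%E).
  by congr fine; apply: eq_integral => p _; rewrite ImMr /cmixture/= -surjective_pairing.
rewrite eI integral0_eq// => t _.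
under eq_integral do rewrite (fk _ _).2 EFinM.
rewrite (integralZl measurableT (giI t)) -(fineK (integrable_fin_num measurableT (giI t))).
transitivity ((expR (nu * t - 1 * expR t))%:E * 0%:E)%E; last by rewrite mule0.
by congr (_ * _%:E)%E; have [_] := NE t.
Qed.

End MixtureMoments.

(** * Complex series *)

Section ComplexSequences.
Context {R : realType}.
Local Notation C := R[i].
Implicit Types (u v : nat -> C) (a b l : C).

(** Componentwise, so that real limit theorems apply directly; [ccvg_limn] connects it with the norm
    topology of [R[i]^o], in which the Bessel series is defined. *)
Definition ccvg u l : Prop :=
  complex.Re (u n) @[n --> \oo] --> complex.Re l /\
  complex.Im (u n) @[n --> \oo] --> complex.Im l.

Lemma ReB a b : complex.Re (a - b) = complex.Re a - complex.Re b.
Proof. by case: a b => [? ?] []. Qed.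
Lemma ImB a b : complex.Im (a - b) = complex.Im a - complex.Im b.
Proof. by case: a b => [? ?] []. Qed.

Lemma ccvg_unique u a b : ccvg u a -> ccvg u b -> a = b.
Proof.
move=> [a1 a2] [b1 b2]; apply: complex_ext.
  exact: (cvg_unique _ a1 b1).
exact: (cvg_unique _ a2 b2).
Qed.

Lemma ccvg_cst a : ccvg (fun=> a) a.
Proof. by split; exact: cvg_cst. Qed.

Lemma ccvgD u v a b : ccvg u a -> ccvg v b -> ccvg (fun n => u n + v n) (a + b).
Proof.
move=> [a1 a2] [b1 b2]; split.
  by rewrite ReD; under eq_fun do rewrite ReD; exact: cvgD.
by rewrite ImD; under eq_fun do rewrite ImD; exact: cvgD.
Qed.

Lemma ccvgM u v a b : ccvg u a -> ccvg v b -> ccvg (fun n => u n * v n) (a * b).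
Proof.
move=> [a1 a2] [b1 b2]; split.
  by rewrite ReM; under eq_fun do rewrite ReM; apply: cvgB; exact: cvgM.
by rewrite ImM; under eq_fun do rewrite ImM; apply: cvgD; exact: cvgM.
Qed.

Lemma ccvg_real (u : nat -> R) (a : R) :
  u n @[n --> \oo] --> a -> ccvg (fun n => (u n)%:C) a%:C.
Proof. by move=> ua; split => //=; exact: cvg_cst. Qed.

Lemma eq_ccvg u v l : u =1 v -> ccvg u l -> ccvg v l.
Proof. by move=> /funext ->. Qed.

Lemma ccvg_squeeze u l (e : nat -> R) :
  (forall n, cabs (u n - l) <= e n) -> e n @[n --> \oo] --> (0 : R) -> ccvg u l.
Proof.
move=> ue e0.
have S (f : nat -> R) (x : R) : (forall n, `|f n - x| <= e n) -> f n @[n --> \oo] --> x.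
  move=> fe.
  have l1 : x - e n @[n --> \oo] --> x.
    by rewrite -[X in _ --> X](subr0 x); apply: cvgB => //; exact: cvg_cst.
  have l2 : x + e n @[n --> \oo] --> x.
    by rewrite -[X in _ --> X](addr0 x); apply: cvgD => //; exact: cvg_cst.
  by apply: (squeeze_cvgr _ l1 l2); apply: nearW => n; rewrite -ler_distl fe.
split; apply: S => n; apply: (le_trans _ (ue n)).
  by rewrite -ReB; exact: normr_Re_le.
by rewrite -ImB; exact: normr_Im_le.
Qed.

Lemma ccvg_limn u l : ccvg u l -> limn (u : nat -> R[i]^o) = l.
Proof.
move=> [u1 u2]; apply: cvg_lim; first exact: norm_hausdorff.
apply/cvgrPdist_le => e e0.
(* The epsilon of the norm topology is a complex number; in the order on [R[i]], positivity forces
   it to be real. *)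
have [er er0 eE] : exists2 er : R, 0 < er & e = er%:C.
  move: e0; case: e => x y; rewrite ltcE/= => /andP[/eqP y0 x0].
  by exists x => //; rewrite y0.
rewrite eE; have er2 : 0 < er / 2 by rewrite divr_gt0.
have H1 : \forall n \near \oo, `|complex.Re l - complex.Re (u n)| <= er / 2.
  by move/cvgrPdist_le: u1; apply.
have H2 : \forall n \near \oo, `|complex.Im l - complex.Im (u n)| <= er / 2.
  by move/cvgrPdist_le: u2; apply.
apply: filterS2 H1 H2 => n h1 h2.
rewrite normc_def lecR.
have -> : Num.sqrt (complex.Re (l - u n) ^+ 2 + complex.Im (l - u n) ^+ 2) =
  cabs (l - u n) by case: (l - u n).
by apply: (le_trans (cabs_le _)); rewrite (splitr er) lerD// (ReB, ImB).
Qed.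

Lemma cabs_sum_le (I : Type) (s : seq I) (F : I -> C) :
  cabs (\sum_(i <- s) F i) <= \sum_(i <- s) cabs (F i).
Proof.
elim: s => [|i s IH]; first by rewrite !big_nil (cabs_real 0) normr0.
by rewrite !big_cons (le_trans (cabsD _ _))// lerD2l.
Qed.

Lemma Re_sum (I : Type) (s : seq I) (F : I -> C) :
  complex.Re (\sum_(i <- s) F i) = \sum_(i <- s) complex.Re (F i).
Proof. by elim: s => [|i s IH]; rewrite ?big_nil// !big_cons ReD IH. Qed.

Lemma Im_sum (I : Type) (s : seq I) (F : I -> C) :
  complex.Im (\sum_(i <- s) F i) = \sum_(i <- s) complex.Im (F i).
Proof. by elim: s => [|i s IH]; rewrite ?big_nil// !big_cons ImD IH. Qed.

Lemma ccvg_series_dominated u (b : nat -> R) :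
  (forall n, cabs (u n) <= b n) -> cvgn (series b) ->
  exists l, ccvg (fun n => \sum_(0 <= k < n) u k) l.
Proof.
move=> ub cb; have b0 n : 0 <= b n by rewrite (le_trans _ (ub n))// cabs_ge0.
have S (f : nat -> R) : (forall n, `|f n| <= b n) -> cvgn (series f).
  by move=> fb; apply: normed_cvg; apply: (series_le_cvg _ b0 fb cb) => n; exact: normr_ge0.
exists ((limn (series (fun k => complex.Re (u k)))) +i*
        (limn (series (fun k => complex.Im (u k))))).
split => /=.
  under eq_fun do rewrite Re_sum.
  by apply: S => n; exact: le_trans (normr_Re_le _) (ub n).
under eq_fun do rewrite Im_sum.
by apply: S => n; exact: le_trans (normr_Im_le _) (ub n).
Qed.

End ComplexSequences.

(** * Cauchy products and the exponential series *)

Section CauchyProduct.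

Definition cauchy_coef (K : pzSemiRingType) (a b : nat -> K) (k : nat) : K :=
  \sum_(i < k.+1) a i * b (k - i)%N.

Lemma sum_triangle (V : nmodType) (F : nat -> nat -> V) n :
  \sum_(0 <= k < n) \sum_(i < k.+1) F i (k - i)%N =
  \sum_(0 <= i < n) \sum_(0 <= j < n - i) F i j.
Proof.
elim: n => [|n IH]; first by rewrite !big_nil.
rewrite big_nat_recr//= IH [RHS]big_nat_recr//= subSn// subnn big_nat1.
have -> : \sum_(i < n.+1) F i (n - i)%N = \sum_(0 <= i < n) F i (n - i)%N + F n 0%N.
  by rewrite -(big_mkord xpredT (fun i => F i (n - i)%N)) big_nat_recr//= subnn.
rewrite addrA -big_split/=; congr (_ + _).
apply: eq_big_nat => i /andP[_ ilt].
by rewrite subSn 1?ltnW// big_nat_recr.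
Qed.

Lemma sum_cauchy_coef (K : pzSemiRingType) (a b : nat -> K) n :
  \sum_(0 <= k < n) cauchy_coef a b k =
  \sum_(0 <= i < n) \sum_(0 <= j < n - i) a i * b j.
Proof. exact: (sum_triangle (fun i j => a i * b j)). Qed.

(** The difference is the sum over the half of the n by n square with i + j >= n. Both the given
    series and their majorants are compared in this form. *)
Lemma cauchy_defect (K : pzRingType) (a b : nat -> K) n :
  (\sum_(0 <= i < n) a i) * (\sum_(0 <= j < n) b j) - \sum_(0 <= k < n) cauchy_coef a b k =
  \sum_(0 <= i < n) \sum_(n - i <= j < n) a i * b j.
Proof.
rewrite sum_cauchy_coef mulr_suml -sumrB; apply: eq_bigr => i _.
rewrite mulr_sumr (@big_cat_nat _ _ _ (n - i)%N 0 n)//= ?leq_subr//.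
by rewrite addrC addrK.
Qed.

End CauchyProduct.

Section ComplexCauchyProduct.
Context {R : realType}.
Local Notation C := R[i].

Lemma ler_sum_prefix (f : nat -> R) m n : (forall i, 0 <= f i) -> (m <= n)%N ->
  \sum_(0 <= i < m) f i <= \sum_(0 <= i < n) f i.
Proof. by move=> f0 mn; rewrite (@big_cat_nat _ _ _ m 0 n)//= lerDl sumr_ge0. Qed.

Lemma cvg_half : (n./2 @[n --> \oo]) --> \oo.
Proof.
move=> P [N _ hN]; exists N.*2 => // n /= hn; apply: hN => /=.
by rewrite -(doubleK N) half_leq.
Qed.

(** Termwise, the defect of a and b is at most the defect T of the majorants a' and b', so it is
    enough that T tends to 0. *)
Lemma ccvg_cauchy (a b : nat -> C) (A B : C) (a' b' : nat -> R) :
  (forall n, cabs (a n) <= a' n) -> (forall n, cabs (b n) <= b' n) ->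
  cvgn (series a') -> cvgn (series b') ->
  ccvg (fun n => \sum_(0 <= k < n) a k) A -> ccvg (fun n => \sum_(0 <= k < n) b k) B ->
  ccvg (fun n => \sum_(0 <= k < n) cauchy_coef a b k) (A * B).
Proof.
move=> ha hb ca' cb' cA cB.
have a0 n : 0 <= a' n by rewrite (le_trans _ (ha n))// cabs_ge0.
have b0 n : 0 <= b' n by rewrite (le_trans _ (hb n))// cabs_ge0.
pose P n := (\sum_(0 <= i < n) a' i) * (\sum_(0 <= j < n) b' j).
pose T n := P n - \sum_(0 <= k < n) cauchy_coef a' b' k.
have cP : P n @[n --> \oo] --> limn (series a') * limn (series b') by exact: cvgM.
have T0 : T n @[n --> \oo] --> (0 : R).
  (* For nonnegative terms the square of side n / 2 lies inside the triangle i + j < n, hence T n <=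
     P n - P (n / 2). *)
  have h : P n - P n./2 @[n --> \oo] --> (0 : R).
    rewrite -(subrr (limn (series a') * limn (series b'))); apply: cvgB => //.
    exact: (cvg_comp _ _ cvg_half cP).
  apply: (squeeze_cvgr _ _ h); last exact: cvg_cst.
  apply: nearW => n; apply/andP; split.
    rewrite /T /P cauchy_defect; apply: sumr_ge0 => i _; apply: sumr_ge0 => j _.
    exact: mulr_ge0.
  rewrite /T lerD2l lerN2 /P sum_cauchy_coef mulr_suml.
  have n2 : (n./2 <= n)%N by rewrite -{2}(odd_double_half n) -addnn addnA leq_addl.
  apply: (@le_trans _ _ (\sum_(0 <= i < n./2) \sum_(0 <= j < n - i) a' i * b' j)).
    apply: ler_sum_nat => i /andP[_ ilt]; rewrite -mulr_sumr ler_wpM2l//.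
    apply: ler_sum_prefix => //; rewrite leq_subRL; last by rewrite (leq_trans (ltnW ilt)).
    rewrite (leq_trans (leq_add (ltnW ilt) (leqnn _)))//.
    by rewrite addnn -{2}(odd_double_half n) leq_addl.
  apply: ler_sum_prefix => // i; apply: sumr_ge0 => j _; exact: mulr_ge0.
have cD : ccvg (fun n => (\sum_(0 <= k < n) cauchy_coef a b k) -
   (\sum_(0 <= i < n) a i) * (\sum_(0 <= j < n) b j)) 0.
  apply: (ccvg_squeeze _ T0) => n; rewrite subr0.
  rewrite -opprB cauchy_defect /T /P cauchy_defect.
  have -> (x : C) : cabs (- x) = cabs x by case: x => x y; rewrite /cabs/= !sqrrN.
  rewrite (le_trans (cabs_sum_le _ _))//; apply: ler_sum => i _.
  rewrite (le_trans (cabs_sum_le _ _))//; apply: ler_sum => j _.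
  by rewrite cabsM ler_pM// cabs_ge0.
have := ccvgD cD (ccvgM cA cB); rewrite add0r; apply: eq_ccvg => n.
by rewrite subrK.
Qed.

Lemma cvg_series_expR (x : R) : series (exp_coeff x) n @[n --> \oo] --> expR x.
Proof. exact: is_cvg_series_exp_coeff. Qed.

Lemma series_exp_coeff_le (x : R) n : 0 <= x -> \sum_(0 <= k < n) exp_coeff x k <= expR x.
Proof.
move=> x0; apply: nondecreasing_cvgn_le; last exact: is_cvg_series_exp_coeff.
by apply: nondecreasing_series => k _ _; exact: exp_coeff_ge0.
Qed.

Definition cexp_coeff (w : C) (k : nat) : C := w ^+ k * (k`!%:R^-1)%:C.

Lemma cexp_coeff_le w k : cabs (cexp_coeff w k) <= exp_coeff (cabs w) k.
Proof. by rewrite cabsM cabsX cabs_real ger0_norm. Qed.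

Lemma cauchy_cexp_coeff (w1 w2 : C) k :
  cauchy_coef (cexp_coeff w1) (cexp_coeff w2) k = cexp_coeff (w1 + w2) k.
Proof.
rewrite /cauchy_coef /cexp_coeff addrC exprDn mulr_suml; apply: eq_bigr => i _.
have ik : (i <= k)%N by rewrite -ltnS.
rewrite -[_ *+ 'C(k, i)]mulr_natr -[X in _ = _ * X * _](rmorph_nat (real_complex R)).
have -> : (k`!%:R^-1 : R) = 'C(k, i)%:R^-1 * (i`!%:R^-1 * (k - i)`!%:R^-1).
  by rewrite -(bin_fact ik) !natrM !invfM.
have b0 : ('C(k, i)%:R : R) != 0 by rewrite pnatr_eq0 -lt0n bin_gt0.
have -> : w2 ^+ (k - i) * w1 ^+ i * ('C(k, i)%:R)%:C *
   ('C(k, i)%:R^-1 * (i`!%:R^-1 * (k - i)`!%:R^-1))%:C =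
   w2 ^+ (k - i) * w1 ^+ i * ('C(k, i)%:R * 'C(k, i)%:R^-1 * (i`!%:R^-1 * (k - i)`!%:R^-1))%:C.
  by rewrite !rmorphM/= !mulrA.
by rewrite mulfV// mul1r rmorphM/=; ring.
Qed.

Lemma imaginary_exp (y : R) k : (0 +i* y) ^+ k =
  ((~~ odd k)%:R * (-1) ^+ k./2 * y ^+ k) +i* ((odd k)%:R * (-1) ^+ k./2 * y ^+ k) :> C.
Proof.
elim: k => [|k IH]; first by apply: complex_ext; rewrite /= ?mul0r//; ring.
rewrite exprS IH; apply: complex_ext; rewrite /= ?negbK uphalf_half exprS;
  case: (odd k) => /=; rewrite ?add0n ?add1n ?exprS; ring.
Qed.

(** [cexp] is defined through real functions. Its power series is recovered as the Cauchy product of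
    the series at the real part and at i times the imaginary part, the latter splitting into cosine
    and sine series. *)
Lemma ccvg_cexp (w : C) : ccvg (fun n => \sum_(0 <= k < n) cexp_coeff w k) (cexp w).
Proof.
case: w => x y.
have c1 : ccvg (fun n => \sum_(0 <= k < n) cexp_coeff x%:C k) (expR x)%:C.
  apply: (eq_ccvg _ (ccvg_real (@cvg_series_expR x))) => n.
  rewrite rmorph_sum/=; apply: eq_bigr => k _.
  by rewrite /cexp_coeff /exp_coeff/= rmorphM rmorphXn.
have c2 : ccvg (fun n => \sum_(0 <= k < n) cexp_coeff (0 +i* y) k) (cos y +i* sin y).
  split => /=.
    under eq_fun do rewrite Re_sum.
    rewrite (_ : (fun n => _) = series (cos_coeff y)).
      by rewrite cos.unlock; exact: is_cvg_series_cos_coeff.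
    apply/funext => n; apply: eq_bigr => k _.
    by rewrite /cexp_coeff imaginary_exp /cos_coeff/= mulr0 subr0.
  under eq_fun do rewrite Im_sum.
  rewrite (_ : (fun n => _) = series (sin_coeff y)).
    by rewrite sin.unlock; exact: is_cvg_series_sin_coeff.
  apply/funext => n; apply: eq_bigr => k _.
  rewrite /cexp_coeff imaginary_exp /sin_coeff/= mulr0 add0r.
  (* [sin_coeff] has the exponent [k.-1./2] where [imaginary_exp] has [k./2]; they agree for odd k,
     and for even k both terms vanish. *)
  case: k => [|k]; first by rewrite !mul0r.
  rewrite -pred_Sn; have [ok|nk] := boolP (odd k.+1); last by rewrite !mul0r.
  by rewrite /= uphalf_half; move: ok => /= /negbTE ->.
have := ccvg_cauchy (cexp_coeff_le _) (cexp_coeff_le _)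
  (is_cvg_series_exp_coeff _) (is_cvg_series_exp_coeff _) c1 c2.
have -> : (expR x)%:C * (cos y +i* sin y) = cexp (x +i* y).
  by apply: complex_ext => /=; ring.
apply: eq_ccvg => n; apply: eq_bigr => k _; rewrite cauchy_cexp_coeff; congr (cexp_coeff _ _).
by apply: complex_ext => /=; ring.
Qed.

End ComplexCauchyProduct.

(** * Dominated convergence for complex-valued functions on the plane *)

Section ComplexDominatedConvergence.
Context {R : realType}.
Local Notation C := R[i].
Local Notation mT := (measurableTypeR R).

Lemma cmeasurable_ccvg (F : nat -> C -> C) (f : C -> C) :
  (forall n, cmeasurable (F n)) -> (forall u, ccvg (fun n => F n u) (f u)) ->
  cmeasurable f.
Proof.
move=> mF Ff; split.
  apply: (@measurable_fun_cvg _ _ _ setT (fun n (p : mT * mT) => complex.Re (F n (p.1 +i* p.2)))).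
    by move=> n; have [] := mF n.
  by move=> p _; have [] := Ff (p.1 +i* p.2).
apply: (@measurable_fun_cvg _ _ _ setT (fun n (p : mT * mT) => complex.Im (F n (p.1 +i* p.2)))).
  by move=> n; have [] := mF n.
by move=> p _; have [] := Ff (p.1 +i* p.2).
Qed.

Lemma Rintegral_dominated_cvg d (T : measurableType d) (m : {measure set T -> \bar R})
    (F : nat -> T -> R) (f g : T -> R) :
  (forall n, measurable_fun setT (F n)) -> measurable_fun setT f ->
  (forall x, F n x @[n --> \oo] --> f x) -> (forall n x, `|F n x| <= g x) ->
  m.-integrable setT (EFin \o g) ->
  m.-integrable setT (EFin \o f) /\ \int[m]_x F n x @[n --> \oo] --> \int[m]_x f x.
Proof.
move=> mF mf Ff Fg gi.
have aeF : {ae m, forall x, setT x -> (EFin \o F n) x @[n --> \oo] --> (EFin \o f) x}.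
  by apply: aeW => x _; apply: cvg_EFin; [exact: nearW|exact: Ff].
have [fi _ h] := @dominated_convergence _ _ _ m setT measurableT
  (fun n => EFin \o F n) (EFin \o f) (EFin \o g)
  (fun n => (measurable_EFinP _ _).2 (mF n)) ((measurable_EFinP _ _).2 mf)
  aeF gi (aeW _ (fun x n _ => Fg n x)).
split => //; apply: fine_cvg.
by rewrite /Rintegral fineK//; exact: integrable_fin_num.
Qed.

Lemma cdominated_convergence (F : nat -> C -> C) (f : C -> C) (g : mT * mT -> R) :
  (forall n, cmeasurable (F n)) -> (forall u, ccvg (fun n => F n u) (f u)) ->
  (forall n p, cabs (F n (p.1 +i* p.2)) <= g p) ->
  planar.-integrable setT (EFin \o g) ->
  cintegrable f /\ ccvg (fun n => cintegral (F n)) (cintegral f).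
Proof.
move=> mF Ff Fg gi; have [mR mI] := cmeasurable_ccvg mF Ff.
have [iR cR] := @Rintegral_dominated_cvg _ _ planar
  (fun n (p : mT * mT) => complex.Re (F n (p.1 +i* p.2))) _ g
  (fun n => (mF n).1) mR (fun p => (Ff _).1)
  (fun n p => le_trans (normr_Re_le _) (Fg n p)) gi.
have [iI cI] := @Rintegral_dominated_cvg _ _ planar
  (fun n (p : mT * mT) => complex.Im (F n (p.1 +i* p.2))) _ g
  (fun n => (mF n).2) mI (fun p => (Ff _).2)
  (fun n p => le_trans (normr_Im_le _) (Fg n p)) gi.
by split; split.
Qed.

End ComplexDominatedConvergence.

(** * Bessel series *)

Section BesselSeries.
Context {R : realType}.
Local Notation C := R[i].

Definition bessel_coeff (nu : R) (k : nat) : R := (k`!%:R * Gamma (nu + k%:R + 1))^-1.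

Definition bessel_term (nu : R) (w : C) (k : nat) : C := w ^+ k * (bessel_coeff nu k)%:C.

(** The Bessel-Clifford function, which removes the square roots: at w^2 / 4 it is (w / 2)^(- nu)
    I_nu (w). The limit is written as in [besselI_entire], so that [besselI_entireE] holds by
    conversion. *)
Definition bessel_series (nu : R) (w : C) : C :=
  limn (series (fun k : nat => w ^+ k / (k`!%:R * Gamma (nu + k%:R + 1))%:C : R[i]^o)).

Lemma besselI_entireE nu w :
  besselI_entire nu w = (2 `^ (- nu))%:C * bessel_series nu (w ^+ 2 / 4).
Proof. by []. Qed.

Lemma bessel_coeff_ge0 nu k : -1 < nu -> 0 <= bessel_coeff nu k.
Proof.
move=> nu1; rewrite invr_ge0 mulr_ge0// ltW// Gamma_gt0//.
have : 0 <= k%:R :> R by []. lra.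
Qed.

(** [Gamma_ge_expn] with A = 1 / e. Since e is arbitrary, the Bessel series has exponential type
    zero, so any gap between |h| and g leaves room for it. *)
Lemma bessel_coeff_le nu e : -1 < nu -> 0 < e ->
  exists2 K, 0 <= K & forall k, bessel_coeff nu k <= K * (e ^+ k / k`!%:R).
Proof.
move=> nu1 e0; have n0 : 0 < nu + 1 by lra.
have ei0 : 0 < e^-1 by rewrite invr_gt0.
have [k0 k00 hk] := Gamma_ge_expn n0 ei0.
exists k0^-1; first by rewrite invr_ge0 ltW.
move=> k; rewrite /bessel_coeff invfM.
have G0 : 0 < Gamma (nu + 1 + k%:R) by apply: Gamma_gt0; rewrite ltr_wpDr.
rewrite addrAC mulrC mulrA ler_wpM2r ?invr_ge0//.
rewrite -[e ^+ k]invrK -exprVn -invfM lef_pV2 ?posrE// ?mulr_gt0 ?exprn_gt0//.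
Qed.

Lemma bessel_term_le nu e : -1 < nu -> 0 < e ->
  exists2 K, 0 <= K & forall w k, cabs (bessel_term nu w k) <= K * exp_coeff (e * cabs w) k.
Proof.
move=> nu1 e0; have [K K0 hK] := bessel_coeff_le nu1 e0; exists K => // w k.
rewrite cabsM cabsX cabs_real ger0_norm ?bessel_coeff_ge0//.
have := ler_wpM2l (exprn_ge0 k (cabs_ge0 w)) (hK k) => /le_trans; apply.
by rewrite /exp_coeff/= exprMn le_eqVlt; apply/orP; left; apply/eqP; ring.
Qed.

Lemma cvg_scaled_exp_series (K x : R) : cvgn (series (fun k => K * exp_coeff x k)).
Proof. by apply: is_cvg_seriesZ; exact: is_cvg_series_exp_coeff. Qed.

Lemma ccvg_bessel_series nu w : -1 < nu ->
  ccvg (fun n => \sum_(0 <= k < n) bessel_term nu w k) (bessel_series nu w).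
Proof.
move=> nu1; have [K K0 hK] := bessel_term_le nu1 ltr01.
have cs := @cvg_scaled_exp_series K (1 * cabs w).
have [l hl] := ccvg_series_dominated (hK w) cs.
suff -> : bessel_series nu w = l by [].
apply: ccvg_limn; apply: eq_ccvg hl => n; apply: eq_bigr => k _.
by rewrite /bessel_term /bessel_coeff fmorphV.
Qed.

Lemma bessel_partial_le nu e : -1 < nu -> 0 < e -> exists2 K, 0 <= K &
  forall w n, cabs (\sum_(0 <= k < n) bessel_term nu w k) <= K * expR (e * cabs w).
Proof.
move=> nu1 e0; have [K K0 hK] := bessel_term_le nu1 e0; exists K => // w n.
apply: (le_trans (cabs_sum_le _ _)).
apply: (@le_trans _ _ (\sum_(0 <= k < n) K * exp_coeff (e * cabs w) k)).
  by apply: ler_sum => k _; exact: hK.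
rewrite -mulr_sumr ler_wpM2l// series_exp_coeff_le// mulr_ge0 ?cabs_ge0//; exact: ltW.
Qed.

Lemma bessel_series_le nu e : -1 < nu -> 0 < e -> exists2 K, 0 <= K &
  forall w, cabs (bessel_series nu w) <= K * expR (e * cabs w).
Proof.
move=> nu1 e0; have [K K0 hK] := bessel_partial_le nu1 e0.
exists (K + K) => [|w]; first exact: addr_ge0.
have [h1 h2] := ccvg_bessel_series w nu1.
have S (f : nat -> R) (l B : R) : (forall n, `|f n| <= B) -> f n @[n --> \oo] --> l -> `|l| <= B.
  move=> fB fl; have fln : `|f n| @[n --> \oo] --> `|l| by exact: cvg_norm.
  rewrite -(cvg_lim _ fln)//; apply: limr_le; first by apply/cvg_ex; exists `|l|.
  exact: nearW.
apply: (le_trans (cabs_le _)); rewrite mulrDl lerD//.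
  by apply: (S _ _ _ _ h1) => n; exact: le_trans (normr_Re_le _) (hK w n).
by apply: (S _ _ _ _ h2) => n; exact: le_trans (normr_Im_le _) (hK w n).
Qed.

Lemma cmeasurable_bessel_partial nu (f : C -> C) n : cmeasurable f ->
  cmeasurable (fun u => \sum_(0 <= k < n) bessel_term nu (f u) k).
Proof.
move=> mf; apply: cmeasurable_sum => k; apply: cmeasurableM; last exact: cmeasurable_cst.
exact: cmeasurableX.
Qed.

Lemma cmeasurable_bessel_series nu (f : C -> C) : -1 < nu -> cmeasurable f ->
  cmeasurable (fun u => bessel_series nu (f u)).
Proof.
move=> nu1 mf.
apply: (@cmeasurable_ccvg _ (fun n u => \sum_(0 <= k < n) bessel_term nu (f u) k)).
  by move=> n; exact: cmeasurable_bessel_partial.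
by move=> u; exact: ccvg_bessel_series.
Qed.

End BesselSeries.

(** * Vandermonde's identity for Gamma ratios and the resulting exponential series *)

Section HilleHardy.
Context {R : realType}.

Lemma Gamma_neq0 (x : R) : 0 < x -> Gamma x != 0.
Proof. by move=> x0; rewrite gt_eqF// Gamma_gt0. Qed.

(** In rising factorials, (a + l)_n is the sum of C(n, i) l^_i (a + i)_(n - i). Expanding in falling
    factorials of l is what makes the ratio summable in closed form against y^l / l!. *)
Lemma Gamma_ratio_Vandermonde (a : R) (l n : nat) : 0 < a ->
  Gamma (a + l%:R + n%:R) / Gamma (a + l%:R) =
  \sum_(i < n.+1) ('C(n, i) * l ^_ i)%:R * (Gamma (a + n%:R) / Gamma (a + i%:R)).
Proof.
move=> a0; have an (k : nat) : 0 < a + k%:R :> R by rewrite ltr_wpDr.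
have al0 : 0 < a + l%:R by exact: an.
elim: n => [|n IH].
  by rewrite big_ord1 bin0 ffactn0 muln1 mul1r !addr0 !divff// Gamma_neq0.
have -> : a + l%:R + n.+1%:R = (a + l%:R + n%:R) + 1 by rewrite -natr1; ring.
have -> : a + n.+1%:R = (a + n%:R) + 1 by rewrite -natr1; ring.
rewrite !GammaS//; last by rewrite ltr_wpDr.
rewrite -mulrA IH mulr_sumr.
pose c (i : nat) : R := Gamma (a + n%:R) / Gamma (a + i%:R).
have cS i : c i.+1 * (a + i%:R) = c i.
  rewrite /c; have -> : a + i.+1%:R = (a + i%:R) + 1 by rewrite -natr1; ring.
  rewrite GammaS// invfM; have := Gamma_neq0 (an i); have := an i.
  move=> /gt_eqF/negbT h1 h2; field; by rewrite h1 h2.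
(* The new factor a + l + n is split as (l - i) + (a + n + i), and l - i raises the falling
   factorial. The split survives for i > l because then l ^_ i = 0. *)
transitivity (\sum_(i < n.+1) (('C(n, i) * l ^_ i.+1)%:R * c i +
   (a + n%:R + i%:R) * (('C(n, i) * l ^_ i)%:R * c i))).
  apply: eq_bigr => i _; rewrite -/(c i) ffactnSr.
  have [il|li] := leqP i l.
    by rewrite !natrM natrB//; ring.
  by rewrite (ffact_small li) mul0n muln0 !mul0r !mulr0 addr0.
rewrite big_split/=.
rewrite [RHS](_ : _ = \sum_(i < n.+2) (('C(n, i) * l ^_ i)%:R * ((a + n%:R) * c i) +
   (if (i : nat) is i'.+1 then ('C(n, i') * l ^_ i)%:R * ((a + n%:R) * c i) else 0))); last first.
  apply: eq_bigr => -[[|i] ilt] _ /=; first by rewrite !bin0 /c !addr0; ring.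
  by rewrite binS mulnDl natrD mulrDl /c; ring.
rewrite big_split/= addrC; rewrite [X in _ = X + _]big_ord_recr/= bin_small// mul0n mul0r addr0.
rewrite [X in _ = _ + X]big_ord_recl/= add0r.
have -> : \sum_(i < n.+1) ('C(n, i) * l ^_ i.+1)%:R * c i =
   \sum_(i < n.+1) ('C(n, i) * l ^_ i.+1)%:R * ((a + i%:R) * c i.+1).
  by apply: eq_bigr => i _; rewrite -[c i]cS [c _ * _]mulrC.
under [X in X + _ = _]eq_bigr do rewrite mulrDl.
rewrite big_split/= -addrA; congr (_ + _); first by apply: eq_bigr => i _; ring.
(* What remains equates the sum of i C(n, i) l^_i c_i with that of (n - i) C(n, i) l^_(i + 1) c_(i +
   1); a shift of i reduces it to (i + 1) C(n, i + 1) = (n - i) C(n, i). *)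
apply/esym/eqP; rewrite -subr_eq -sumrB; apply/eqP/esym.
rewrite [RHS](eq_bigr (fun i : 'I_n.+1 => ((n%:R - i%:R) * 'C(n, i)%:R) * ((l ^_ i.+1)%:R * c i.+1))); last first.
  by move=> i _; rewrite /bump/= add1n natrM; ring.
rewrite [RHS]big_ord_recr/= subrr !mul0r addr0 big_ord_recl/= mul0r add0r.
apply: eq_bigr => i _; rewrite /bump/= add1n.
have h : 'C(n, i.+1)%:R * i.+1%:R = (n%:R - i%:R) * 'C(n, i)%:R :> R.
  by rewrite -natrM mulnC mul_bin_left natrM natrB// ltnW.
by rewrite -h natrM; ring.
Qed.

Lemma cvg_sum (I : Type) (s : seq I) (F : I -> nat -> R) (l : I -> R) :
  (forall i, F i n @[n --> \oo] --> l i) ->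
  \sum_(i <- s) F i n @[n --> \oo] --> \sum_(i <- s) l i.
Proof.
move=> Fl; elim: s => [|i s IH].
  by rewrite big_nil; under eq_fun do rewrite big_nil; exact: cvg_cst.
by rewrite big_cons; under eq_fun do rewrite big_cons; exact: cvgD.
Qed.

(** The terms with l < i vanish, and l^_i / l! = 1 / (l - i)! otherwise, so the shifted series is
    y^i times the exponential series. *)
Lemma cvg_ffact_exp_series (y : R) (i : nat) :
  \sum_(0 <= l < n) (l ^_ i)%:R * (y ^+ l / l`!%:R) @[n --> \oo] --> y ^+ i * expR y.
Proof.
rewrite -(cvg_shiftn i)/=.
under eq_fun.
  move=> n; rewrite (@big_cat_nat _ _ _ i 0 (n + i))//= ?leq_addl//.
  rewrite [X in X + _]big1_seq; last first.
    by move=> l /=; rewrite mem_index_iota => /andP[_ li]; rewrite ffact_small// mul0r.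
  rewrite add0r -[X in \sum_(X <= _ < _) _]add0n big_addn addnK.
  rewrite (eq_bigr (fun l => y ^+ i * (y ^+ l / l`!%:R))); last first.
    move=> l _; rewrite -(ffact_fact (leq_addl l i)) addnK natrM exprD.
    have f1 : (l`!%:R : R) != 0 by rewrite pnatr_eq0 -lt0n fact_gt0.
    have f2 : ((l + i) ^_ i)%:R != 0 :> R by rewrite pnatr_eq0 -lt0n ffact_gt0 leq_addl.
    by field; rewrite f1 f2.
  rewrite -mulr_sumr; over.
by apply: cvgM; [exact: cvg_cst|exact: cvg_series_expR].
Qed.

(** Up to the factor Gamma (a + n) / Gamma a, this is the terminating case of Kummer's
    transformation, 1F1(a + n; a; y) = e^y 1F1(- n; a; - y). *)
Lemma cvg_Gamma_ratio_series (a y : R) (n : nat) : 0 < a ->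
  \sum_(0 <= l < N) (Gamma (a + l%:R + n%:R) / Gamma (a + l%:R)) * (y ^+ l / l`!%:R)
    @[N --> \oo] -->
  expR y * \sum_(i < n.+1) 'C(n, i)%:R * (Gamma (a + n%:R) / Gamma (a + i%:R)) * y ^+ i.
Proof.
move=> a0.
rewrite mulr_sumr.
under eq_fun.
  move=> N; rewrite (eq_bigr (fun l => \sum_(i < n.+1)
    ('C(n, i)%:R * (Gamma (a + n%:R) / Gamma (a + i%:R))) *
       ((l ^_ i)%:R * (y ^+ l / l`!%:R)))); last first.
    move=> l _; rewrite Gamma_ratio_Vandermonde// mulr_suml; apply: eq_bigr => i _.
    by rewrite natrM; ring.
  rewrite exchange_big/=.
  rewrite (eq_bigr (fun i : 'I_n.+1 => ('C(n, i)%:R * (Gamma (a + n%:R) / Gamma (a + i%:R))) *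
      \sum_(0 <= l < N) ((l ^_ i)%:R * (y ^+ l / l`!%:R)))); last first.
    by move=> i _; rewrite mulr_sumr.
  over.
apply: cvg_sum => i; rewrite [X in _ --> X]mulrCA [expR y * _]mulrC.
by apply: cvgM; [exact: cvg_cst|exact: cvg_ffact_exp_series].
Qed.

End HilleHardy.

Section MixtureBesselSeries.
Context {R : realType}.

Lemma natr_bin (n m : nat) : (m <= n)%N ->
  'C(n, m)%:R = n`!%:R / (m`!%:R * (n - m)`!%:R) :> R.
Proof.
move=> mn; rewrite -(bin_fact mn) !natrM mulfK// mulf_neq0// pnatr_eq0 -lt0n fact_gt0//.
Qed.

Lemma fact_neq0 n : n`!%:R != 0 :> R.
Proof. by rewrite pnatr_eq0 -lt0n fact_gt0. Qed.

Lemma natr_bin_bin (k p m : nat) : (m <= p)%N -> (p <= k)%N ->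
  'C(k, m)%:R * 'C(k - m, p - m)%:R = 'C(k, p)%:R * 'C(p, m)%:R :> R.
Proof.
move=> mp pk; have mk := leq_trans mp pk.
rewrite !natr_bin ?leq_sub2r//.
have -> : (k - m - (p - m) = k - p)%N by rewrite subnBA// subnK.
by field; rewrite !fact_neq0.
Qed.

(** The terms vanish beyond min (j, k). Bounding m by k frees its range from j, so that the sum over
    j can be moved inside. *)
Lemma mixture_moment_sum_k (nu q h : R) j k :
  mixture_moment nu q h j k =
  let w := h ^+ 2 / (4 * q) in
  pi / q * (h / (2 * q)) ^+ (j + k) *
  \sum_(m < k.+1) ('C(j, m) * 'C(k, m) * m`!)%:R * w^-1 ^+ m *
     (Gamma (nu + 1 + (j + k)%:R - m%:R) *
        (1 - w) `^ (- (nu + 1 + (j + k)%:R - m%:R))).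
Proof.
rewrite /mixture_moment /=; congr (_ * _).
pose F (m : nat) : R := ('C(j, m) * 'C(k, m) * m`!)%:R * (h ^+ 2 / (4 * q))^-1 ^+ m *
     (Gamma (nu + 1 + (j + k)%:R - m%:R) *
        (1 - h ^+ 2 / (4 * q)) `^ (- (nu + 1 + (j + k)%:R - m%:R))).
have ext a b : (a <= b)%N -> (forall m, (a < m)%N -> F m = 0) ->
    \sum_(m < a.+1) F m = \sum_(m < b.+1) F m.
  move=> ab Fz; rewrite -!(big_mkord xpredT F) [RHS](@big_cat_nat _ _ _ a.+1)//=.
  rewrite [X in _ = _ + X]big1_seq ?addr0// => m /=.
  by rewrite mem_index_iota => /andP[am _]; exact: Fz.
have [jk|kj] := leqP j k.
  by apply: ext => // m jm; rewrite /F bin_small// !mul0n !mul0r.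
by apply/esym/ext; [exact: ltnW|move=> m km; rewrite /F (@bin_small k)// muln0 mul0n !mul0r].
Qed.

(* The moment of [conj u ^ k * bessel_series nu (b * u)] against the same weight. *)
Definition mixture_bessel_moment (nu q h b : R) (k : nat) : R :=
  let w := h ^+ 2 / (4 * q) in
  let P := h / (2 * q * (1 - w)) in
  pi / q * (1 - w) `^ (- (nu + 1)) * P ^+ k * expR (b * P) * Gamma (nu + 1 + k%:R) *
  \sum_(p < k.+1) 'C(k, p)%:R * (b * P / w) ^+ p / Gamma (nu + 1 + p%:R).

Lemma powR_addn (x r : R) (n : nat) : 0 < x -> x `^ (- (r + n%:R)) = x `^ (- r) / x ^+ n.
Proof.
move=> x0; rewrite opprD powRD ?powRN ?powR_mulrn ?ltW//.
by apply/implyP => _; rewrite gt_eqF.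
Qed.

(** The algebra of one term, with j = l + m. Here lam = 1 - w, D = pi / q, Z is the power of 1 - w
    with exponent - (nu + 1), G and G2 are Gamma values, and fl, fm, flm are the factorials of l, m
    and l + m. Abstracting them leaves an identity for [field]. *)
Lemma mixture_bessel_term (F : fieldType) (b P w lam G G2 Z D fl fm flm Ckm : F) (l m k : nat) :
  w != 0 -> lam != 0 -> G != 0 -> fl != 0 -> fm != 0 -> flm != 0 ->
  b ^+ (l + m) * (flm * G)^-1 * (D * (P * lam) ^+ (l + m + k) *
    (flm / (fm * fl) * Ckm * fm * w^-1 ^+ m * (G2 * (Z / lam ^+ (l + k))))) =
  D * Z * P ^+ k * Ckm * (b * P * lam / w) ^+ m * (G2 / G * ((b * P) ^+ l / fl)).
Proof.
move=> w0 l0 G0 fl0 fm0 flm0; rewrite !exprMn !exprVn !exprD; field.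
by rewrite fl0 G0 fm0 flm0 !expf_neq0.
Qed.

(** For fixed m the sum over j = l + m is a Gamma ratio series with a = nu + 1 + m and n = k - m.
    This gives a finite double sum in m and the index i of that series' polynomial, which is then
    collapsed. *)
Lemma cvg_mixture_bessel_moment (nu q h b : R) k :
  -1 < nu -> 0 < q -> h != 0 -> h ^+ 2 < 4 * q ->
  \sum_(0 <= j < N) b ^+ j * bessel_coeff nu j * mixture_moment nu q h j k @[N --> \oo] -->
  mixture_bessel_moment nu q h b k.
Proof.
move=> nu1 q0 h0 hq; rewrite /mixture_bessel_moment/=.
set w := h ^+ 2 / (4 * q).
have w0 : 0 < w by apply: divr_gt0; [rewrite exprn_even_gt0|rewrite mulr_gt0].
have w1 : 0 < 1 - w by rewrite subr_gt0 ltr_pdivrMr ?mul1r// mulr_gt0.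
set mu := nu + 1; have mu0 : 0 < mu by rewrite /mu; lra.
set P := h / (2 * q * (1 - w)); set y := b * P.
pose A := pi / q * (1 - w) `^ (- mu) * P ^+ k.
pose T (m j : nat) : R := b ^+ j * bessel_coeff nu j * (pi / q * (h / (2 * q)) ^+ (j + k) *
  (('C(j, m) * 'C(k, m) * m`!)%:R * w^-1 ^+ m *
     (Gamma (mu + (j + k)%:R - m%:R) * (1 - w) `^ (- (mu + (j + k)%:R - m%:R))))).
pose S (m : nat) : R := \sum_(i < (k - m).+1) 'C(k - m, i)%:R *
   (Gamma (mu + m%:R + (k - m)%:R) / Gamma (mu + m%:R + i%:R)) * y ^+ i.
have cT (m : 'I_k.+1) : \sum_(0 <= j < N) T m j @[N --> \oo] -->
   A * 'C(k, m)%:R * (y * (1 - w) / w) ^+ m * (expR y * S m).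
  have mk : (m <= k)%N by rewrite -ltnS.
  rewrite -(cvg_shiftn m)/=.
  have a0 : 0 < mu + m%:R by rewrite ltr_wpDr.
  under eq_fun.
    move=> N; rewrite (@big_cat_nat _ _ _ m 0 (N + m))//= ?leq_addl//.
    rewrite [X in X + _]big1_seq; last first.
      move=> l /=; rewrite mem_index_iota => /andP[_ lm].
      by rewrite /T bin_small// !mul0n !mul0r !mulr0.
    rewrite add0r -[X in \sum_(X <= _ < _) _]add0n big_addn addnK.
    rewrite (eq_bigr (fun l => A * 'C(k, m)%:R * (y * (1 - w) / w) ^+ m *
       ((Gamma (mu + m%:R + l%:R + (k - m)%:R) / Gamma (mu + m%:R + l%:R)) *
          (y ^+ l / l`!%:R)))); last first.
      move=> l _; rewrite /T /bessel_coeff.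
      have e1 : mu + (l + m + k)%:R - m%:R = mu + (l + k)%:R by rewrite !natrD; ring.
      have e2 : mu + m%:R + l%:R + (k - m)%:R = mu + (l + k)%:R by rewrite natrB// natrD; ring.
      have e3 : nu + (l + m)%:R + 1 = mu + m%:R + l%:R by rewrite /mu natrD; ring.
      rewrite e1 e2 e3 powR_addn// !natrM (natr_bin (leq_addl l m)) addnK.
      have G0 : Gamma (mu + m%:R + l%:R) != 0 by rewrite Gamma_neq0// ltr_wpDr.
      have hP : h / (2 * q) = P * (1 - w) by rewrite /P; field; rewrite !gt_eqF.
      by rewrite hP /A /y; apply: mixture_bessel_term; rewrite ?fact_neq0// gt_eqF.
    rewrite -mulr_sumr; over.
  by apply: cvgM; [exact: cvg_cst|exact: cvg_Gamma_ratio_series].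
(* The double sum is grouped by p = m + i. The sum over m is then binomial, with value (1 + (1 - w)
   / w)^p = w^(- p). *)
have -> : A * expR y * Gamma (mu + k%:R) *
    (\sum_(p < k.+1) 'C(k, p)%:R * (y / w) ^+ p / Gamma (mu + p%:R)) =
  \sum_(m < k.+1) A * 'C(k, m)%:R * (y * (1 - w) / w) ^+ m * (expR y * S m).
  pose F (m i : nat) : R := A * 'C(k, m)%:R * (y * (1 - w) / w) ^+ m * (expR y *
     ('C(k - m, i)%:R * (Gamma (mu + m%:R + (k - m)%:R) / Gamma (mu + m%:R + i%:R)) * y ^+ i)).
  rewrite [RHS](_ : _ = \sum_(0 <= m < k.+1) \sum_(0 <= i < k.+1 - m) F m i); last first.
    rewrite big_mkord; apply: eq_bigr => m _; rewrite /S !mulr_sumr.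
    by rewrite subSn ?big_mkord// -ltnS.
  rewrite -sum_triangle big_mkord mulr_sumr; apply: eq_bigr => p _.
  have pk : (p <= k)%N by rewrite -ltnS.
  have -> : (y / w) ^+ p = y ^+ p * (1 + (1 - w) / w) ^+ p.
    by rewrite -exprMn; congr (_ ^+ p); field; rewrite gt_eqF.
  rewrite exprDn mulr_sumr mulr_sumr mulr_suml mulr_sumr; apply: eq_bigr => m _.
  have mp : (m <= p)%N by rewrite -ltnS.
  rewrite expr1n mul1r -[_ *+ 'C(p, m)]mulr_natr /F.
  have -> : mu + m%:R + (k - m)%:R = mu + k%:R.
    by rewrite natrB ?(leq_trans mp)//; ring.
  have -> : mu + m%:R + (p - m)%:R = mu + p%:R by rewrite natrB//; ring.
  have -> : y ^+ p = y ^+ m * y ^+ (p - m) by rewrite -exprD subnKC.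
  have -> : (y * (1 - w) / w) ^+ m = y ^+ m * ((1 - w) / w) ^+ m by rewrite -exprMn mulrA.
  transitivity (A * expR y * Gamma (mu + k%:R) * (y ^+ m * y ^+ (p - m) * ((1 - w) / w) ^+ m)
     * ('C(k, p)%:R * 'C(p, m)%:R) / Gamma (mu + p%:R)); first by ring.
  by rewrite -natr_bin_bin//; ring.
under eq_fun.
  move=> N; rewrite (eq_bigr (fun j => \sum_(m < k.+1) T m j)); last first.
    by move=> j _; rewrite mixture_moment_sum_k/= -/w -/mu !mulr_sumr; apply: eq_bigr.
  rewrite exchange_big/=; over.
exact: cvg_sum cT.
Qed.

End MixtureBesselSeries.

(** * Termwise integration of the two Bessel series *)

Section BesselMixtureIntegral.
Context {R : realType}.
Local Notation C := R[i].
Local Notation mT := (measurableTypeR R).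

(** The exponential rate is divided by |zeta| + 1, where the 1 covers zeta = 0. One constant serves
    the series and all its partial sums, as either may be the fixed factor under domination. *)
Lemma bessel_growth (nu d : R) (zeta : C) : -1 < nu -> 0 < d ->
  exists2 K, 0 <= K & forall u,
    (forall n, cabs (\sum_(0 <= k < n) bessel_term nu (zeta * u) k) <= K * expR (d * cabs u)) /\
    cabs (bessel_series nu (zeta * u)) <= K * expR (d * cabs u).
Proof.
move=> nu1 d0; have z1 : 0 < cabs zeta + 1 by rewrite ltr_wpDl ?cabs_ge0.
have e0 : 0 < d / (cabs zeta + 1) by rewrite divr_gt0.
have [K1 K10 h1] := bessel_partial_le nu1 e0.
have [K2 K20 h2] := bessel_series_le nu1 e0.
have ez u : expR (d / (cabs zeta + 1) * cabs (zeta * u)) <= expR (d * cabs u).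
  rewrite ler_expR cabsM mulrA ler_wpM2r ?cabs_ge0// -mulrA ger_pMr//.
  by rewrite mulrC ler_pdivrMr// mul1r lerDl.
exists (K1 + K2) => [|u]; first exact: addr_ge0.
split=> [n|].
  apply: (le_trans (h1 _ n)); apply: (le_trans (ler_wpM2l K10 (ez u))).
  by rewrite ler_wpM2r ?expR_ge0// lerDl.
apply: (le_trans (h2 _)); apply: (le_trans (ler_wpM2l K20 (ez u))).
by rewrite ler_wpM2r ?expR_ge0// lerDr.
Qed.

Lemma envelope_bound (h g d K1 K2 : R) (X Y : C) (p : mT * mT) :
  0 <= K1 -> 0 <= K2 -> 0 <= d -> d + d + `|h| <= g ->
  cabs X <= K1 * expR (d * cabs (p.1 +i* p.2)) ->
  cabs Y <= K2 * expR (d * cabs (p.1 +i* p.2)) ->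
  cabs (X * Y * (expR (h * p.1))%:C) <= K1 * K2 * exp_envelope g p.
Proof.
move=> K10 K20 d0 dg hX hY; set r := cabs (p.1 +i* p.2) in hX hY.
have g0 : 0 <= g by apply: le_trans dg; rewrite !addr_ge0.
rewrite !cabsM cabs_real (ger0_norm (expR_ge0 _)).
have hE : expR (h * p.1) <= expR (`|h| * r).
  rewrite ler_expR (le_trans (ler_norm _))// normrM ler_wpM2l//.
  exact: (normr_Re_le (p.1 +i* p.2)).
apply: (@le_trans _ _ (K1 * expR (d * r) * (K2 * expR (d * r)) * expR (`|h| * r))).
  by rewrite ler_pM ?mulr_ge0 ?cabs_ge0 ?expR_ge0// ler_pM ?cabs_ge0.
have -> : K1 * expR (d * r) * (K2 * expR (d * r)) * expR (`|h| * r) =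
    K1 * K2 * expR ((d + d + `|h|) * r) by rewrite !mulrDl !expRD; ring.
apply: ler_wpM2l; first exact: mulr_ge0.
apply: le_trans (exp_envelope_ge p g0); rewrite ler_expR ler_wpM2r//.
exact: cabs_ge0.
Qed.

(** Read from right to left: the finite sum left in the moment of conj(u)^k is a coefficient of a
    Bessel series times an exponential. *)
Lemma cauchy_bessel_cexp (nu Y P : R) (zeta : C) k :
  cauchy_coef (bessel_term nu (Y%:C * (P%:C * zeta))) (cexp_coeff (P%:C * zeta)) k =
  zeta ^+ k * ((P ^+ k)%:C *
    (\sum_(i < k.+1) Y ^+ i * bessel_coeff nu i * (k - i)`!%:R^-1)%:C).
Proof.
rewrite /cauchy_coef rmorph_sum/= [RHS]mulrA mulr_sumr; apply: eq_bigr => i _.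
have ik : (i <= k)%N by rewrite -ltnS.
rewrite /bessel_term /cexp_coeff exprMn !rmorphM/= !rmorphXn/=.
have -> : zeta ^+ k * P%:C ^+ k = (P%:C * zeta) ^+ i * (P%:C * zeta) ^+ (k - i).
  by rewrite -exprD subnKC// exprMn mulrC.
ring.
Qed.

Variables (nu q h g b : R) (zeta : C).
Hypotheses (nu1 : -1 < nu) (q0 : 0 < q) (h0 : h != 0) (hg : `|h| < g) (gq : g ^+ 2 < 2 * q).

(** Each of the two factors multiplying the weight is allowed half of the gap between |h| and g. *)
Let d := (g - `|h|) / 2.
Let d0 : 0 < d. Proof. by rewrite divr_gt0// subr_gt0. Qed.
Let dg : d + d + `|h| <= g. Proof. by rewrite -splitr subrK. Qed.

Let hq : h ^+ 2 < 4 * q.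
Proof.
have : h ^+ 2 < g ^+ 2.
  by rewrite -(real_normK (num_real h)) ltrXn2r// ?nnegrE// (le_trans _ (ltW hg)).
by move: gq q0; lra.
Qed.

Let weightC (u : C) : C := (expR (h * complex.Re u))%:C * (cmixture nu q u)%:C.

Lemma cmeasurable_expR_Re : cmeasurable (fun u : C => (expR (h * complex.Re u))%:C).
Proof.
apply: cmeasurable_realfun => /=; apply: measurableT_comp => //.
by apply: measurable_funM; [exact: measurable_cst|exact: measurable_fst].
Qed.

Lemma cmeasurable_cmixture : cmeasurable (fun u : C => (cmixture nu q u)%:C).
Proof.
apply: cmeasurable_realfun; rewrite /cmixture/=.
by under eq_fun do rewrite -surjective_pairing; exact: measurable_mixture.
Qed.

(** Both factors vary with n, so one statement covers the expansion of either factor, the other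
    sequence being constant; with both constant it yields integrability. *)
Lemma cmixture_product_dominated (F G : nat -> C -> C) (f f' : C -> C) (K1 K2 : R) :
  0 <= K1 -> 0 <= K2 ->
  (forall n, cmeasurable (F n)) -> (forall n, cmeasurable (G n)) ->
  (forall u, ccvg (fun n => F n u) (f u)) -> (forall u, ccvg (fun n => G n u) (f' u)) ->
  (forall n u, cabs (F n u) <= K1 * expR (d * cabs u)) ->
  (forall n u, cabs (G n u) <= K2 * expR (d * cabs u)) ->
  cintegrable (fun u => f u * f' u * weightC u) /\
  ccvg (fun n => cintegral (fun u => F n u * G n u * weightC u))
       (cintegral (fun u => f u * f' u * weightC u)).
Proof.
move=> K10 K20 mF mG Ff Gf hF hG.
apply: (@cdominated_convergence _ _ _
  (fun p => K1 * K2 * (exp_envelope g p * mixture nu q p))).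
- move=> n; apply: cmeasurableM; first exact: cmeasurableM.
  apply: cmeasurableM; first exact: cmeasurable_expR_Re.
  exact: cmeasurable_cmixture.
- move=> u; apply: ccvgM; last exact: ccvg_cst.
  exact: ccvgM.
- move=> n p; rewrite /weightC mulrA cabsM cabs_real.
  rewrite (ger0_norm (mixture_ge0 _ _ _)) /cmixture/= -surjective_pairing mulrA.
  rewrite ler_wpM2r ?mixture_ge0//.
  by apply: (envelope_bound K10 K20 (ltW d0) dg); [exact: hF|exact: hG].
- by apply: integrable_EFinZl; exact: integrable_envelope_mixture.
Qed.

Lemma cintegrable_mixture_product (f f' : C -> C) (K1 K2 : R) :
  0 <= K1 -> 0 <= K2 -> cmeasurable f -> cmeasurable f' ->
  (forall u, cabs (f u) <= K1 * expR (d * cabs u)) ->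
  (forall u, cabs (f' u) <= K2 * expR (d * cabs u)) ->
  cintegrable (fun u => f u * f' u * weightC u).
Proof.
move=> K10 K20 mf mf' hf hf'.
by have [] := @cmixture_product_dominated (fun=> f) (fun=> f') f f' K1 K2 K10 K20
  (fun=> mf) (fun=> mf') (fun u => ccvg_cst _) (fun u => ccvg_cst _) (fun=> hf) (fun=> hf').
Qed.

Lemma conj_power_le (k : nat) : exists2 K, 0 <= K &
  forall u : C, cabs (conjc u ^+ k) <= K * expR (d * cabs u).
Proof.
have [K K0 hK] := expn_le_expR k d0; exists K => // u.
by rewrite cabsX cabs_conj; apply: hK; exact: cabs_ge0.
Qed.

Lemma power_le (k : nat) : exists2 K, 0 <= K &
  forall u : C, cabs (u ^+ k) <= K * expR (d * cabs u).
Proof.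
have [K K0 hK] := expn_le_expR k d0; exists K => // u.
by rewrite cabsX; apply: hK; exact: cabs_ge0.
Qed.

(** The first exchange. The limit is computed twice, by domination and by the closed form of the sum
    over j, and uniqueness of limits identifies the results. *)
Lemma cintegral_conj_power_bessel (k : nat) :
  cintegrable (fun u => conjc u ^+ k * bessel_series nu (b%:C * u) * weightC u) /\
  cintegral (fun u => conjc u ^+ k * bessel_series nu (b%:C * u) * weightC u) =
    (mixture_bessel_moment nu q h b k)%:C.
Proof.
have [K1 K10 hK1] := conj_power_le k.
have [K2 K20 hK2] := bessel_growth b%:C nu1 d0.
have mk : cmeasurable (fun u : C => conjc u ^+ k).
  by apply: cmeasurableX; exact: cmeasurable_conj.
have mb : cmeasurable (fun u : C => b%:C * u).
  by apply: cmeasurableM; [exact: cmeasurable_cst|exact: cmeasurable_id].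
have [ci cc] := @cmixture_product_dominated (fun _ u => conjc u ^+ k)
  (fun n u => \sum_(0 <= j < n) bessel_term nu (b%:C * u) j) _
  (fun u => bessel_series nu (b%:C * u)) K1 K2 K10 K20 (fun=> mk)
  (fun n => cmeasurable_bessel_partial nu n mb) (fun u => ccvg_cst _)
  (fun u => ccvg_bessel_series _ nu1) (fun=> hK1) (fun n u => (hK2 u).1 n).
split=> //; apply: (ccvg_unique cc).
have cX := ccvg_real (cvg_mixture_bessel_moment (b := b) (k := k) nu1 q0 h0 hq).
apply: eq_ccvg cX => n.
have ij (j : nat) : cintegrable (fun u => u ^+ j * conjc u ^+ k * weightC u).
  have [K3 K30 hK3] := power_le j.
  apply: (cintegrable_mixture_product K30 K10 _ mk hK3 hK1).
  by apply: cmeasurableX; exact: cmeasurable_id.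
rewrite [RHS](eq_cintegral (g := fun u => \sum_(0 <= j < n)
  (b ^+ j * bessel_coeff nu j)%:C * (u ^+ j * conjc u ^+ k * weightC u))); last first.
  move=> u; rewrite mulr_sumr mulr_suml; apply: eq_bigr => j _.
  by rewrite /bessel_term exprMn rmorphM/= rmorphXn/=; ring.
rewrite cintegral_sum; last by move=> j; exact: cintegrableZl.
rewrite rmorph_sum/=; apply: eq_bigr => j _.
rewrite cintegralZl// rmorphM/=; congr (_ * _).
rewrite -(cintegral_mixture_moment j k nu1 q0 h0 hg gq).
by apply: eq_cintegral => u; rewrite /weightC mulrA.
Qed.

(** The second exchange. At this generality zeta is any complex number, b any nonzero or zero real;
    the theorem is one choice of parameters. *)
Lemma cintegral_bessel_bessel :
  let w := h ^+ 2 / (4 * q) in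
  let P := h / (2 * q * (1 - w)) in
  let f u := bessel_series nu (zeta * conjc u) * bessel_series nu (b%:C * u) * weightC u in
  cintegrable f /\
  cintegral f = (pi / q * (1 - w) `^ (- (nu + 1)) * expR (b * P))%:C *
    (cexp (P%:C * zeta) * bessel_series nu ((b * P / w)%:C * (P%:C * zeta))).
Proof.
move=> w P f.
have [K1 K10 hK1] := bessel_growth zeta nu1 d0.
have [K2 K20 hK2] := bessel_growth b%:C nu1 d0.
have mz : cmeasurable (fun u : C => zeta * conjc u).
  by apply: cmeasurableM; [exact: cmeasurable_cst|exact: cmeasurable_conj].
have mb : cmeasurable (fun u : C => bessel_series nu (b%:C * u)).
  apply: cmeasurable_bessel_series => //.
  by apply: cmeasurableM; [exact: cmeasurable_cst|exact: cmeasurable_id].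
have hz n u : cabs (\sum_(0 <= k < n) bessel_term nu (zeta * conjc u) k) <=
    K1 * expR (d * cabs u).
  by have [/(_ n)] := hK1 (conjc u); rewrite cabs_conj.
have [ci cc] := @cmixture_product_dominated
  (fun n u => \sum_(0 <= k < n) bessel_term nu (zeta * conjc u) k)
  (fun _ u => bessel_series nu (b%:C * u))
  (fun u => bessel_series nu (zeta * conjc u))
  (fun u => bessel_series nu (b%:C * u)) K1 K2 K10 K20
  (fun n => cmeasurable_bessel_partial nu n mz) (fun=> mb)
  (fun u => ccvg_bessel_series _ nu1) (fun u => ccvg_cst _) hz (fun=> fun u => (hK2 u).2).
split=> //; apply: (ccvg_unique cc).
set D := (pi / q * _ * _)%:C.
have [K K0 hK] := bessel_term_le nu1 ltr01.
have cX := ccvgM (ccvg_cst D) (ccvg_cauchy (hK _) (cexp_coeff_le _)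
  (@cvg_scaled_exp_series _ _ _) (is_cvg_series_exp_coeff _)
  (ccvg_bessel_series ((b * P / w)%:C * (P%:C * zeta)) nu1) (ccvg_cexp (P%:C * zeta))).
rewrite [X in _ * X]mulrC; apply: eq_ccvg cX => n.
have ik k := (cintegral_conj_power_bessel k).1.
rewrite [RHS](eq_cintegral (g := fun u => \sum_(0 <= k < n)
  (zeta ^+ k * (bessel_coeff nu k)%:C) *
    (conjc u ^+ k * bessel_series nu (b%:C * u) * weightC u))); last first.
  move=> u; rewrite !mulr_suml; apply: eq_bigr => k _.
  by rewrite /bessel_term exprMn; ring.
rewrite cintegral_sum; last by move=> k; exact: cintegrableZl.
rewrite mulr_sumr; apply: eq_bigr => k _.
rewrite cintegralZl// (cintegral_conj_power_bessel k).2.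
(* The Bessel coefficient of index k cancels Gamma (nu + 1 + k) and leaves 1 / k!. As C(k, i) / k! =
   1 / (i! (k - i)!), each term is a Bessel coefficient times an exponential one. *)
rewrite /mixture_bessel_moment -/w -/P.
rewrite cauchy_bessel_cexp /D.
move: (1 - w) (b * P / w) => lam Y; move: (expR (b * P)) (pi / q) (_ `^ _) => E A B.
transitivity (zeta ^+ k * (A * B * E * (P ^+ k *
  (\sum_(i < k.+1) Y ^+ i * bessel_coeff nu i / (k - i)`!%:R)))%:C).
  by rewrite [in RHS]rmorphM [X in _ = _ * (_ * X)]rmorphM/=; ring.
rewrite -[RHS]mulrA -rmorphM/=; congr (_ * _%:C).
rewrite !mulr_sumr; apply: eq_bigr => i _.
have ik' : (i <= k)%N by rewrite -ltnS.
rewrite (natr_bin ik') /bessel_coeff.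
have e1 (l : nat) : nu + l%:R + 1 = nu + 1 + l%:R by ring.
rewrite !e1; have G0 (l : nat) : Gamma (nu + 1 + l%:R) != 0.
  by rewrite Gamma_neq0// ltr_wpDr// -ltrBlDr sub0r.
have f0 l := @fact_neq0 R l.
move: (G0 k) (G0 i) (f0 k) (f0 i) (f0 (k - i)%N).
move: (Gamma _) (Gamma _) (k`!%:R) (i`!%:R) ((k - i)`!%:R) => Gk Gi fk fi fki g1 g2 f1 f2 f3.
by field; rewrite g1 g2 f1 f2 f3.
Qed.

End BesselMixtureIntegral.

(** * Principal powers *)

Section PrincipalPower.
Context {R : realType}.
Local Notation C := R[i].
Implicit Types (x y z : C) (r s t : R).

Definition cis t : C := cos t +i* sin t.

Lemma cisD s t : cis (s + t) = cis s * cis t.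
Proof. by apply: complex_ext; rewrite ?ReM ?ImM/= ?cosD ?sinD//; ring. Qed.

Lemma conjc_cis t : conjc (cis t) = cis (- t).
Proof. by rewrite /cis cosN sinN. Qed.

Lemma cabs_cis t : cabs (cis t) = 1.
Proof. by rewrite /cabs/= cos2Dsin2 sqrtr1. Qed.

Lemma cabs_eq0 x : (cabs x == 0) = (x == 0).
Proof.
apply/eqP/eqP => [|->]; first exact: ComplexField.Normc.eq0_normc.
exact: ComplexField.Normc.normc0.
Qed.

Lemma cabs_gt0 x : x != 0 -> 0 < cabs x.
Proof. by move=> x0; rewrite lt_neqAle cabs_ge0 eq_sym cabs_eq0 x0. Qed.

Lemma cpowE x s : cpow x s = (cabs x `^ s)%:C * cis (s * carg x).
Proof. by apply: complex_ext; rewrite ?ReM ?ImM/= ?mul0r ?subr0 ?addr0. Qed.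

Lemma carg_cis r t : 0 < r -> - pi < t <= pi -> carg (r%:C * cis t) = t.
Proof.
move=> r0 /andP[tl tu].
rewrite /carg cabsM cabs_real cabs_cis mulr1 (gtr0_norm r0) ReM ImM/= !mul0r subr0 addr0.
rewrite mulrAC mulfV ?gt_eqF// mul1r pmulr_rge0//.
have [t0|t0] := leP 0 t.
  by rewrite sin_ge0_pi ?t0// cosK// in_itv/= t0.
have tp : 0 < - t < pi by rewrite oppr_gt0 t0 ltrNl.
have := sin_gt0_pi tp; rewrite sinN oppr_gt0 ltNge => /negbTE ->.
by rewrite -cosN cosK ?opprK// in_itv/= !ltW//; case/andP: tp.
Qed.

Lemma sqr_cabs x : cabs x ^+ 2 = complex.Re x ^+ 2 + complex.Im x ^+ 2.
Proof. by case: x => a b; rewrite /cabs/= sqr_sqrtr// addr_ge0 ?sqr_ge0. Qed.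

Lemma Re_div_cabs_itv x : -1 <= complex.Re x / cabs x <= 1.
Proof.
have [->|x0] := eqVneq x 0; first by rewrite mul0r lerN10 ler01.
rewrite -ler_norml normrM normfV (ger0_norm (cabs_ge0 _)) ler_pdivrMr ?cabs_gt0//.
by rewrite mul1r normr_Re_le.
Qed.

Lemma polar x : x = (cabs x)%:C * cis (carg x).
Proof.
have [->|x0] := eqVneq x 0; first by rewrite /cabs ComplexField.Normc.normc0 mul0r.
have c0 := cabs_gt0 x0; have cn : cabs x != 0 by rewrite gt_eqF.
have xI := Re_div_cabs_itv x.
have si : sin (acos (complex.Re x / cabs x)) = `|complex.Im x| / cabs x.
  rewrite sin_acos// -[in RHS](gtr0_norm c0) -normf_div -sqrtr_sqr; congr Num.sqrt.
  by rewrite !expr_div_n -[1](@divff _ (cabs x ^+ 2)) ?expf_neq0// -mulrBl sqr_cabs addrAC subrr add0r.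
apply: complex_ext; rewrite ?ReM ?ImM/= ?mul0r ?subr0 ?addr0 /carg.
  have cE : cos (acos (complex.Re x / cabs x)) = complex.Re x / cabs x by rewrite acosK// in_itv.
  by case: ifP => _; rewrite ?cosN cE mulrC divfK.
case: ifPn => [i0|]; first by rewrite si ger0_norm// mulrC divfK.
rewrite -ltNge => i0; rewrite sinN si ltr0_norm// mulNr opprK mulrC divfK//.
Qed.

Lemma carg_itv x : - pi < carg x <= pi.
Proof.
have xI := Re_div_cabs_itv x; rewrite /carg; case: ifPn => [_|].
  rewrite acos_lepi// andbT; apply: lt_le_trans (acos_ge0 xI).
  by rewrite oppr_lt0 pi_gt0.
rewrite -ltNge => i0; apply/andP; split; last first.
  by apply: (le_trans _ (pi_ge0 R)); rewrite oppr_le0 acos_ge0.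
rewrite ltrN2 acos_ltpi//; case/andP: xI => xl ->; rewrite andbT lt_neqAle xl andbT.
(* The value - pi would require Re x = - |x|, hence Im x = 0, whereas Im x < 0 in this branch. *)
apply/eqP => e; have x0 : x != 0 by apply: contraTneq i0 => ->; rewrite ltxx.
have cx : complex.Re x = - cabs x.
  by rewrite -[LHS](divfK (lt0r_neq0 (cabs_gt0 x0))) -e mulN1r.
have /eqP := sqr_cabs x; rewrite cx sqrrN -subr_eq0 opprD addNKr oppr_eq0 sqrf_eq0.
by rewrite lt_eqF.
Qed.

Lemma cpow0 s : s != 0 -> cpow (0 : C) s = 0.
Proof. by move=> s0; rewrite cpowE /cabs ComplexField.Normc.normc0 powR0// mul0r. Qed.

Lemma cpowr0 x : cpow x 0 = 1.
Proof. by rewrite cpowE powRr0 mul0r /cis cos0 sin0 mul1r. Qed.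

Lemma cpowZ r x s : 0 < r -> cpow (r%:C * x) s = (r `^ s)%:C * cpow x s.
Proof.
move=> r0; have [->|x0] := eqVneq x 0.
  rewrite mulr0; have [->|s0] := eqVneq s 0; first by rewrite powRr0 mul1r.
  by rewrite cpow0// mulr0.
rewrite cpowE [X in carg (_ * X)]polar mulrA -rmorphM/= carg_cis ?carg_itv//; last first.
  by rewrite mulr_gt0// cabs_gt0.
rewrite cabsM cabs_real gtr0_norm// powRM ?cabs_ge0 ?ltW// rmorphM/= -mulrA.
by rewrite -cpowE.
Qed.

Lemma conjcM x y : conjc (x * y) = conjc x * conjc y.
Proof. exact: rmorphM. Qed.

Lemma cpow_mul_conj x y s : x != 0 -> y != 0 -> - pi < carg x - carg y <= pi ->
  cpow (x * conjc y) s = cpow x s * conjc (cpow y s).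
Proof.
move=> x0 y0 xy.
have e : x * conjc y = (cabs x * cabs y)%:C * cis (carg x - carg y).
  rewrite [in LHS](polar x) [in LHS](polar y) conjcM conjc_real conjc_cis cisD rmorphM/=.
  by ring.
rewrite !cpowE conjcM conjc_real conjc_cis e carg_cis// ?mulr_gt0 ?cabs_gt0//.
rewrite cabsM cabs_real cabs_cis mulr1 ger0_norm ?mulr_ge0 ?cabs_ge0//.
by rewrite powRM ?cabs_ge0// mulrBr cisD rmorphM/=; ring.
Qed.

Lemma carg_le_pihalf x : 0 <= complex.Re x -> carg x <= pi / 2.
Proof.
have p0 := pi_gt0 R; move=> x0; rewrite /carg; case: ifP => _; last first.
  have := acos_ge0 (Re_div_cabs_itv x); lra.
rewrite leNgt -ltr_cos ?in_itv/= ?acos_ge0 ?acos_lepi ?Re_div_cabs_itv//; last lra.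
by rewrite -leNgt cos_pihalf acosK ?in_itv/= ?Re_div_cabs_itv// divr_ge0// cabs_ge0.
Qed.

Lemma carg_gt_Npihalf x : (complex.Im x < 0 -> 0 < complex.Re x) -> 0 <= complex.Re x ->
  - (pi / 2) < carg x.
Proof.
have p0 := pi_gt0 R; move=> h x0; rewrite /carg; case: ifPn => [_|].
  have := acos_ge0 (Re_div_cabs_itv x); lra.
rewrite -ltNge => /h r0; have xn : x != 0 by apply: contraTneq r0 => ->; rewrite ltxx.
rewrite ltrN2 -ltr_cos ?in_itv/= ?acos_ge0 ?acos_lepi ?Re_div_cabs_itv//; last lra.
by rewrite cos_pihalf acosK ?in_itv/= ?Re_div_cabs_itv// divr_gt0// cabs_gt0.
Qed.

Lemma Re_sqrtc_ge0 x : 0 <= complex.Re (sqrtc x).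
Proof. by case: x => a b /=; exact: sqrtr_ge0. Qed.

(** This excludes the argument - pi / 2: the root of a negative real lies on the upper imaginary
    axis. The difference of the arguments of two roots is then strictly inside ]-pi, pi[. *)
Lemma Im_sqrtc_lt0 x : complex.Im (sqrtc x) < 0 -> 0 < complex.Re (sqrtc x).
Proof.
case: x => a b /=; have [->|b0 _] := eqVneq b 0.
  by rewrite mul1r ltNge sqrtr_ge0.
rewrite sqrtr_gt0 divr_gt0//.
suff : - a < Num.sqrt (a ^+ 2 + b ^+ 2) by lra.
apply: (le_lt_trans (ler_norm _)); rewrite normrN -sqrtr_sqr ltr_sqrt.
  by rewrite ltrDl exprn_even_gt0.
by rewrite ltr_wpDl ?sqr_ge0// exprn_even_gt0.
Qed.

(* Both square roots have argument in ]-pi/2, pi/2], so no branch cut is crossed. *)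
Lemma cpow_sqrtc_conj x y s :
  cpow (sqrtc x * conjc (sqrtc y)) s = cpow (sqrtc x) s * conjc (cpow (sqrtc y) s).
Proof.
have [->|s0] := eqVneq s 0; first by rewrite !cpowr0 conjc1 mul1r.
have [->|x0] := eqVneq x 0; first by rewrite sqrtc0 mul0r cpow0// mul0r.
have [->|y0] := eqVneq y 0.
  by rewrite sqrtc0 conjc0 mulr0 cpow0// conjc0 mulr0.
apply: cpow_mul_conj; rewrite ?sqrtc_eq0//.
have := carg_le_pihalf (Re_sqrtc_ge0 x); have := carg_le_pihalf (Re_sqrtc_ge0 y).
have := carg_gt_Npihalf (@Im_sqrtc_lt0 x) (Re_sqrtc_ge0 x).
have := carg_gt_Npihalf (@Im_sqrtc_lt0 y) (Re_sqrtc_ge0 y).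
move=> *; lra.
Qed.

Lemma cpow_conj_mul x s : conjc (cpow x s) * cpow x s = ((cabs x ^+ 2) `^ s)%:C.
Proof.
rewrite cpowE conjcM conjc_real conjc_cis mulrACA -cisD addNr /cis cos0 sin0.
by rewrite mulr1 -rmorphM/= -powRM ?cabs_ge0.
Qed.

Lemma sqr_cabs_sqrtc x : cabs (sqrtc x) ^+ 2 = cabs x.
Proof. by rewrite -cabsX sqr_sqrtc. Qed.

End PrincipalPower.

(** * The integral identity *)

Section OffOrigin.
Context {R : realType}.
Local Notation mT := (measurableTypeR R).

Lemma Rintegral_off_point (F G : mT * mT -> R) p0 : (forall p, p <> p0 -> F p = G p) ->
  planar.-integrable setT (EFin \o F) ->
  planar.-integrable setT (EFin \o G) /\ \int[planar]_p G p = \int[planar]_p F p.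
Proof.
move=> FG Fi; have mp : measurable [set p0].
  by case: p0 {FG} => x y; rewrite set1_prod; apply: measurableX; exact: measurable_set1.
have mF : measurable_fun setT F by apply/measurable_EFinP; case/integrableP: Fi.
(* Almost everywhere equality alone does not transfer measurability here; G is glued from F off the
   point and an arbitrary value on the singleton. *)
have mG : measurable_fun setT G.
  rewrite -(setvU [set p0]); apply/measurable_funU => //; first exact: measurableC.
  split; last exact: measurable_fun_set1.
  apply: (eq_measurable_fun F); last exact: measurable_funTS.
  by move=> p; rewrite inE => /FG.
have ae : ae_eq planar setT (EFin \o F) (EFin \o G).
  exists [set p0]; split=> //; first exact: planar_set1.
  by move=> p/= h; apply: contrapT => np; apply: h => _; rewrite FG.
split; first by apply: (ae_eq_integrable _ ae) => //; exact/measurable_EFinP.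
congr fine; apply/esym; apply: ae_eq_integral => //; exact/measurable_EFinP.
Qed.

(** At u = 0 the conventional values of [cpow], [besselK] and [mixture] need not fit together, so
    the integrands are identified only elsewhere. *)
Lemma cintegral_off_origin (f g : R[i] -> R[i]) : (forall u, u != 0 -> f u = g u) ->
  cintegrable f -> cintegrable g /\ cintegral g = cintegral f.
Proof.
move=> fg [f1 f2].
have e p : p <> (0, 0) -> f (p.1 +i* p.2) = g (p.1 +i* p.2).
  move=> p0; apply: fg; apply/eqP => -[e1 e2]; apply: p0.
  by rewrite (surjective_pairing p) e1 e2.
have [g1 i1] := @Rintegral_off_point (fun p => complex.Re (f (p.1 +i* p.2)))
  (fun p => complex.Re (g (p.1 +i* p.2))) (0, 0) (fun p h => congr1 _ (e p h)) f1.
have [g2 i2] := @Rintegral_off_point (fun p => complex.Im (f (p.1 +i* p.2)))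
  (fun p => complex.Im (g (p.1 +i* p.2))) (0, 0) (fun p h => congr1 _ (e p h)) f2.
by split=> //; apply: complex_ext; [exact: i1|exact: i2].
Qed.

End OffOrigin.

Section BesselReproducing.
Context {R : realType}.
Local Notation C := R[i].

Lemma cmixture_besselK (nu a : R) (u : C) : 0 < a -> u != 0 ->
  cmixture nu (a ^+ 2 / 4) u = 2 * (a * cabs u / 2) `^ nu * besselK nu (a * cabs u).
Proof.
move=> a0 u0; have x0 : 0 < a * cabs u by rewrite mulr_gt0// cabs_gt0.
have := integral_besselK nu x0; rewrite /cmixture /mixture /Rintegral /mixture_kernel.
rewrite (_ : (fun t : R => _) = fun t =>
  (expR (nu * t - 1 * expR t - a ^+ 2 / 4 * sqnorm (complex.Re u, complex.Im u) *
    expR (- t)))%:E).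
  by move=> ->.
by apply/funext => t; rewrite /sqnorm/= -sqr_cabs; congr (expR _)%:E; ring.
Qed.

Lemma powR_inv (a r : R) : 0 < a -> a^-1 `^ r = (a `^ r)^-1.
Proof.
move=> a0; rewrite -[LHS](mulfK (lt0r_neq0 (powR_gt0 r a0))).
by rewrite -powRM ?invr_ge0 ?ltW// mulVf ?gt_eqF// powR1 mul1r.
Qed.

Variables (alpha nu : R).
Hypotheses (alpha0 : 0 < alpha) (nu1 : -1 < nu).

Let q : R := (alpha / 3) ^+ 2 / 4.
Let q0 : 0 < q. Proof. by rewrite divr_gt0// exprn_gt0// divr_gt0. Qed.
Let h : R := - (alpha / 6).

(** The factors come, in order, from pulling alpha / 2 out of the first power, from the two
    normalisations in [besselI_entire], from the argument sqrt(u) / 2, and from trading |u|^nu K_nu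
    for the mixture. *)
Definition bessel_kernel_const : R :=
  (alpha / 2) `^ nu * 2 `^ (- nu) * 2 `^ (- nu) * 2^-1 `^ nu / (2 * (alpha / 6) `^ nu).

(** The quarter squares of the two Bessel arguments are (alpha^2 / 16) z conj(u) and u / 16. The
    only powers with branches left are those of sqrt(u) and its conjugate, which combine to
    |u|^nu. *)
Lemma bessel_kernelE (z u : C) : u != 0 ->
  ((alpha / 2) `^ nu)%:C * conjc (cpow (sqrtc u) nu) *
    besselI_entire nu ((alpha / 2)%:C * (sqrtc z * conjc (sqrtc u))) *
    besselI nu (sqrtc u / 2) *
    (expR (- (1 / 6 * alpha * complex.Re u)) * besselK nu (alpha * cabs u / 3))%:C =
  bessel_kernel_const%:C *
    (bessel_series nu ((alpha ^+ 2 / 16)%:C * z * conjc u) *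
     bessel_series nu ((16^-1)%:C * u) *
     ((expR (h * complex.Re u))%:C * (cmixture nu q u)%:C)).
Proof.
move=> u0; have c0 := cabs_gt0 u0.
have half : (2 : C)^-1 = (2^-1)%:C by rewrite fmorphV rmorph_nat.
have quarter : (4 : C)^-1 = (4^-1)%:C by rewrite fmorphV rmorph_nat.
have e1 : ((alpha / 2)%:C * (sqrtc z * conjc (sqrtc u))) ^+ 2 / 4 =
    (alpha ^+ 2 / 16)%:C * z * conjc u.
  have -> : conjc u = conjc (sqrtc u) ^+ 2 by rewrite -rmorphXn sqr_sqrtc.
  rewrite -[in RHS](sqr_sqrtc z) quarter !exprMn -rmorphXn/=.
  rewrite (_ : alpha ^+ 2 / 16 = (alpha / 2) ^+ 2 * 4^-1) ?rmorphM/=; last by field.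
  by ring.
have e2 : (sqrtc u / 2) ^+ 2 / 4 = (16^-1)%:C * u.
  rewrite -[in RHS](sqr_sqrtc u) quarter half exprMn -rmorphXn/= -mulrA -rmorphM/= mulrC.
  by congr (_%:C * _); field.
have e3 : cpow (sqrtc u / 2) nu = (2^-1 `^ nu)%:C * cpow (sqrtc u) nu.
  by rewrite half mulrC cpowZ.
have e4 : expR (- (1 / 6 * alpha * complex.Re u)) = expR (h * complex.Re u).
  by congr expR; rewrite /h; field.
have e5 : cabs u `^ nu * besselK nu (alpha * cabs u / 3) =
    (2 * (alpha / 6) `^ nu)^-1 * cmixture nu q u.
  have a30 : 0 < alpha / 3 by rewrite divr_gt0.
  rewrite (cmixture_besselK nu a30 u0) (_ : alpha / 3 * cabs u / 2 = alpha / 6 * cabs u).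
    rewrite (powRM nu (ltW (divr_gt0 alpha0 _)) (cabs_ge0 u))// (mulrAC alpha).
    have : (alpha / 6) `^ nu != 0 by rewrite gt_eqF// powR_gt0// divr_gt0.
    by move=> x0; field.
  by field.
rewrite /besselI !besselI_entireE e1 e2 e3 e4.
move: (bessel_series _ _) (bessel_series _ _) => X Y.
transitivity (((alpha / 2) `^ nu)%:C * (2 `^ (- nu))%:C * (2 `^ (- nu))%:C *
  (2^-1 `^ nu)%:C * (X * Y) * (expR (h * complex.Re u))%:C *
  (conjc (cpow (sqrtc u) nu) * cpow (sqrtc u) nu * (besselK nu (alpha * cabs u / 3))%:C)).
  by rewrite rmorphM/=; ring.
rewrite cpow_conj_mul sqr_cabs_sqrtc -[X in _ * X = _](rmorphM (real_complex R))/= e5.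
rewrite /bessel_kernel_const.
by rewrite !rmorphM/=; ring.
Qed.

Let c : R := alpha ^+ 2 * expR (1 / (4 * alpha)) / (3 * pi * 2 ^+ 3).

(** Here 3 / 4 is 1 - w. All powers are expressed through 2^nu, 3^nu and (alpha / 2)^nu, after which
    the identity is rational in nonzero atoms. *)
Lemma bessel_reproducing_const :
  c * (bessel_kernel_const * (pi / q * (3 / 4) `^ (- (nu + 1)) * expR (- (1 / (4 * alpha))))) =
  2 `^ (- nu).
Proof.
have p0 := pi_gt0 R; have a2 : 0 < alpha / 2 by rewrite divr_gt0.
have t0 : 0 < 2 `^ nu :> R by exact: powR_gt0.
have s0 : 0 < 3 `^ nu :> R by exact: powR_gt0.
have x0 : 0 < (alpha / 2) `^ nu by exact: powR_gt0.
have e0 : 0 < expR (1 / (4 * alpha)) by exact: expR_gt0.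
have x6 : (alpha / 6) `^ nu = (alpha / 2) `^ nu / 3 `^ nu.
  rewrite (_ : alpha / 6 = alpha / 2 * 3^-1); last by field.
  by rewrite powRM ?invr_ge0 ?(ltW a2)// powR_inv.
have w34 : (3 / 4) `^ (- (nu + 1)) = (2 `^ nu) ^+ 2 / 3 `^ nu * (4 / 3) :> R.
  rewrite powRN powRD; last by apply/implyP => _; rewrite gt_eqF// divr_gt0.
  rewrite powRr1 ?divr_ge0// (_ : 3 / 4 = 3 * 2^-1 * 2^-1 :> R); last by field.
  rewrite !powRM ?mulr_ge0 ?invr_ge0// powR_inv//.
  by field; rewrite !gt_eqF.
rewrite /c /bessel_kernel_const /q x6 w34 powR_inv// powRN expRN.
move: (powR _ _) (powR _ _) (powR _ _) (expR _) x0 t0 s0 e0 => X T S E.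
move=> /lt0r_neq0 X0 /lt0r_neq0 T0 /lt0r_neq0 S0 /lt0r_neq0 E0.
have pn := lt0r_neq0 p0; have an := lt0r_neq0 alpha0.
move: pi pn => p pn; field.
by rewrite X0 T0 S0 E0 pn an.
Qed.

Lemma bessel_reproducing (z : C) :
  let G (u : C) : C := ((alpha / 2) `^ nu)%:C * conjc (cpow (sqrtc u) nu) *
    besselI_entire nu ((alpha / 2)%:C * (sqrtc z * conjc (sqrtc u))) *
    besselI nu (sqrtc u / 2) *
    (expR (- (1 / 6 * alpha * complex.Re u)) * besselK nu (alpha * cabs u / 3))%:C in
  cintegrable G /\
  cexp (- (alpha%:C * z / 4)) * besselI_entire nu (sqrtc z) = c%:C * cintegral G.
Proof.
move=> G; have h0 : h != 0 by rewrite oppr_eq0 gt_eqF// divr_gt0.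
(* The rate alpha / 5 lies strictly between |h| = alpha / 6 and sqrt(2 q) = alpha / sqrt(18). *)
have hg : `|h| < alpha / 5.
  by rewrite normrN gtr0_norm ?divr_gt0//; move: alpha0; lra.
have gq : (alpha / 5) ^+ 2 < 2 * q.
  have a20 : 0 < alpha ^+ 2 by exact: exprn_gt0.
  rewrite (_ : (alpha / 5) ^+ 2 = alpha ^+ 2 / 25); last by field.
  rewrite (_ : 2 * q = alpha ^+ 2 / 18); last by rewrite /q; field.
  by move: a20; lra.
have := @cintegral_bessel_bessel R nu q h (alpha / 5) 16^-1 ((alpha ^+ 2 / 16)%:C * z)
  nu1 q0 h0 hg gq.
rewrite /=; set f := (fun u : C => _) => -[fi fE].
have [Gi GE] : cintegrable G /\ cintegral G = cintegral (fun u => bessel_kernel_const%:C * f u).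
  apply: cintegral_off_origin; last exact: cintegrableZl.
  by move=> u u0; rewrite /G bessel_kernelE.
split; first exact: Gi.
rewrite GE (cintegralZl _ fi) fE.
have an : alpha != 0 by rewrite gt_eqF.
have alphaC : alpha%:C != 0 by rewrite (fmorph_eq0 (real_complex R)).
(* With w = 1/4, P = - 4 / alpha, b = 1/16 and zeta = alpha^2 z / 16, one gets b P = - 1 / (4
   alpha), P zeta = - alpha z / 4 and (b P / w) P zeta = z / 4: the constant, the exponential and
   the Bessel argument of the left-hand side. *)
have ew : h ^+ 2 / (4 * q) = 4^-1 by rewrite /h /q; field.
have eP : h / (2 * q * (1 - h ^+ 2 / (4 * q))) = - (4 / alpha).
  by rewrite ew /h /q; field.
have quarter : (4 : C)^-1 = (4^-1)%:C by rewrite fmorphV rmorph_nat.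
rewrite eP ew (_ : 1 - 4^-1 = 3 / 4 :> R); last by field.
have eb : 16^-1 * - (4 / alpha) = - (1 / (4 * alpha)) by field.
rewrite eb besselI_entireE sqr_sqrtc -bessel_reproducing_const.
have -> : (- (4 / alpha))%:C * ((alpha ^+ 2 / 16)%:C * z) = - (alpha%:C * z / 4).
  rewrite (rmorphN (real_complex R)) !(rmorphM (real_complex R)) !(fmorphV (real_complex R)).
  rewrite !(rmorph_nat (real_complex R))/=.
  by field; rewrite alphaC.
have -> : (- (1 / (4 * alpha)) / 4^-1)%:C * - (alpha%:C * z / 4) = z / 4.
  rewrite (_ : - (1 / (4 * alpha)) / 4^-1 = - alpha^-1); last by field.
  rewrite (rmorphN (real_complex R)) (fmorphV (real_complex R))/=.
  by field; rewrite alphaC.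
move: (bessel_series _ _) (cexp _) => X Y.
move: c bessel_kernel_const (_ * expR _) => a1 a2 a3.
by rewrite !(rmorphM (real_complex R))/=; ring.
Qed.

End BesselReproducing.

Unset Implicit Arguments.
(* The first conjunct is the identity with principal branches. As
   [sqrtc z * conjc (sqrtc u)] has argument in ]-pi, pi[, its principal power is
   [cpow (sqrtc z) nu * conjc (cpow (sqrtc u) nu)]. The second conjunct is the
   identity after cancelling [cpow (sqrtc z) nu]; it is the one with content at
   [z = 0] when [nu != 0]. *)
Theorem mainTheorem7 (R : realType) (alpha nu : R) (halpha : 0 < alpha)
    (hnu : -1 < nu) (z : R[i]) :
  let c : R := alpha ^+ 2 * expR (1 / (4 * alpha)) / (3 * pi * 2 ^+ 3) in
  let weight (u : R[i]) : R :=
    expR (- (1 / 6 * alpha * complex.Re u)) * besselK nu (alpha * cabs u / 3) in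
  let F (u : R[i]) : R[i] :=
    besselI nu ((alpha / 2)%:C * (sqrtc z * conjc (sqrtc u))) *
    besselI nu (sqrtc u / 2) * (weight u)%:C in
  let G (u : R[i]) : R[i] :=
    ((alpha / 2) `^ nu)%:C * conjc (cpow (sqrtc u) nu) *
    besselI_entire nu ((alpha / 2)%:C * (sqrtc z * conjc (sqrtc u))) *
    besselI nu (sqrtc u / 2) * (weight u)%:C in
  (cintegrable F /\
   cexp (- (alpha%:C * z / 4)) * besselI nu (sqrtc z) = c%:C * cintegral F) /\
  (cintegrable G /\
   cexp (- (alpha%:C * z / 4)) * besselI_entire nu (sqrtc z) =
     c%:C * cintegral G).
Proof.
move=> c weight F G.
have [Gi GE] : cintegrable G /\
    cexp (- (alpha%:C * z / 4)) * besselI_entire nu (sqrtc z) = c%:C * cintegral G.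
  have := bessel_reproducing halpha hnu z; rewrite /= => -[Gi GE].
  by split; [exact: Gi|exact: GE].
(* The power of sqrt(z) does not depend on u, so the identity for F is that for G multiplied by a
   constant; this also covers z = 0. *)
have FG : F =1 (fun u => cpow (sqrtc z) nu * G u).
  move=> u; rewrite /F /G {1}/besselI cpowZ ?divr_gt0// cpow_sqrtc_conj.
  by move: (besselI _ _) (besselI_entire _ _) (weight u) => X Y W; ring.
split; last by split.
split; first by rewrite (funext FG); exact: cintegrableZl.
by rewrite (eq_cintegral FG) cintegralZl// mulrCA GE /besselI mulrCA.
Qed.
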